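(* Let $\Omega\subset\mathbb C$ be a simply connected domain, let $A\in M^{2\times2}(\Omega)$, and let $\Omega$ be a volume-preserving $A$-quasiconformal $\infty$-regular domain. Then $$\lambda_1(A,\Omega)\ge\lambda_1(\mathbb D).$$
   Context: Write $z=x+iy$; $\mathbb D\subset\mathbb C$ is the unit disc. The class $M^{2\times2}(\Omega)$: all symmetric $2\times2$ real matrix functions $A(z)=\{a_{kl}(z)\}$ on $\Omega$ with measurable entries, $\det A=1$ a.e., and, for some constant $1\le K<\infty$, $\frac1K|\xi|^2\le\langle A(z)\xi,\xi\rangle\le K|\xi|^2$ for a.e. $z\in\Omega$ and all $\xi\in\mathbb C\cong\mathbb R^2$. $A$-quasiconformal mapping: a quasiconformal homeomorphism $\varphi:\Omega\to\widetilde\Omega$ satisfying the Beltrami equation $\varphi_{\bar z}=\mu\,\varphi_z$ a.e. in $\Omega$ with $\mu(z)=\dfrac{a_{22}(z)-a_{11}(z)-2ia_{12}(z)}{\det(I+A(z))}$, $I$ the identity matrix. Here a homeomorphism $\varphi$ is quasiconformal if $\varphi\in W^{1,2}_{\mathrm{loc}}(\Omega)$ and $|D\varphi(z)|^2\le K'|J(z,\varphi)|$ for a.e. $z\in\Omega$ for some constant $K'<\infty$; $J(z,\varphi)$ is the Jacobian determinant. A simply connected domain $\Omega$ is $A$-quasiconformal $\infty$-regular (about $\mathbb D$) if $J(\cdot,\varphi^{-1})\in L^\infty(\mathbb D)$, where $\varphi:\Omega\to\mathbb D$ is a corresponding $A$-quasiconformal mapping. It is called volume-preserving if moreover $|J(z,\varphi)|=1$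 for (almost every) $z\in\Omega$ for such an $A$-quasiconformal mapping $\varphi:\Omega\to\mathbb D$. First Dirichlet eigenvalue: $W^{1,2}_0(\Omega,A)$ is the closure of $C_0^\infty(\Omega)$ in the norm $\|f\,|\,L^2(\Omega)\|+\left(\iint_\Omega\langle A\nabla f,\nabla f\rangle\,dx\,dy\right)^{1/2}$, and $$\lambda_1(A,\Omega)=\inf_{f\in W^{1,2}_0(\Omega,A)\setminus\{0\}}\frac{\iint_\Omega\langle A(z)\nabla f(z),\nabla f(z)\rangle\,dx\,dy}{\iint_\Omega|f(z)|^2\,dx\,dy}.$$ $\lambda_1(\mathbb D)=\lambda_1(I,\mathbb D)$ is the first Dirichlet eigenvalue of the Laplacian in $\mathbb D$. *)

(* Defs.v *)
From HB Require Import structures.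
From mathcomp Require Import all_boot all_order all_algebra.
From mathcomp Require Import complex.
From mathcomp Require Import all_classical all_reals all_analysis.
From mathcomp Require Import measurable_realfun.
Set Implicit Arguments.
Unset Strict Implicit.
Unset Printing Implicit Defensive.
Import Order.TTheory GRing.Theory Num.Theory.
Import numFieldNormedType.Exports.
Local Open Scope classical_set_scope.
Local Open Scope ring_scope.

(* Points of the plane are pairs z = (x, y) : R * R, so that the product
   topology and the product measure are available; vectors (gradients, xi) are
   columns 'cV[R]_2, on which matrices act by *m. The library norm of R * R is
   the max norm: only its topology is used, Euclidean norms are written out. *)

Notation area R := (@lebesgue_measure R \x @lebesgue_measure R)%E.

Definition inner (R : realType) (u v : 'cV[R]_2) : R := \sum_i u i 0 * v i 0.

Definition enorm (R : realType) (u : 'cV[R]_2) : R := Num.sqrt (inner u u).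

Definition opnorm (R : realType) (M : 'M[R]_2) : R :=
  sup [set enorm (M *m xi) | xi in [set xi | enorm xi = 1]].

Definition unit_disc (R : realType) : set (R * R) :=
  [set z | z.1 ^+ 2 + z.2 ^+ 2 < 1].
Arguments unit_disc R : clear implicits.

Definition simply_connected_domain (R : realType) (Omega : set (R * R)) : Prop :=
  [/\ open Omega, Omega !=set0, connected Omega &
      forall gamma : R -> R * R,
        {within `[0, 1], continuous gamma} -> gamma @` `[0, 1] `<=` Omega ->
        gamma 0 = gamma 1 ->
        exists H : R * R -> R * R,
          [/\ {within `[0, 1] `*` `[0, 1], continuous H},
              H @` (`[0, 1] `*` `[0, 1]) `<=` Omega,
              forall t : R, t \in `[0, 1] -> H (0, t) = gamma t,
              forall t : R, t \in `[0, 1] -> H (1, t) = gamma 0 &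
              forall s : R, s \in `[0, 1] -> H (s, 0) = gamma 0 /\ H (s, 1) = gamma 0]].

(* Index 0 is the x direction, index 1 the y direction. *)

Definition plane_coord (R : realType) (i : 'I_2) (z : R * R) : R :=
  if i == 0 then z.1 else z.2.

Definition basis_vec (R : realType) (j : 'I_2) : R * R :=
  ((j == 0)%:R, (j == 1)%:R).

Definition partial (R : realType) (j : 'I_2) (h : R * R -> R) : R * R -> R :=
  fun z => 'D_(basis_vec R j) h z.

Fixpoint iter_partial (R : realType) (s : seq 'I_2) (h : R * R -> R) :
    R * R -> R :=
  if s is j :: s' then partial j (iter_partial s' h) else h.

Definition smooth (R : realType) (h : R * R -> R) : Prop :=
  forall s : seq 'I_2, continuous (iter_partial s h) /\
    forall j z, derivable (iter_partial s h) z (basis_vec R j).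

(* C_0^oo(Omega), its elements being extended by 0 to the whole plane. *)
Definition test_function (R : realType) (Omega : set (R * R))
    (h : R * R -> R) : Prop :=
  [/\ smooth h, compact (closure [set z | h z != 0]) &
      closure [set z | h z != 0] `<=` Omega].

Definition grad (R : realType) (h : R * R -> R) : R * R -> 'cV[R]_2 :=
  fun z => \col_j partial j h z.

(* "measurable" in the library's instance on R * R is Borel measurable. The
   coefficients A are only required to be Lebesgue measurable, that is,
   measurable for the completed sigma-algebra. The library integral remains the
   Lebesgue integral for such integrands: the supremum of the integrals of Borel
   simple functions below a nonnegative Lebesgue measurable function is the
   integral of any Borel function that is a.e. equal to it. *)
Definition lebesgue_measurable_fun (R : realType) (Omega : set (R * R))
    (f : R * R -> R) : Prop :=
  forall B : set R, measurable B ->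
    completed_algebra_gen (area R) (Omega `&` f @^-1` B).

(* Elements of the Lebesgue and Sobolev spaces, and weak derivatives, are a.e.
   equivalence classes; they are given by Borel representatives. *)

Definition Lploc (R : realType) (p : nat) (Omega : set (R * R))
    (f : R * R -> R) : Prop :=
  measurable_fun Omega f /\
  forall K : set (R * R), compact K -> K `<=` Omega ->
    (\int[area R]_(z in K) (`|f z| ^+ p)%:E < +oo)%E.

Definition weak_partial (R : realType) (Omega : set (R * R)) (j : 'I_2)
    (f g : R * R -> R) : Prop :=
  [/\ Lploc 1 Omega f, Lploc 1 Omega g &
      forall h, test_function Omega h ->
        \int[area R]_(z in Omega) (f z * partial j h z) =
        - \int[area R]_(z in Omega) (g z * h z)].

Definition weak_gradient (R : realType) (Omega : set (R * R))
    (f : R * R -> R) (g : R * R -> 'cV[R]_2) : Prop :=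
  forall j, weak_partial Omega j f (fun z => g z j 0).

(* Dphi z i j is the derivative of the i-th component in direction j; the
   Jacobian J(z, phi) is \det (Dphi z). *)
Definition weak_differential (R : realType) (Omega : set (R * R))
    (phi : R * R -> R * R) (Dphi : R * R -> 'M[R]_2) : Prop :=
  forall i j, weak_partial Omega j (fun z => plane_coord i (phi z))
                                   (fun z => Dphi z i j).

Definition W12loc (R : realType) (Omega : set (R * R))
    (phi : R * R -> R * R) (Dphi : R * R -> 'M[R]_2) : Prop :=
  [/\ weak_differential Omega phi Dphi,
      forall i, Lploc 2 Omega (fun z => plane_coord i (phi z)) &
      forall i j, Lploc 2 Omega (fun z => Dphi z i j)].

Definition M22 (R : realType) (Omega : set (R * R))
    (A : R * R -> 'M[R]_2) : Prop :=
  [/\ forall z, Omega z -> (A z)^T = A z,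
      forall k l, lebesgue_measurable_fun Omega (fun z => A z k l),
      {ae area R, forall z, Omega z -> \det (A z) = 1} &
      exists2 K : R, 1 <= K &
        {ae area R, forall z, Omega z -> forall xi : 'cV[R]_2,
          K^-1 * enorm xi ^+ 2 <= inner (A z *m xi) xi <= K * enorm xi ^+ 2}].

(* psi is the inverse homeomorphism; values outside Omega and Omega' are
   irrelevant. *)
Definition homeomorphism (R : realType) (Omega Omega' : set (R * R))
    (phi psi : R * R -> R * R) : Prop :=
  [/\ {within Omega, continuous phi} /\ {within Omega', continuous psi},
      phi @` Omega `<=` Omega', psi @` Omega' `<=` Omega,
      {in Omega, cancel phi psi} & {in Omega', cancel psi phi}].

Definition quasiconformal (R : realType) (Omega Omega' : set (R * R))
    (phi psi : R * R -> R * R) (Dphi : R * R -> 'M[R]_2) : Prop :=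
  [/\ homeomorphism Omega Omega' phi psi, W12loc Omega phi Dphi &
      exists K' : R, {ae area R, forall z, Omega z ->
        opnorm (Dphi z) ^+ 2 <= K' * `|\det (Dphi z)|}].

(* phi_z = (phi_x - i phi_y) / 2 and phi_zbar = (phi_x + i phi_y) / 2 for the
   complex-valued function phi = phi_1 + i phi_2 with differential D. *)

Definition dz (R : realType) (D : 'M[R]_2) : R[i] :=
  ((D 0 0 +i* D 1 0) - (0 +i* 1) * (D 0 1 +i* D 1 1))%C / 2.

Definition dzbar (R : realType) (D : 'M[R]_2) : R[i] :=
  ((D 0 0 +i* D 1 0) + (0 +i* 1) * (D 0 1 +i* D 1 1))%C / 2.

Definition beltrami_coef (R : realType) (M : 'M[R]_2) : R[i] :=
  ((M 1 1 - M 0 0) +i* (- (2 * M 0 1)))%C / (\det (1%:M + M))%:C%C.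

Definition A_quasiconformal (R : realType) (A : R * R -> 'M[R]_2)
    (Omega Omega' : set (R * R)) (phi psi : R * R -> R * R)
    (Dphi : R * R -> 'M[R]_2) : Prop :=
  quasiconformal Omega Omega' phi psi Dphi /\
  {ae area R, forall z, Omega z ->
    dzbar (Dphi z) = beltrami_coef (A z) * dz (Dphi z)}.

Definition ess_bounded (R : realType) (Omega : set (R * R))
    (f : R * R -> R) : Prop :=
  exists M : R, {ae area R, forall z, Omega z -> `|f z| <= M}.

(* Omega is A-quasiconformal oo-regular, as witnessed by phi. For J(., psi) to
   be defined, psi = phi^-1 must be weakly differentiable; this holds for every
   quasiconformal homeomorphism. *)
Definition infty_regular_by (R : realType) (A : R * R -> 'M[R]_2)
    (Omega : set (R * R)) (phi psi : R * R -> R * R)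
    (Dphi Dpsi : R * R -> 'M[R]_2) : Prop :=
  [/\ A_quasiconformal A Omega (unit_disc R) phi psi Dphi,
      weak_differential (unit_disc R) psi Dpsi &
      ess_bounded (unit_disc R) (fun w => \det (Dpsi w))].

Definition volume_preserving_infty_regular (R : realType)
    (A : R * R -> 'M[R]_2) (Omega : set (R * R)) : Prop :=
  exists phi psi Dphi Dpsi,
    infty_regular_by A Omega phi psi Dphi Dpsi /\
    {ae area R, forall z, Omega z -> `|\det (Dphi z)| = 1}.

Definition sqL2norm (R : realType) (Omega : set (R * R))
    (f : R * R -> R) : \bar R :=
  (\int[area R]_(z in Omega) (`|f z| ^+ 2)%:E)%E.

Definition energy (R : realType) (A : R * R -> 'M[R]_2) (Omega : set (R * R))
    (g : R * R -> 'cV[R]_2) : \bar R :=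
  (\int[area R]_(z in Omega) (inner (A z *m g z) (g z))%:E)%E.

Definition W12norm (R : realType) (A : R * R -> 'M[R]_2) (Omega : set (R * R))
    (f : R * R -> R) (g : R * R -> 'cV[R]_2) : \bar R :=
  (sqrte (sqL2norm Omega f) + sqrte (energy A Omega g))%E.

(* f, with weak gradient g, lies in the closure of C_0^oo(Omega). *)
Definition W120 (R : realType) (A : R * R -> 'M[R]_2) (Omega : set (R * R))
    (f : R * R -> R) (g : R * R -> 'cV[R]_2) : Prop :=
  [/\ weak_gradient Omega f g, (W12norm A Omega f g < +oo)%E &
      forall e : R, 0 < e -> exists2 h, test_function Omega h &
        (W12norm A Omega (fun z => f z - h z)%R
                         (fun z => g z - grad h z)%R < e%:E)%E].

Definition lambda1 (R : realType) (A : R * R -> 'M[R]_2)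
    (Omega : set (R * R)) : \bar R :=
  ereal_inf [set q | exists f g,
    [/\ W120 A Omega f g,
        ~ {ae area R, forall z, Omega z -> f z = 0} &
        q = (energy A Omega g / sqL2norm Omega f)%E]].

(* Main.v *)
Require Import Defs.
From mathcomp Require Import all_boot all_order all_algebra.
From mathcomp Require Import complex.
From mathcomp Require Import all_classical all_reals all_analysis.
From mathcomp Require Import measurable_realfun.
From mathcomp Require Import ring lra.
Set Implicit Arguments.
Unset Strict Implicit.
Unset Printing Implicit Defensive.
Import Order.TTheory GRing.Theory Num.Theory.
Import numFieldNormedType.Exports.
Local Open Scope classical_set_scope.
Local Open Scope ring_scope.

(** The comparison takes place at the level of Rayleigh quotients: with [t0] a
    quarter of the first eigenvalue of the disc, every quotient on [Omega] is at
    least [4 t0], while test functions on the disc have quotients close to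
    [4 t0].

    Pointwise algebra. Write [D] for the differential of [phi]. As [A] is
    symmetric, positive and of determinant one, the Beltrami equation says
    [D A = cof D], so that [det D] is a value of the quadratic form of [A] and is
    nonnegative. Volume preservation thus gives [det D = 1] almost everywhere,
    whence [A = adj(D) adj(D)^T] and [<A g, g> = |adj(D)^T g|^2], with [D]
    bounded ([beltrami_unimodular]).

    Lower bound. Let [f] be the power series with [f(s^2 / 4) = J_0(s)], so that
    [u = f(t |w|^2)] solves [Laplace u = - 4 t u]. If [f > 0] on [0, t], the
    field [F = grad u / u] is smooth on the closed disc and satisfies
    [div F + |F|^2 = - 4 t] ([riccati_field]). For a test function [h] on
    [Omega], expand [0 <= |adj(D)^T grad h - h F(phi)|^2] and integrate. The cross
    term is [- grad(h^2) . adj(D) F(phi)]; Piola's identity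
    [div (adj(D) F(phi)) = det D (div F)(phi)] turns it into
    [h^2 (div F)(phi)], and there remains
    [4 t int h^2 <= int <A grad h, grad h>] ([picone_map]). This is Picone's, or
    Barta's, argument, carried from the disc to [Omega] by [phi]. It extends to
    the closure of the test functions ([rayleigh_closure]).

    Piola's identity for the Sobolev map [phi] ([piola_weak]) comes from the
    smooth one by mollification: [D] is bounded, so dominated convergence
    suffices once the mollified derivatives converge almost everywhere.

    Upper bound. Here [t0] is the first zero of [f]. Multiplying the eigenfunction
    [f(t0 |z|^2)] by cutoffs gives test functions on the disc whose quotients
    tend to [4 t0] ([lambda1_disc_le]). Letting [t] increase to [t0] in the lower
    bound concludes. *)

(** * Directional derivatives in the plane *)

Section directional.
Variable R : realType.
Implicit Types (z : R * R) (j : 'I_2).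

Lemma ord2P (i : 'I_2) : i = 0 \/ i = 1.
Proof. by case: i => -[|[|]]// ?; [left|right]; exact: val_inj. Qed.

Lemma is_derive_line (V W : normedModType R) (f : V -> W) (z v : V) (d : W) :
  is_derive z v f d <-> is_derive (0 : R) 1 (fun h : R => f (h *: v + z)) d.
Proof.
have E : (fun h : R => h^-1 *: ((f \o shift z) (h *: v) - f z)) =
  (fun h : R => h^-1 *: (((fun h : R => f (h *: v + z)) \o shift 0) (h *: 1)
                          - f (0 *: v + z))).
  by apply/funext => h /=; rewrite scale0r add0r addr0 [h *: 1]mulr1.
by split=> -[df dv]; split; move: df dv; rewrite /derivable /derive E.
Qed.

Lemma is_derive_slice (f : R * R -> R) z d :
  (is_derive z (basis_vec R 0) f d <-> is_derive z.1 1 (fun s => f (s, z.2)) d)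
  /\ (is_derive z (basis_vec R 1) f d <->
      is_derive z.2 1 (fun s => f (z.1, s)) d).
Proof.
case: z => x y; split; rewrite is_derive_line [X in _ <-> X]is_derive_line.
  have -> // : (fun h : R => f (h *: basis_vec R 0 + (x, y))) =
               (fun h : R => f (h *: 1 + (x, y).1, (x, y).2)).
  apply/funext => h; congr (f _); rewrite /basis_vec /= /GRing.scale /=.
  by rewrite /GRing.add /= /add_pair /= /scale_pair /= [_ *: 0]mulr0 add0r.
have -> // : (fun h : R => f (h *: basis_vec R 1 + (x, y))) =
             (fun h : R => f ((x, y).1, h *: 1 + (x, y).2)).
apply/funext => h; congr (f _); rewrite /basis_vec /= /GRing.scale /=.
by rewrite /GRing.add /= /add_pair /= /scale_pair /= [_ *: 0]mulr0 add0r.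
Qed.

Lemma is_derive_chain (f : R * R -> R) (g : R -> R) z v d e :
  is_derive z v f d -> is_derive (f z) 1 g e -> is_derive z v (g \o f) (e * d).
Proof.
move=> /is_derive_line fd ge; apply/is_derive_line.
apply: (@is_derive1_comp _ g (fun h : R => f (h *: v + z)) 0) => //.
by rewrite scale0r add0r.
Qed.

Lemma is_deriveMm (f g : R * R -> R) z v df dg :
  is_derive z v f df -> is_derive z v g dg ->
  is_derive z v (fun x => f x * g x) (f z * dg + g z * df).
Proof. exact: is_deriveM. Qed.

Lemma is_deriveDd (f g : R * R -> R) z v df dg :
  is_derive z v f df -> is_derive z v g dg ->
  is_derive z v (fun x => f x + g x) (df + dg).
Proof. exact: is_deriveD. Qed.

Lemma partial_val j f z d : is_derive z (basis_vec R j) f d -> partial j f z = d.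
Proof. by case. Qed.

Lemma is_derive_partial j f z : derivable f z (basis_vec R j) ->
  is_derive z (basis_vec R j) f (partial j f z).
Proof. by move=> df; apply: DeriveDef. Qed.

Lemma derive1_continuous (g dg : R -> R) :
  (forall x : R, is_derive x 1 g (dg x)) -> continuous g.
Proof.
by move=> gd x; apply: differentiable_continuous; apply/derivable1_diffP; case: (gd x).
Qed.

Lemma le_derive1_lip (g dg : R -> R) (C : R) :
  (forall x : R, is_derive x 1 g (dg x)) -> (forall x, `|dg x| <= C) ->
  forall x y, `|g x - g y| <= C * `|x - y|.
Proof.
move=> gd gC x y; wlog xy : x y / y <= x => [H|].
  have [/H//|/ltW xy] := leP y x.
  by rewrite distrC (distrC x); exact: H.
have cg : {within `[y, x], continuous g}.
  by apply: continuous_subspaceT; exact: derive1_continuous gd.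
have [c _ ->] := MVT_segment xy (fun t _ => gd t) cg.
by rewrite normrM ler_wpM2r.
Qed.

(** Bounded partial derivatives make a function Lipschitz, hence jointly
    continuous: move along one axis at a time. Partial derivatives alone would
    not give joint continuity, which smoothness of convolutions requires. *)
Lemma bounded_partial_continuous (G : R * R -> R) (dG : 'I_2 -> R * R -> R)
    (C : R) :
  (forall j z, is_derive z (basis_vec R j) G (dG j z)) ->
  (forall j z, `|dG j z| <= C) -> continuous G.
Proof.
move=> Gd GC.
have C0 : 0 <= C by apply: le_trans (GC 0 0).
have lip z w : `|G z - G w| <= C *+ 2 * `|z - w|.
  have -> : G z - G w = (G (z.1, z.2) - G (w.1, z.2)) + (G (w.1, z.2) - G (w.1, w.2)).
    by rewrite addrA subrK -!surjective_pairing.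
  apply: le_trans (ler_normD _ _) _; rewrite mulr2n mulrDl; apply: lerD.
    apply: le_trans (_ : C * `|z.1 - w.1| <= _).
      apply: (@le_derive1_lip (fun s => G (s, z.2)) (fun s => dG 0 (s, z.2))) => // x.
      by apply/(is_derive_slice G (x, z.2) _).1.
    by rewrite ler_wpM2l// prod_normE le_max lexx.
  apply: le_trans (_ : C * `|z.2 - w.2| <= _).
    apply: (@le_derive1_lip (fun s => G (w.1, s)) (fun s => dG 1 (w.1, s))) => // x.
    by apply/(is_derive_slice G (w.1, x) _).2.
  by rewrite ler_wpM2l// prod_normE le_max lexx orbT.
move=> z; apply/cvgrPdist_le => e e0; near=> w.
apply: le_trans (lip _ _) _.
apply: le_trans (_ : (C *+ 2 + 1) * `|z - w| <= _).
  by rewrite ler_wpM2r// lerDl.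
rewrite mulrC -ler_pdivlMr ?ltr_wpDl// ?mulrn_wge0//.
near: w; apply: cvgr_dist_le; first exact: cvg_id.
by rewrite divr_gt0// ltr_wpDl// mulrn_wge0.
Unshelve. all: by end_near. Qed.

End directional.

(** * Bounded functions of bounded support *)

Section bounded_functions.
Context d (T : measurableType d) (R : realType) (mu : {measure set T -> \bar R}).
Implicit Types f g : T -> R.

(** Measurable, bounded and of support of finite measure: a class stable under
    all the algebra needed below, on which integrability never has to be
    discussed. *)
Definition bbs f := measurable_fun setT f /\ exists (M : R) (A : set T),
  [/\ measurable A, (mu A < +oo)%E, (forall z, `|f z| <= M) &
     (forall z, ~ A z -> f z = 0)].

Definition bmeas f := measurable_fun setT f /\ exists M : R, forall z, `|f z| <= M.

Lemma bbs_bmeas f : bbs f -> bmeas f.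
Proof. by move=> [mf [M [A [_ _ fM _]]]]; split => //; exists M. Qed.

Lemma bbs_integrable f : bbs f -> mu.-integrable setT (EFin \o f).
Proof.
move=> [mf [M [A [mA Aoo fM fA]]]].
have -> : EFin \o f = (EFin \o f) \_ A.
  apply/funext => z; rewrite patchE; case: ifPn => // /negP zA.
  by rewrite /= fA // => ?; apply: zA; rewrite inE.
apply/integrable_restrict => //; rewrite setTI.
apply: measurable_bounded_integrable => //; first exact: measurable_funTS.
exists M; split; first exact: num_real.
by move=> x Mx z _ /=; apply: le_trans (ltW Mx).
Qed.

Lemma bbs0 : bbs (fun=> 0).
Proof.
by split=> //; exists 0, set0; split => // [|z]; rewrite ?measure0 ?normr0.
Qed.

Lemma bbsD f g : bbs f -> bbs g -> bbs (fun z => f z + g z).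
Proof.
move=> [mf [M [A [mA Aoo fM fA]]]] [mg [M' [A' [mA' Aoo' gM gA]]]]; split.
  exact: measurable_funD.
exists (M + M'), (A `|` A'); split=> [|||z].
- exact: measurableU.
- by apply: le_lt_trans (measureU2 _ mA mA') _; exact: lte_add_pinfty.
- by move=> z; apply: le_trans (ler_normD _ _) _; exact: lerD.
- by move=> /not_orP[/fA -> /gA ->]; rewrite addr0.
Qed.

Lemma bbsM f g : bbs f -> bmeas g -> bbs (fun z => f z * g z).
Proof.
move=> [mf [M [A [mA Aoo fM fA]]]] [mg [M' gM]]; split.
  exact: measurable_funM.
exists (M * M'), A; split=> // z; last by move=> /fA ->; rewrite mul0r.
by rewrite normrM; apply: ler_pM.
Qed.

Lemma bbsMr f g : bmeas g -> bbs f -> bbs (fun z => g z * f z).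
Proof. by move=> bg bf; under eq_fun do rewrite mulrC; exact: bbsM. Qed.

Lemma bmeas_cst (k : R) : bmeas (fun=> k).
Proof. by split => //; exists `|k|. Qed.

Lemma bbsZ k f : bbs f -> bbs (fun z => k * f z).
Proof. by apply: bbsMr; exact: bmeas_cst. Qed.

Lemma bbsN f : bbs f -> bbs (fun z => - f z).
Proof. by move/(bbsZ (-1)); under eq_fun do rewrite mulN1r. Qed.

Lemma bbsB f g : bbs f -> bbs g -> bbs (fun z => f z - g z).
Proof. by move=> bf /bbsN; exact: bbsD. Qed.

Lemma bmeasD f g : bmeas f -> bmeas g -> bmeas (fun z => f z + g z).
Proof.
move=> [mf [M fM]] [mg [M' gM]]; split; first exact: measurable_funD.
by exists (M + M') => z; apply: le_trans (ler_normD _ _) _; exact: lerD.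
Qed.

Lemma bmeasM f g : bmeas f -> bmeas g -> bmeas (fun z => f z * g z).
Proof.
move=> [mf [M fM]] [mg [M' gM]]; split; first exact: measurable_funM.
by exists (M * M') => z; rewrite normrM; apply: ler_pM.
Qed.

Lemma bmeasN f : bmeas f -> bmeas (fun z => - f z).
Proof. by move/(bmeasM (bmeas_cst (-1))); under eq_fun do rewrite mulN1r. Qed.

Lemma bmeasB f g : bmeas f -> bmeas g -> bmeas (fun z => f z - g z).
Proof. by move=> bf /bmeasN; exact: bmeasD. Qed.

Lemma intD f g : bbs f -> bbs g ->
  \int[mu]_z (f z + g z) = \int[mu]_z f z + \int[mu]_z g z.
Proof. by move=> bf bg; rewrite RintegralD//; exact: bbs_integrable. Qed.

Lemma intB f g : bbs f -> bbs g ->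
  \int[mu]_z (f z - g z) = \int[mu]_z f z - \int[mu]_z g z.
Proof. by move=> bf bg; rewrite RintegralB//; exact: bbs_integrable. Qed.

Lemma intZ k f : bbs f ->
  \int[mu]_z (k * f z) = k * \int[mu]_z f z.
Proof. by move=> bf; rewrite RintegralZl//; exact: bbs_integrable. Qed.

Lemma intN f : bbs f -> \int[mu]_z (- f z) = - \int[mu]_z f z.
Proof.
by move=> bf; under eq_Rintegral do rewrite -mulN1r; rewrite intZ// mulN1r.
Qed.

Lemma le_int f g : bbs f -> bbs g -> (forall z, f z <= g z) ->
  \int[mu]_z f z <= \int[mu]_z g z.
Proof.
by move=> bf bg fg; apply: le_Rintegral => //; exact: bbs_integrable.
Qed.

Lemma ae_eq_int f g : bbs f -> bbs g -> {ae mu, forall z, f z = g z} ->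
  \int[mu]_z f z = \int[mu]_z g z.
Proof.
move=> bf bg fg; congr fine; apply: ae_eq_integral => //.
- by have /integrableP[] := bbs_integrable bf.
- by have /integrableP[] := bbs_integrable bg.
- by apply: filterS fg => z /= -> _.
Qed.

Lemma int_EFin f : bbs f -> (\int[mu]_z (f z)%:E)%E = (\int[mu]_z f z)%:E.
Proof.
by move=> /bbs_integrable bf; rewrite fineK//; exact: integrable_fin_num.
Qed.

End bounded_functions.

Section plane_measure.
Variable R : realType.
Implicit Types (f g : R * R -> R) (z : R * R).

Lemma open_measurable_plane (U : set (R * R)) : open U -> measurable U.
Proof.
move=> oU.
pose sq (t : rat * rat * nat) : set (R * R) :=
  ball (ratr t.1.1 : R) t.2.+1%:R^-1 `*` ball (ratr t.1.2 : R) t.2.+1%:R^-1.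
have -> : U = \bigcup_t (if `[< sq t `<=` U >] then sq t else set0).
  apply/seteqP; split=> [z Uz|z [t _]]; last by case: asboolP => // tU /tU.
  have /nbhs_ballP[e /= e0 zeU] := open_nbhs_nbhs (conj oU Uz).
  have [n nP] : exists n : nat, n.+1%:R^-1 < e / 2.
    have := @near_infty_natSinv_lt R (PosNum (divr_gt0 e0 (ltr0Sn _ 1))).
    by move=> [n _ /(_ n (leqnn _))]; exists n.
  have n0 : (0 : R) < n.+1%:R^-1 by rewrite invr_gt0.
  have rP (k x : R) : 0 < k -> exists q : rat, `|ratr q - x| < k.
    move=> k0; have /rat_in_itvoo[q] : x - k < x + k by lra.
    by rewrite in_itv/= => qP; exists q; rewrite ltr_distl.
  have [p pP] := rP _ z.1 n0; have [q qP] := rP _ z.2 n0.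
  exists (p, q, n) => //; case: asboolP => [_|].
    by split => /=; rewrite -ball_normE /=.
  case=> w [/=]; rewrite -!ball_normE /= => w1 w2.
  have tri (k x y y' : R) : k < e / 2 -> `|x - y| < k -> `|x - y'| < k ->
      `|y - y'| < e.
    rewrite !ltr_distl => ke /andP[? ?] /andP[? ?]; apply/andP; split; lra.
  by apply: zeU; split; rewrite -ball_normE/=;
    [exact: tri nP pP w1|exact: tri nP qP w2].
apply: countable_bigcupT_measurable => // t; case: ifP => // _.
by apply: measurableX; exact: measurable_ball.
Qed.

Lemma closed_measurable_plane (U : set (R * R)) : closed U -> measurable U.
Proof.
by move/closed_openC/open_measurable_plane/measurableC; rewrite setCK.
Qed.

Lemma compact_measurable_plane (U : set (R * R)) : compact U -> measurable U.
Proof.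
move=> cU; apply: closed_measurable_plane; apply: compact_closed cU.
exact: norm_hausdorff.
Qed.

Lemma continuous_measurable_plane f : continuous f -> measurable_fun setT f.
Proof.
move=> /continuousP cf; apply: (measurability _ (RGenOpens.measurableE R)).
move=> _ [_ [a [b ->] <-]]; rewrite setTI; apply: open_measurable_plane.
exact/cf/interval_open.
Qed.

Definition box (N : R) : set (R * R) := `[- N, N] `*` `[- N, N].

Lemma boxP N z : box N z <-> `|z| <= N.
Proof.
rewrite /box prod_normE /= ge_max !ler_norml !in_itv/=.
by split => [[-> ->]//|/andP[]].
Qed.

Lemma measurable_box N : measurable (box N).
Proof. by apply: measurableX; exact: measurable_itv. Qed.

Lemma compact_box N : compact (box N).
Proof. by apply: compact_setX; exact: segment_compact. Qed.

Lemma area_box N : (area R (box N) < +oo)%E.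
Proof.
rewrite product_measure1E; [|exact: measurable_itv|exact: measurable_itv].
have fin : (@lebesgue_measure R `[(- N)%R, N%R] < +oo)%E.
  by rewrite lebesgue_measure_itv; case: ifP => _ //; rewrite -EFinB ltry.
by apply: lte_mul_pinfty => //; rewrite ge0_fin_numE.
Qed.

Lemma continuous_bbs f N : continuous f -> (forall z, N < `|z| -> f z = 0) ->
  bbs (area R) f.
Proof.
move=> cf fN; split; first exact: continuous_measurable_plane.
have /compact_bounded[M [_ MP]] : compact (f @` box N).
  by apply: continuous_compact; [exact: continuous_subspaceT|exact: compact_box].
exists (Num.max (M + 1) 0), (box N); split => [|||z].
- exact: measurable_box.
- exact: area_box.
- move=> z; have [/boxP zN|/fN ->] := leP `|z| N.
    by rewrite le_max (MP (M + 1) _ (f z)) ?ltrDl//; exists z.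
  by rewrite normr0 le_max lexx orbT.
- by move=> zN; apply: fN; rewrite ltNge; apply/negP => /boxP.
Qed.

End plane_measure.

#[local] Instance ae_area_filter (R : realType) :
  Filter (nbhs (almost_everywhere (area R))).
Proof. exact: ae_filter_ringOfSetsType. Qed.

(** * Integration of partial derivatives *)

Section integration.
Variable R : realType.
Implicit Types (f g : R * R -> R) (z : R * R) (j : 'I_2).

Lemma integral_derive1_0 (g dg : R -> R) (N : R) :
  (forall x : R, is_derive x 1 g (dg x)) -> continuous dg ->
  (forall x, N <= `|x| -> g x = 0) -> (forall x, N <= `|x| -> dg x = 0) ->
  (\int[@lebesgue_measure R]_x (dg x)%:E)%E = 0%E.
Proof.
move=> gd cdg g0 dg0; pose M := Num.max N 1.
have M0 : 0 < M by rewrite lt_max ltr01 orbT.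
have NM : N <= M by rewrite le_max lexx.
have -> : (fun x => (dg x)%:E) = (fun x => (dg x)%:E) \_ `[- M, M].
  apply/funext => x; rewrite patchE; case: ifPn => // /negP.
  rewrite inE/= in_itv/= -ler_norml => /negP; rewrite -ltNge => /ltW xM.
  by rewrite dg0// (le_trans NM).
rewrite -integral_mkcond (@continuous_FTC2 _ dg g).
- by rewrite !g0 ?subee// ?normrN ger0_norm// ltW.
- by rewrite gtrN.
- exact: continuous_subspaceT.
- have cg := derive1_continuous gd.
  split; first by move=> x _; case: (gd x).
  + by apply: cvg_at_right_filter; exact: cg.
  + by apply: cvg_at_left_filter; exact: cg.
- by move=> x _; rewrite derive1E; case: (gd x).
Qed.

Lemma continuous_pairl (y : R) : continuous (fun x : R => (x, y)).
Proof.
move=> x; apply: (@cvg_pair R R R (nbhs x) (nbhs x) (nbhs y)).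
  exact: cvg_id.
exact: cvg_cst.
Qed.

Lemma continuous_pairr (x : R) : continuous (fun y : R => (x, y)).
Proof.
move=> y; apply: (@cvg_pair R R R (nbhs y) (nbhs x) (nbhs y)).
  exact: cvg_cst.
exact: cvg_id.
Qed.

Lemma is_derive_outside (G : R * R -> R) v d N z :
  (forall z, N < `|z| -> G z = 0) -> N < `|z| -> is_derive z v G d -> d = 0.
Proof.
move=> G0 zN [_ <-].
have -> : 'D_v G z = 'D_v (cst 0) z.
  apply: near_eq_derive; near=> w; rewrite /cst G0//; near: w.
  by apply: (cvgr_gt (`|z|)) => //; exact: cvg_norm.
exact: derive_cst.
Unshelve. all: by end_near. Qed.

(** Fubini and the fundamental theorem of calculus along the lines parallel to
    the axis: every integration by parts below is this lemma applied to a
    product. *)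
Lemma int_partial j (G dG : R * R -> R) N :
  (forall z, is_derive z (basis_vec R j) G (dG z)) -> continuous dG ->
  (forall z, N < `|z| -> G z = 0) -> \int[area R]_z dG z = 0.
Proof.
move=> Gd cdG G0.
have dG0 z : N < `|z| -> dG z = 0 by move=> zN; exact: is_derive_outside G0 zN (Gd z).
have idG := bbs_integrable (continuous_bbs cdG dG0).
have big1 (x y : R) : N + 1 <= `|x| -> N < `|(x, y)|.
  move=> xN; apply: lt_le_trans (_ : `|x| <= _).
    by apply: lt_le_trans xN; rewrite ltrDl.
  by rewrite prod_normE le_max lexx.
have big2 (x y : R) : N + 1 <= `|y| -> N < `|(x, y)|.
  move=> xN; apply: lt_le_trans (_ : `|y| <= _).
    by apply: lt_le_trans xN; rewrite ltrDl.
  by rewrite prod_normE le_max lexx orbT.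
have [j0|j1] := ord2P j.
- rewrite /Rintegral -(integral21_prod_meas1 idG).
  rewrite (eq_integral (cst 0%E)) ?integral0// => y _.
  rewrite /fubini_G /comp.
  apply: (@integral_derive1_0 (fun x => G (x, y)) (fun x => dG (x, y)) (N + 1)).
  + by move=> x; apply/(is_derive_slice G (x, y) _).1; rewrite -j0; exact: Gd.
  + move=> x; apply: (@continuous_comp _ _ _ (fun x => (x, y)) dG _ _ (cdG _)).
    exact: continuous_pairl.
  + by move=> x xN; apply: G0; exact: big1.
  + by move=> x xN; apply: dG0; exact: big1.
- rewrite /Rintegral -(integral12_prod_meas1 idG).
  rewrite (eq_integral (cst 0%E)) ?integral0// => x _.
  rewrite /fubini_F /comp.
  apply: (@integral_derive1_0 (fun y => G (x, y)) (fun y => dG (x, y)) (N + 1)).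
  + by move=> y; apply/(is_derive_slice G (x, y) _).2; rewrite -j1; exact: Gd.
  + move=> y; apply: (@continuous_comp _ _ _ (fun y => (x, y)) dG _ _ (cdG _)).
    exact: continuous_pairr.
  + by move=> y yN; apply: G0; exact: big2.
  + by move=> y yN; apply: dG0; exact: big2.
Qed.

End integration.

(** * Dominated convergence, line by line *)

Section iterated_limits.
Variable R : realType.
Let leb := @lebesgue_measure R.

Lemma itv_finite (N : R) : (leb `[(- N)%R, N%R] < +oo)%E.
Proof.
by rewrite /leb lebesgue_measure_itv; case: ifP => _ //; rewrite -EFinB ltry.
Qed.

Lemma bbs_itv (f : R -> R) (M N : R) : measurable_fun setT f ->
  (forall x, `|f x| <= M) -> (forall x, N < `|x| -> f x = 0) -> bbs leb f.
Proof.
move=> mf fM fN; split=> //; exists M, `[(- N)%R, N%R]%classic; split => //.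
  exact: itv_finite.
move=> x /= xN; apply: fN; rewrite ltNge; apply/negP => xN'; apply: xN.
by rewrite in_itv/= -ler_norml.
Qed.

Lemma le_int_itv (f : R -> R) (M N : R) : measurable_fun setT f ->
  (forall x, `|f x| <= M) -> (forall x, N < `|x| -> f x = 0) ->
  `|\int[leb]_x f x| <= M * fine (leb `[(- N)%R, N%R]%classic).
Proof.
move=> mf fM fN; have bf := bbs_itv mf fM fN.
apply: le_trans (le_normr_Rintegral _ _) _ => //; first exact: bbs_integrable.
have -> : \int[leb]_x `|f x| = \int[leb]_(x in `[(- N)%R, N%R]%classic) `|f x|.
  rewrite [RHS]Rintegral_mkcond; apply: eq_Rintegral => x _.
  rewrite patchE; case: ifPn => // /negP; rewrite inE/= in_itv/= -ler_norml.
  by move/negP; rewrite -ltNge => /fN ->; rewrite normr0.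
rewrite -Rintegral_cst//; apply: le_Rintegral => //.
- apply: (@integrableS _ _ _ leb setT) => //.
  by have /integrable_norm := bbs_integrable bf.
- apply: measurable_bounded_integrable => //; first exact: itv_finite.
  exists `|M|; split; first exact: num_real.
  by move=> x Mx y _ /=; apply: ltW.
Qed.

Lemma bbs_dct d (T : measurableType d) (mu : {measure set T -> \bar R})
    (h_ : nat -> T -> R) (h : T -> R) (M : R) (A : set T) :
  measurable A -> (mu A < +oo)%E ->
  (forall n, measurable_fun setT (h_ n)) -> measurable_fun setT h ->
  (forall n z, `|h_ n z| <= M) -> (forall n z, ~ A z -> h_ n z = 0) ->
  {ae mu, forall z, h_ n z @[n --> \oo] --> h z} ->
  (\int[mu]_z (h_ n z)%:E @[n --> \oo] --> \int[mu]_z (h z)%:E)%E.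
Proof.
move=> mA Aoo mh_ mh hM hA hcv.
have bA : bbs mu (fun z => M * \1_A z).
  split; first by apply: measurable_funM => //; exact: measurable_indic.
  exists `|M|, A; split => // z.
    by rewrite normrM ler_piMr// indicE; case: (_ \in _); rewrite ?normr1 ?normr0.
  by move=> zA; rewrite indicE memNset// mulr0.
have cv : {ae mu, forall z, setT z -> (h_ n z)%:E @[n --> \oo] --> (h z)%:E}.
  have ff : Filter (nbhs (almost_everywhere mu)) by exact: ae_filter_ringOfSetsType.
  by apply: filterS hcv => z hz _; apply: cvg_EFin; [exact: nearW|exact: hz].
have dom : {ae mu, forall z n, setT z -> (`|(h_ n z)%:E| <= (M * \1_A z)%:E)%E}.
  apply: aeW => z n _ /=; rewrite lee_fin indicE.
  have [zA|/negP zA] := boolP (z \in A); first by rewrite mulr1.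
  by rewrite hA ?normr0 ?mulr0// => zA'; apply: zA; rewrite inE.
have [] := @dominated_convergence _ _ _ mu setT measurableT
  (fun n z => (h_ n z)%:E) (fun z => (h z)%:E) (fun z => (M * \1_A z)%:E)
  (fun n => proj2 (measurable_EFinP _ _) (mh_ n))
  (proj2 (measurable_EFinP _ _) mh) cv (bbs_integrable bA) dom.
by [].
Qed.

Lemma iterated_dct (h_ : nat -> R -> R -> R) (h : R -> R -> R) (M N : R) :
  (forall n y, measurable_fun setT (h_ n y)) ->
  (forall y, measurable_fun setT (h y)) ->
  (forall n, measurable_fun setT (fun y => \int[leb]_x h_ n y x)) ->
  measurable_fun setT (fun y => \int[leb]_x h y x) ->
  (forall n y x, `|h_ n y x| <= M) -> (forall y x, `|h y x| <= M) ->
  (forall n y x, N < `|x| \/ N < `|y| -> h_ n y x = 0) ->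
  (forall y x, N < `|x| \/ N < `|y| -> h y x = 0) ->
  (forall y, {ae leb, forall x, h_ n y x @[n --> \oo] --> h y x}) ->
  \int[leb]_y \int[leb]_x h_ n y x @[n --> \oo] -->
  \int[leb]_y \int[leb]_x h y x.
Proof.
move=> mh_ mh mih_ mih h_M hM h_N hN hcv.
have outI (x : R) : ~ `[(- N)%R, N%R]%classic x -> N < `|x|.
  move=> xN; rewrite ltNge; apply/negP => xN'; apply: xN.
  by rewrite /= in_itv/= -ler_norml.
have zero (g : R -> R) : (forall x, g x = 0) -> \int[leb]_x g x = 0.
  by move=> g0; under eq_Rintegral do rewrite g0; rewrite /Rintegral integral0.
have bh y : bbs leb (h y).
  by apply: (@bbs_itv _ M N) => // x xN; apply: hN; left.
have bih : bbs leb (fun y => \int[leb]_x h y x).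
  apply: (@bbs_itv _ (M * fine (leb `[(- N)%R, N%R]%classic)) N) => //.
    by move=> y; apply: le_int_itv => // x xN; apply: hN; left.
  by move=> y yN; apply: zero => x; apply: hN; right.
apply: fine_cvg; rewrite -/(Rintegral _ _ _) -(int_EFin bih).
apply: (@bbs_dct _ _ leb _ _ (M * fine (leb `[(- N)%R, N%R]%classic))
  `[(- N)%R, N%R]%classic) => //.
- exact: itv_finite.
- by move=> n y; apply: le_int_itv => // x xN; apply: h_N; left.
- by move=> n y yI; have yN := outI _ yI; apply: zero => x; apply: h_N; right.
- apply: aeW => y; apply: fine_cvg; rewrite -/(Rintegral _ _ _) -(int_EFin (bh y)).
  apply: (@bbs_dct _ _ leb _ _ M `[(- N)%R, N%R]%classic) => //.
  + exact: itv_finite.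
  + by move=> n; exact: mh_.
  + exact: mh.
  + by move=> n x xI; have xN := outI _ xI; apply: h_N; left.
Qed.

End iterated_limits.

Section slices.
Variable R : realType.
Let leb := @lebesgue_measure R.
Implicit Types (f : R * R -> R) (M N : R).

Definition boxed M N f := [/\ measurable_fun setT f, forall z, `|f z| <= M &
  forall z, N < `|z| -> f z = 0].

Lemma boxed_bbs M N f : boxed M N f -> bbs (area R) f.
Proof.
move=> [mf fM fN]; split => //; exists M, (box N); split => //.
- exact: measurable_box.
- exact: area_box.
- by move=> z zN; apply: fN; rewrite ltNge; apply/negP => /boxP.
Qed.

Lemma lt_norm_fst N (x y : R) : N < `|x| -> N < `|(x, y)|.
Proof. by move=> xN; rewrite prod_normE lt_max xN. Qed.

Lemma lt_norm_snd N (x y : R) : N < `|y| -> N < `|(x, y)|.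
Proof. by move=> yN; rewrite prod_normE lt_max yN orbT. Qed.

Lemma boxed_slice1 M N f y : boxed M N f -> bbs leb (fun x => f (x, y)).
Proof.
move=> [mf fM fN]; apply: (@bbs_itv _ _ M N) => //.
  exact: measurable_fun_pair1.
by move=> x xN; apply: fN; exact: lt_norm_fst.
Qed.

Lemma boxed_slice2 M N f x : boxed M N f -> bbs leb (fun y => f (x, y)).
Proof.
move=> [mf fM fN]; apply: (@bbs_itv _ _ M N) => //.
  exact: measurable_fun_pair2.
by move=> y yN; apply: fN; exact: lt_norm_snd.
Qed.

Lemma int_fubini21 M N f : boxed M N f ->
  measurable_fun setT (fun y => \int[leb]_x f (x, y)) /\
  \int[area R]_z f z = \int[leb]_y \int[leb]_x f (x, y).
Proof.
move=> bf; have intf := bbs_integrable (boxed_bbs bf).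
have E : fubini_G leb (EFin \o f) = EFin \o (fun y => \int[leb]_x f (x, y)).
  by apply/funext => y; rewrite /fubini_G /= -(int_EFin (boxed_slice1 y bf)).
split; first by apply/measurable_EFinP; rewrite -E; exact: measurable_fubini_G intf.
rewrite /Rintegral -(integral21_prod_meas1 intf); congr fine.
by apply: eq_integral => y _; exact: (congr1 (@^~ y) E).
Qed.

Lemma int_fubini12 M N f : boxed M N f ->
  measurable_fun setT (fun x => \int[leb]_y f (x, y)) /\
  \int[area R]_z f z = \int[leb]_x \int[leb]_y f (x, y).
Proof.
move=> bf; have intf := bbs_integrable (boxed_bbs bf).
have E : fubini_F leb (EFin \o f) = EFin \o (fun x => \int[leb]_y f (x, y)).
  by apply/funext => y; rewrite /fubini_F /= -(int_EFin (boxed_slice2 y bf)).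
split; first by apply/measurable_EFinP; rewrite -E; exact: measurable_fubini_F intf.
rewrite /Rintegral -(integral12_prod_meas1 intf); congr fine.
by apply: eq_integral => y _; exact: (congr1 (@^~ y) E).
Qed.

(** Dominated convergence on the plane for sequences that are only known to
    converge almost everywhere on each line parallel to one axis: this is what
    one-dimensional Lebesgue differentiation provides. *)
Lemma slice_dct (j : 'I_2) M N (h_ : nat -> R * R -> R) (h : R * R -> R) :
  (forall n, boxed M N (h_ n)) -> boxed M N h ->
  (forall t, {ae leb, forall s,
     let z := if j == 0 then (s, t) else (t, s) in
     h_ n z @[n --> \oo] --> h z}) ->
  \int[area R]_z h_ n z @[n --> \oo] --> \int[area R]_z h z.
Proof.
move=> bh_ bh; case: eqP => _ /= cv.
- rewrite (int_fubini21 bh).2.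
  under eq_fun => n do rewrite (int_fubini21 (bh_ n)).2.
  apply: (@iterated_dct _ (fun n y x => h_ n (x, y)) (fun y x => h (x, y)) M N).
  + by move=> n y; apply: measurable_fun_pair1; case: (bh_ n).
  + by move=> y; apply: measurable_fun_pair1; case: bh.
  + by move=> n; exact: (int_fubini21 (bh_ n)).1.
  + exact: (int_fubini21 bh).1.
  + by move=> n y x; case: (bh_ n).
  + by move=> y x; case: bh.
  + by move=> n y x xyN; have [_ _ ->//] := bh_ n; case: xyN => ?;
      [exact: lt_norm_fst|exact: lt_norm_snd].
  + by move=> y x xyN; have [_ _ ->//] := bh; case: xyN => ?;
      [exact: lt_norm_fst|exact: lt_norm_snd].
  + exact: cv.
- rewrite (int_fubini12 bh).2.
  under eq_fun => n do rewrite (int_fubini12 (bh_ n)).2.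
  apply: (@iterated_dct _ (fun n x y => h_ n (x, y)) (fun x y => h (x, y)) M N).
  + by move=> n y; apply: measurable_fun_pair2; case: (bh_ n).
  + by move=> y; apply: measurable_fun_pair2; case: bh.
  + by move=> n; exact: (int_fubini12 (bh_ n)).1.
  + exact: (int_fubini12 bh).1.
  + by move=> n y x; case: (bh_ n).
  + by move=> y x; case: bh.
  + by move=> n y x xyN; have [_ _ ->//] := bh_ n; case: xyN => ?;
      [exact: lt_norm_snd|exact: lt_norm_fst].
  + by move=> y x xyN; have [_ _ ->//] := bh; case: xyN => ?;
      [exact: lt_norm_snd|exact: lt_norm_fst].
  + exact: cv.
Qed.

(** * Approximate identities on the line *)

Definition dilate (b : R -> R) (delta s : R) := delta^-1 * b (delta^-1 * s).

Section approximate_identity.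
Variable b : R -> R.
Hypothesis cb : continuous b.
Hypothesis b_ge0 : forall s, 0 <= b s.
Hypothesis b_even : forall s, b (- s) = b s.
Hypothesis b_supp : forall s, 1 <= `|s| -> b s = 0.
Hypothesis b_mass : (\int[leb]_s (b s)%:E)%E = 1%E.

Lemma dilate_continuous delta : continuous (dilate b delta).
Proof.
move=> s; apply: cvgM; first exact: cvg_cst.
apply: (@cvg_comp _ _ _ (fun s : R => delta^-1 * s) b _ (nbhs (delta^-1 * s))).
  by apply: cvgM; [exact: cvg_cst|exact: cvg_id].
exact: cb.
Qed.

Lemma dilate_ge0 delta s : 0 <= delta -> 0 <= dilate b delta s.
Proof. by move=> d0; rewrite mulr_ge0// invr_ge0. Qed.

Lemma dilate_supp delta s : 0 < delta -> delta <= `|s| -> dilate b delta s = 0.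
Proof.
move=> d0 ds; rewrite /dilate b_supp ?mulr0//.
by rewrite normrM gtr0_norm ?invr_gt0// ler_pdivlMl// mulr1.
Qed.

Lemma dilate_mass (delta x : R) : 0 < delta ->
  (\int[leb]_s (dilate b delta (x - s))%:E)%E = 1%E.
Proof.
move=> d0; pose F (s : R) : R := delta^-1 * (s - x).
have dF (s : R) : is_derive s 1 (F : R -> R) delta^-1.
  have -> : delta^-1 = delta^-1 *: (1 - 0 : R) by rewrite subr0 [_ *: _]mulr1.
  exact: is_deriveZ.
have F1 : (F : R -> R)^`()%classic = cst delta^-1.
  by apply/funext => s; rewrite derive1E; case: (dF s).
have id0 : 0 < delta^-1 by rewrite invr_gt0.
rewrite -b_mass (@increasing_ge0_integration_by_substitutionT _ F b) //.
- apply: eq_integral => s _; rewrite F1 /dilate; congr EFin.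
  change (delta^-1 * b (delta^-1 * (x - s)) = b (delta^-1 * (s - x)) * delta^-1).
  by rewrite mulrC -b_even -mulrN opprB.
- by move=> s t st; rewrite /F ltr_pM2l// ltrD2r.
- by rewrite F1; exact: cst_continuous.
- by rewrite F1; exact: is_cvg_cst.
- by rewrite F1; exact: is_cvg_cst.
- apply/cvgrNyPle => A; near=> s.
  rewrite /F ler_pdivrMl// lerBlDr; near: s; apply: nbhs_ninfty_le; exact: num_real.
- apply/cvgryPge => A; near=> s.
  rewrite /F ler_pdivlMl// lerBrDr; near: s; apply: nbhs_pinfty_ge; exact: num_real.
Unshelve. all: by end_near. Qed.

Variable B : R.
Hypothesis b_le : forall s, b s <= B.

Lemma dilate_le delta s : 0 < delta -> dilate b delta s <= delta^-1 * B.
Proof. by move=> d0; rewrite /dilate ler_wpM2l// invr_ge0 ltW. Qed.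

Lemma bbs_dilate delta x : 0 < delta -> bbs leb (fun s => dilate b delta (x - s)).
Proof.
move=> d0; apply: (@bbs_itv _ _ (delta^-1 * B) (`|x| + delta)).
- apply: continuous_measurable_fun => s.
  apply: (@cvg_comp _ _ _ (fun s : R => x - s) (dilate b delta) _ (nbhs (x - s))).
    by apply: cvgB; [exact: cvg_cst|exact: cvg_id].
  exact: dilate_continuous.
- by move=> s; rewrite ger0_norm ?dilate_le// dilate_ge0// ltW.
- move=> s xs; apply: dilate_supp => //; have := ler_normD x (s - x).
  by rewrite addrC subrK (distrC s); lra.
Qed.

(** The kernel is at most [B / delta] on the ball of radius [delta], whose
    length is [2 delta]: hence the constant. *)
Lemma dilate_davg (u : R -> R) (M delta x : R) :
  measurable_fun setT u -> (forall s, `|u s| <= M) -> 0 < delta ->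
  (`|\int[leb]_s (dilate b delta (x - s) * u s) - u x|%:E <=
   (2 * B)%:E * davg u x delta)%E.
Proof.
move=> mu uM d0; have bd := bbs_dilate x d0.
have bmu : bmeas u by split => //; exists M.
have bux : bmeas (fun s => u s - u x) by apply: bmeasB => //; exact: bmeas_cst.
have B0 : 0 <= B by apply: le_trans (b_le 0).
have -> : \int[leb]_s (dilate b delta (x - s) * u s) - u x =
          \int[leb]_s (dilate b delta (x - s) * (u s - u x)).
  have E : u x = \int[leb]_s (dilate b delta (x - s) * u x).
    under eq_Rintegral do rewrite mulrC.
    rewrite intZ//; have -> : \int[leb]_s dilate b delta (x - s) = 1.
      by rewrite /Rintegral dilate_mass.
    by rewrite mulr1.
  rewrite [X in _ - X]E -intB; [|exact: bbsM|by apply: bbsM => //; exact: bmeas_cst].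
  by apply: eq_Rintegral => s _; rewrite mulrBr.
have bdu : bbs leb (fun s => dilate b delta (x - s) * (u s - u x)) by exact: bbsM.
have /integrableP[mdu _] := bbs_integrable bdu.
rewrite (EFin_normr_Rintegral _ (bbs_integrable bdu))//.
apply: le_trans (le_abse_integral _ _ mdu) _ => //.
have -> : (\int[leb]_s `|(EFin \o (fun s => dilate b delta (x - s) * (u s - u x))%R) s|)%E =
          (\int[leb]_(s in ball x delta) `|dilate b delta (x - s) * (u s - u x)|%:E)%E.
  rewrite [RHS]integral_mkcond; apply: eq_integral => s _.
  rewrite patchE; case: ifPn => // /negP; rewrite inE -ball_normE/= => /negP.
  by rewrite -leNgt => xs; rewrite dilate_supp// mul0r normr0.
rewrite /davg /iavg lebesgue_measure_ball ?(ltW d0)// muleA.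
rewrite inver mulrn_eq0/= gt_eqF// -EFinM -ge0_integralZl//; last 3 first.
- exact: measurable_ball.
- apply: measurable_funTS; apply/measurable_EFinP; apply: measurableT_comp => //.
  by case: bux.
- by rewrite lee_fin mulr_ge0 ?mulr_ge0// invr_ge0 mulrn_wge0// ltW.
apply: ge0_le_integral => //=.
- exact: measurable_ball.
- apply/measurable_EFinP; apply: measurableT_comp => //; apply: measurable_funTS.
  by case: bdu.
- apply: measurable_funeM; apply/measurable_EFinP; apply: measurableT_comp => //.
  by apply: measurable_funTS; case: bux.
- move=> s _; rewrite lee_fin normrM ler_wpM2r//.
  rewrite ger0_norm ?dilate_ge0 ?(ltW d0)//; apply: le_trans (dilate_le _ d0) _.
  suff -> : delta^-1 * B = 2 * B / (delta *+ 2) by [].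
  by rewrite -mulr_natr; field; rewrite gt_eqF.
Qed.

Lemma dilate_lebesgue_pt (u : R -> R) (M x : R) (d_ : nat -> R) :
  measurable_fun setT u -> (forall s, `|u s| <= M) -> lebesgue_pt u x ->
  (forall n, 0 < d_ n) -> d_ n @[n --> \oo] --> 0 ->
  \int[leb]_s (dilate b (d_ n) (x - s) * u s) @[n --> \oo] --> u x.
Proof.
move=> mu uM ux d_gt0 d_0; apply/subr_cvg0/norm_cvg0P.
apply: (@fine_cvg _ _ _ _ (fun n => `|\int[leb]_s (dilate b (d_ n) (x - s) * u s) - u x|%:E)).
apply: (@squeeze_cvge _ _ _ _ (cst 0%E) _
  (fun n => (2 * B)%:E * davg u x (d_ n))%E).
- by apply: nearW => n; rewrite lee_fin normr_ge0/=; exact: dilate_davg.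
- exact: cvg_cst.
- move/cvge_at_rightP : ux => /(_ d_) ux.
  have : (((2 * B)%:E * davg u x (d_ n)) @[n --> \oo] --> (2 * B)%:E * 0)%E.
    by apply: cvgeM => //; [exact: cvg_cst|exact: ux].
  by rewrite mule0.
Qed.

Lemma dilate_cvg_ae (u : R -> R) (d_ : nat -> R) : bbs leb u ->
  (forall n, 0 < d_ n) -> d_ n @[n --> \oo] --> 0 ->
  {ae leb, forall x,
    \int[leb]_s (dilate b (d_ n) (x - s) * u s) @[n --> \oo] --> u x}.
Proof.
move=> bu d_gt0 d_0; have [mu [M [_ [_ _ uM _]]]] := bu.
have ff : Filter (nbhs (almost_everywhere leb)) by exact: ae_filter_ringOfSetsType.
have := lebesgue_differentiation
  (open_integrable_locally openT (bbs_integrable bu)).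
by apply: filterS => x ux; exact: (dilate_lebesgue_pt mu uM).
Qed.

End approximate_identity.

End slices.

(** * Smooth functions on the line and a bump *)

Section smooth_line.
Variable R : realType.
Implicit Types (f g : R -> R) (n k : nat).

Fixpoint Cn n f : Prop :=
  if n is n'.+1 then exists df, (forall x : R, is_derive x 1 f (df x)) /\ Cn n' df
  else True.

Definition smooth1 f := forall n, Cn n f.

Lemma CnS n f : Cn n.+1 f -> Cn n f.
Proof.
elim: n f => [//|n ih] f [df [fd cdf]]; exists df; split => //; exact: ih.
Qed.

Lemma Cn_comb n (c d : R) f g : Cn n f -> Cn n g ->
  Cn n (fun x => c * f x + d * g x).
Proof.
elim: n f g => [//|n ih] f g [df [fd cdf]] [dg [gd cdg]].
exists (fun x => c * df x + d * dg x); split; last exact: ih.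
by move=> x; apply: is_deriveD; apply: (@is_deriveZ _ _ _ _ _ x 1).
Qed.

Lemma CnM n f g : Cn n f -> Cn n g -> Cn n (fun x => f x * g x).
Proof.
elim: n f g => [//|n ih] f g nf ng.
have [df [fd cdf]] := nf; have [dg [gd cdg]] := ng.
exists (fun x => 1 * (f x * dg x) + 1 * (g x * df x)); split.
  by move=> x; rewrite !mul1r; exact: is_deriveM.
by apply: Cn_comb; apply: ih => //; exact: CnS.
Qed.

Lemma smooth1M f g : smooth1 f -> smooth1 g -> smooth1 (fun x => f x * g x).
Proof. by move=> sf sg n; exact: CnM. Qed.

Lemma smooth1_cst (c : R) : smooth1 (fun=> c).
Proof.
move=> n; elim: n c => // n ih c; exists (fun=> 0); split; last exact: ih.
by move=> x; exact: is_derive_cst.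
Qed.

Lemma smooth1Z (c : R) f : smooth1 f -> smooth1 (fun x => c * f x).
Proof. by apply: smooth1M; exact: smooth1_cst. Qed.

Lemma smooth1_ext f g : f =1 g -> smooth1 f -> smooth1 g.
Proof. by move=> /funext ->. Qed.

Lemma is_derive_affine (a b x : R) : is_derive x 1 (fun x => a * x + b) a.
Proof.
have := is_deriveD (is_deriveZ a (is_derive_id x 1)) (is_derive_cst b x 1).
by rewrite addr0 [a *: 1]mulr1.
Qed.

Lemma smooth1_affine f (a b : R) : smooth1 f -> smooth1 (fun x => f (a * x + b)).
Proof.
move=> sf n; elim: n f {sf}(sf n) => [//|n ih] f [df [fd cdf]].
exists (fun x => a * df (a * x + b) + 0 * df (a * x + b)); split; last first.
  by apply: Cn_comb; exact: ih.
move=> x; rewrite mul0r addr0 mulrC.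
apply: (@is_derive1_comp _ f (fun x => a * x + b)) => //.
exact: is_derive_affine.
Qed.

Lemma smooth1_derive f : smooth1 f ->
  (forall x : R, is_derive x 1 f (f^`()%classic x)) /\ smooth1 f^`()%classic.
Proof.
move=> sf; split=> [x|n].
  have [df [/(_ x) fd _]] := sf 1%N.
  by rewrite derive1E; apply: DeriveDef; case: fd.
have [df [fd cdf]] := sf n.+1.
suff -> : f^`()%classic = df by [].
by apply/funext => x; rewrite derive1E; case: (fd x).
Qed.

Lemma smooth1_continuous f : smooth1 f -> continuous f.
Proof. by move=> /smooth1_derive[fd _]; exact: derive1_continuous fd. Qed.

(** The whole family is needed because its span, and not the single function
    [exp (- 1 / x)], is stable under differentiation. *)
Definition flat k (x : R) : R := if 0 < x then x^-1 ^+ k * expR (- x^-1) else 0.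

Lemma flat_ge0 k x : 0 <= flat k x.
Proof.
rewrite /flat; case: ifP => // x0.
by rewrite mulr_ge0 ?expR_ge0// exprn_ge0// invr_ge0 ltW.
Qed.

Lemma flat_le0 k x : x <= 0 -> flat k x = 0.
Proof. by move=> x0; rewrite /flat ltNge x0. Qed.

(** The exponential series dominates each of its terms. *)
Lemma pow_expRN_le (y : R) n m : 0 < y ->
  y ^+ n * expR (- y) <= (n + m)`!%:R * y ^- m.
Proof.
move=> y0; rewrite expRN ler_pdivrMr ?expR_gt0//.
have h : y ^+ (n + m) <= (n + m)`!%:R * expR y.
  have nm0 : 0 < (n + m)`!%:R :> R by rewrite ltr0n fact_gt0.
  rewrite -ler_pdivrMl// mulrC; case: (n + m)%N => [|k].
    by rewrite expr0 fact0 divr1 -expR0 ler_expR ltW.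
  by apply: le_trans (expR_ge1Dxn k (ltW y0)); rewrite lerDr.
rewrite mulrAC ler_pdivlMr ?exprn_gt0//.
by rewrite -exprD.
Qed.

Lemma flat_bound k x : `|flat k x| <= (k + 2)`!%:R * x ^+ 2.
Proof.
rewrite ger0_norm ?flat_ge0// /flat; case: ifP => [x0|_]; last first.
  by rewrite mulr_ge0// sqr_ge0.
have xi0 : 0 < x^-1 by rewrite invr_gt0.
by apply: le_trans (pow_expRN_le k 2 xi0) _; rewrite exprVn invrK.
Qed.

Lemma flat_le k x : flat k x <= k`!%:R.
Proof.
rewrite /flat; case: ifP => // x0.
have xi0 : 0 < x^-1 by rewrite invr_gt0.
by apply: le_trans (pow_expRN_le k 0 xi0) _; rewrite addn0 expr0 invr1 mulr1.
Qed.

Lemma is_derive_pow n (f : R -> R) (x d : R) : is_derive x 1 f d ->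
  is_derive x 1 (fun y => f y ^+ n) (n%:R * f x ^+ n.-1 * d).
Proof.
move=> fd; have := is_deriveX n fd.
have -> : f ^+ n = (fun y => f y ^+ n).
  by apply/funext => y; elim: n => [|n ih]; rewrite ?expr0// !exprS -ih.
by [].
Qed.

Lemma is_derive_flat k (x : R) :
  is_derive x 1 (flat k) (- k%:R * flat k.+1 x + flat k.+2 x).
Proof.
have [x0|x0|->] := ltgtP x 0.
- rewrite !flat_le0 ?(ltW x0)// mulr0 addr0.
  apply: (@near_eq_is_derive _ _ _ (cst 0)).
  near=> y; rewrite /cst flat_le0//; apply: ltW; near: y.
  exact: cvgr_lt x0.
- have x1 : x != 0 by rewrite gt_eqF.
  have dinv : is_derive x 1 (fun x : R => x^-1) (- x ^- 2).
    have := @is_deriveV R id x 1 1 x1 (is_derive_id x 1).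
    by rewrite [_ *: 1]mulr1.
  have dpow : is_derive x 1 (fun x : R => x^-1 ^+ k) (k%:R * x^-1 ^+ k.-1 * (- x ^- 2)).
    exact: is_derive_pow dinv.
  have dexp : is_derive x 1 (fun x : R => expR (- x^-1)) (expR (- x^-1) * x ^- 2).
    apply: (@is_derive1_comp _ expR (fun x => - x^-1)) => //.
    by have := is_deriveN dinv; rewrite opprK.
  have := is_deriveM dpow dexp.
  have fg : \near x, (fun x : R => x^-1 ^+ k) x * (fun x : R => expR (- x^-1)) x = flat k x.
    near=> y; rewrite /flat ifT//; near: y; exact: cvgr_gt x0.
  move=> /(near_eq_is_derive fg); congr is_derive; rewrite /flat x0 /GRing.scale/=.
  case: k {dpow fg} => [|k].
    by rewrite !expr0 !mul0r !mulr0 oppr0 mul0r addr0 add0r mul1r mulrC exprVn.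
  by rewrite -exprVn !exprS /=; ring.
- rewrite !flat_le0// mulr0 addr0.
  have E : (fun h : R => h^-1 *: ((flat k \o shift 0) (h *: (1 : R)) - flat k 0)) @ 0^' --> (0 : R).
    apply: (@cvg_to_0_linear _ _ (k + 2)`!%:R 1) => // h /andP[h0 _] /=.
    rewrite (@flat_le0 k 0)// subr0 addr0 [h *: 1]mulr1 normrM normfV ler_pdivrMl//.
    apply: le_trans (flat_bound k h) _.
    by rewrite -(real_normK (num_real h)) expr2 [leRHS]mulrCA.
  split; first by apply/cvg_ex; exists 0.
  exact/cvg_lim.
Unshelve. all: by end_near. Qed.

Lemma smooth1_flat k : smooth1 (flat k).
Proof.
move=> n; elim: n k => [//|n ih] k.
exists (fun x => (- k%:R) * flat k.+1 x + 1 * flat k.+2 x); split.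
  by move=> x; rewrite mul1r; exact: is_derive_flat.
exact: Cn_comb.
Qed.

End smooth_line.

Section bump.
Variable R : realType.
Let leb := @lebesgue_measure R.

(** The product [flat 0 (1 + s) flat 0 (1 - s)], normalized; its mass is bounded
    below on [[- 1/2, 1/2]]. *)
Lemma bump_exists : exists b : R -> R,
  [/\ smooth1 b, forall s, 0 <= b s, forall s, b (- s) = b s,
      forall s, 1 <= `|s| -> b s = 0 &
      (\int[leb]_s (b s)%:E)%E = 1%E /\ exists B, forall s, b s <= B].
Proof.
pose b0 (s : R) := flat 0 (1 * s + 1) * flat 0 (-1 * s + 1).
have sb0 : smooth1 b0.
  by apply: smooth1M; apply: smooth1_affine; exact: smooth1_flat.
have b0_ge0 s : 0 <= b0 s by rewrite mulr_ge0// flat_ge0.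
have b0_le1 s : b0 s <= 1.
  by rewrite mulr_ile1 ?flat_ge0//; exact: (flat_le 0).
have b0_supp s : 1 <= `|s| -> b0 s = 0.
  rewrite /b0 ler_normr => /orP[s1|s1].
    by rewrite [X in _ * X]flat_le0 ?mulr0//; lra.
  by rewrite flat_le0 ?mul0r//; lra.
have bb0 : bbs leb b0.
  apply: (@bbs_itv _ _ 1 1).
  - by apply: continuous_measurable_fun; exact: smooth1_continuous.
  - by move=> s; rewrite ger0_norm.
  - by move=> s /ltW; exact: b0_supp.
pose m := \int[leb]_s b0 s.
have m0 : 0 < m.
  pose I := `[(- 2^-1)%R, (2^-1)%R : R]%classic.
  pose c : R := expR (- 2) * expR (- 2).
  have c0 : 0 < c by rewrite mulr_gt0// expR_gt0.
  have mI : leb I = 1%E.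
    rewrite /leb lebesgue_measure_itv/= lte_fin ifT; last by lra.
    by rewrite -EFinB; congr EFin; lra.
  have Ioo : (leb I < +oo)%E by rewrite mI ltry.
  have flat_ge t : 2^-1 <= t -> expR (- 2) <= flat 0 t :> R.
    move=> t2; have t0 : 0 < t by lra.
    by rewrite /flat t0 expr0 mul1r ler_expR lerN2 -[leRHS]invrK lef_pV2 ?posrE.
  apply: lt_le_trans (_ : c * fine (leb I) <= _); first by rewrite mI mulr1.
  have mmI : measurable I by exact: measurable_itv.
  rewrite -Rintegral_cst//.
  rewrite Rintegral_mkcond; apply: le_int => //.
    split; first exact: (measurable_restrictT (fun=> c) mmI).1.
    exists c, I; split => //.
    - move=> s; rewrite patchE; case: ifP => _; last by rewrite normr0 ltW.
      by rewrite ger0_norm// ltW.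
    - by move=> s Is; rewrite patchE memNset.
  move=> s; rewrite patchE; case: ifPn => // /set_mem.
  rewrite /I /= in_itv/= => /andP[s1 s2].
  by apply: ler_pM; rewrite ?expR_ge0//; apply: flat_ge; lra.
exists (fun s => m^-1 * b0 s); split.
- exact: smooth1Z.
- by move=> s; rewrite mulr_ge0// invr_ge0 ltW.
- move=> s; rewrite /b0; have -> : 1 * - s + 1 = -1 * s + 1 by ring.
  have -> : -1 * - s + 1 = 1 * s + 1 by ring.
  by congr (_ * _); exact: mulrC.
- by move=> s /b0_supp ->; rewrite mulr0.
- split.
    rewrite (int_EFin (bbsZ _ bb0)) intZ// -/m mulVf// gt_eqF//.
  by exists m^-1 => s; rewrite ler_piMr// invr_ge0 ltW.
Qed.

End bump.

(** * Smooth functions in the plane *)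

Section smooth_plane.
Variable R : realType.
Implicit Types (h g : R * R -> R) (f : R -> R) (n : nat) (j : 'I_2).

(** [smooth] quantifies over words of partial derivatives, which do not match the
    shape of the Leibniz and chain rules; this equivalent recursive form is
    preserved by products and compositions, by induction on the order. *)
Fixpoint C2n n h : Prop := continuous h /\
  if n is n'.+1 then exists dh : 'I_2 -> R * R -> R,
    (forall j z, is_derive z (basis_vec R j) h (dh j z)) /\
    forall j, C2n n' (dh j)
  else True.

Lemma C2n_continuous n h : C2n n h -> continuous h.
Proof. by case: n => [|n] []. Qed.

Lemma smoothP h : smooth h <-> forall n, C2n n h.
Proof.
split=> [sh n|ch s].
  have : forall s, continuous (iter_partial s h) /\
    forall j z, derivable (iter_partial s h) z (basis_vec R j) := sh.
  elim: n h {sh} => [|n ih] h sh; first by split => //; exact: (sh [::]).1.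
  split; first exact: (sh [::]).1.
  exists (fun j => partial j h); split.
    by move=> j z; apply: is_derive_partial; exact: (sh [::]).2.
  move=> j; apply: ih => s.
  have -> : iter_partial s (partial j h) = iter_partial (rcons s j) h.
    by elim: s => //= i s ->.
  exact: sh.
have : forall s, continuous (iter_partial s h) /\ C2n 1 (iter_partial s h).
  move=> {}s; elim/last_ind: s h ch => [|s j ih] h ch.
    by split; [exact: (C2n_continuous (ch 0%N))|exact: ch].
  have -> : iter_partial (rcons s j) h = iter_partial s (partial j h).
    by elim: s {ih} => //= i s ->.
  apply: ih => n; have [_ [dh [hd cdh]]] := ch n.+1.
  suff -> : partial j h = dh j by exact: cdh.
  by apply/funext => z; exact: partial_val (hd j z).
move=> /(_ s)[cs [_ [dh [hd _]]]]; split => // j z.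
Qed.

Lemma C2nS n h : C2n n.+1 h -> C2n n h.
Proof.
elim: n h => [|n ih] h [ch [dh [hd cdh]]]; split => //.
by exists dh; split => // j; exact: ih.
Qed.

Lemma C2nD n h g : C2n n h -> C2n n g -> C2n n (fun z => h z + g z).
Proof.
elim: n h g => [|n ih] h g [ch H] [cg G].
  by split => // z; apply: cvgD; [exact: ch|exact: cg].
split; first by move=> z; apply: cvgD; [exact: ch|exact: cg].
have [dh [hd cdh]] := H; have [dg [gd cdg]] := G.
exists (fun j z => dh j z + dg j z); split => [j z|j]; last first.
  by apply: ih; [exact: cdh|exact: cdg].
exact: is_deriveDd.
Qed.

Lemma C2nM n h g : C2n n h -> C2n n g -> C2n n (fun z => h z * g z).
Proof.
elim: n h g => [|n ih] h g nh ng; have [ch H] := nh; have [cg G] := ng.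
  by split => // z; apply: cvgM; [exact: ch|exact: cg].
split; first by move=> z; apply: cvgM; [exact: ch|exact: cg].
have [dh [hd cdh]] := H; have [dg [gd cdg]] := G.
exists (fun j z => h z * dg j z + g z * dh j z); split => [j z|j].
  exact: is_deriveMm.
by apply: C2nD; apply: ih; by [exact: C2nS|exact: cdh|exact: cdg].
Qed.

Lemma smooth_mul h g : smooth h -> smooth g -> smooth (fun z => h z * g z).
Proof. by move=> /smoothP sh /smoothP sg; apply/smoothP => n; exact: C2nM. Qed.

Lemma smooth_add h g : smooth h -> smooth g -> smooth (fun z => h z + g z).
Proof. by move=> /smoothP sh /smoothP sg; apply/smoothP => n; exact: C2nD. Qed.

Lemma C2n_cst n (c : R) : C2n n (fun=> c).
Proof.
elim: n c => [|n ih] c; first by split => // z; exact: cvg_cst.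
split; first by move=> z; exact: cvg_cst.
exists (fun _ _ => 0); split => // j z; exact: is_derive_cst.
Qed.

Lemma is_derive_coord1 j z : is_derive z (basis_vec R j) fst (j == 0)%:R.
Proof.
have [->|->] := ord2P j.
  by apply/(is_derive_slice _ _ _).1; exact: is_derive_id.
by apply/(is_derive_slice _ _ _).2; exact: is_derive_cst.
Qed.

Lemma is_derive_coord2 j z : is_derive z (basis_vec R j) snd (j == 1)%:R.
Proof.
have [->|->] := ord2P j.
  by apply/(is_derive_slice _ _ _).1; exact: is_derive_cst.
by apply/(is_derive_slice _ _ _).2; exact: is_derive_id.
Qed.

Lemma C2n_comp n (u : R * R -> R) f : (forall n, C2n n u) -> smooth1 f ->
  C2n n (f \o u).
Proof.
move=> su; elim: n f => [|n ih] f sf.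
  split => // z; apply: continuous_comp; first exact: (C2n_continuous (su 0%N)).
  exact: smooth1_continuous.
have [fd sdf] := smooth1_derive sf.
split.
  move=> z; apply: continuous_comp; first exact: (C2n_continuous (su 0%N)).
  exact: smooth1_continuous.
have [_ [du [ud cdu]]] := su n.+1.
exists (fun j z => (f^`()%classic \o u) z * du j z); split => j.
  by move=> z; exact: is_derive_chain (ud j z) (fd (u z)).
by apply: C2nM; [exact: ih|exact: cdu].
Qed.

Lemma C2n_fst n : C2n n (@fst R R).
Proof.
case: n => [|n]; first by split => // z; exact: cvg_fst.
split; first by move=> z; exact: cvg_fst.
exists (fun j _ => (j == 0)%:R); split => [j z|j]; first exact: is_derive_coord1.
exact: C2n_cst.
Qed.

Lemma C2n_snd n : C2n n (@snd R R).
Proof.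
case: n => [|n]; first by split => // z; exact: cvg_snd.
split; first by move=> z; exact: cvg_snd.
exists (fun j _ => (j == 1)%:R); split => [j z|j]; first exact: is_derive_coord2.
exact: C2n_cst.
Qed.

Lemma smooth_comp (u : R * R -> R) f : smooth u -> smooth1 f -> smooth (f \o u).
Proof. by move=> /smoothP su sf; apply/smoothP => n; exact: C2n_comp. Qed.

Lemma smooth_fst : smooth (@fst R R).
Proof. by apply/smoothP => n; exact: C2n_fst. Qed.

Lemma smooth_snd : smooth (@snd R R).
Proof. by apply/smoothP => n; exact: C2n_snd. Qed.

Lemma smooth_continuous h : smooth h -> continuous h.
Proof. by move=> /(_ [::])[]. Qed.

Lemma smooth_is_derive h j z : smooth h ->
  is_derive z (basis_vec R j) h (partial j h z).
Proof. by move=> /(_ [::])[_ hd]; exact: is_derive_partial. Qed.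

Lemma smooth_partial h j : smooth h -> smooth (partial j h).
Proof.
move=> sh s; have := sh (rcons s j).
suff -> : iter_partial (rcons s j) h = iter_partial s (partial j h) by [].
by elim: s => //= i s ->.
Qed.

Lemma smooth_partial_continuous h j : smooth h -> continuous (partial j h).
Proof. by move=> /(smooth_partial j)/smooth_continuous. Qed.

End smooth_plane.

(** * Convolution with a smooth kernel *)

Section convolution.
Variable R : realType.
Implicit Types (k f g : R * R -> R) (z w : R * R) (j : 'I_2).

Definition mollifier k := smooth k /\ exists N, forall z, N < `|z| -> k z = 0.

Lemma mollifier_bbs k : mollifier k -> bbs (area R) k.
Proof. by move=> [/smooth_continuous ck [N kN]]; exact: continuous_bbs ck kN. Qed.

Lemma mollifier_bounded k : mollifier k -> exists C, forall z, `|k z| <= C.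
Proof. by move=> /mollifier_bbs/bbs_bmeas[]. Qed.

Lemma mollifier_partial j k : mollifier k -> mollifier (partial j k).
Proof.
move=> [sk [N kN]]; split; first exact: smooth_partial.
exists N => z zN; exact: is_derive_outside kN zN (smooth_is_derive j z sk).
Qed.

Lemma mollifier_reflect_bmeas k z : mollifier k -> bmeas (fun w => k (z - w)).
Proof.
move=> kk; have [C kC] := mollifier_bounded kk; split; last by exists C.
apply: continuous_measurable_plane => w.
apply: (@cvg_comp _ _ _ (fun w => z - w) k _ (nbhs (z - w))).
  by apply: cvgB; [exact: cvg_cst|exact: cvg_id].
by have [/smooth_continuous ck _] := kk; exact: ck.
Qed.

Definition convol k f z : R := \int[area R]_w (k (z - w) * f w).

Lemma bbs_convol k f z : mollifier k -> bbs (area R) f ->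
  bbs (area R) (fun w => k (z - w) * f w).
Proof. by move=> kk bf; apply: bbsMr => //; exact: mollifier_reflect_bmeas. Qed.

Lemma bbs_norm f : bbs (area R) f -> bbs (area R) (fun w => `|f w|).
Proof.
move=> [mf [M [A [mA Aoo fM fA]]]]; split; first exact: measurableT_comp.
exists M, A; split => // z; first by rewrite normr_id.
by move=> /fA ->; rewrite normr0.
Qed.

Lemma convol_bounded k f : mollifier k -> bbs (area R) f ->
  exists C, forall z, `|convol k f z| <= C.
Proof.
move=> kk bf; have [C kC] := mollifier_bounded kk.
exists (\int[area R]_w (C * `|f w|)) => z.
apply: le_trans (le_normr_Rintegral _ _) _ => //.
  by apply: bbs_integrable; exact: bbs_convol.
apply: le_int.
- by apply: bbs_norm; exact: bbs_convol.
- by apply: bbsZ; exact: bbs_norm.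
- by move=> w; rewrite normrM ler_wpM2r.
Qed.

(** Differentiation under the integral sign; the derivative falls on the kernel,
    so [f] need only be bounded of bounded support. *)
Lemma is_derive_convol j k f z : mollifier k -> bbs (area R) f ->
  is_derive z (basis_vec R j) (convol k f) (convol (partial j k) f z).
Proof.
move=> kk bf; apply/is_derive_line.
pose F (h : R) (w : R * R) := k (h *: basis_vec R j + z - w) * f w.
pose dF (h : R) w := partial j k (h *: basis_vec R j + z - w) * f w.
have dk (h : R) w : is_derive h 1 (F ^~ w) (dF h w).
  have H : is_derive h 1 (fun h : R => k (h *: basis_vec R j + z - w))
                 (partial j k (h *: basis_vec R j + z - w)).
    have := smooth_is_derive j (h *: basis_vec R j + z - w) kk.1.
    move=> /is_derive_line H; apply/is_derive_line.
    suff -> : (fun t : R => k ((t *: 1 + h) *: basis_vec R j + z - w)) =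
              (fun t : R => k (t *: basis_vec R j + (h *: basis_vec R j + z - w))) by [].
    by apply/funext => t; congr k; rewrite [t *: 1]mulr1 scalerDl !addrA.
  have := is_deriveM H (is_derive_cst (f w) h 1).
  by rewrite scaler0 add0r /dF [in X in _ -> X]mulrC.
have d1F : partial1of2 F = dF.
  by apply/funext => h; apply/funext => w; rewrite partial1of2E; case: (dk h w).
have [C kC] := mollifier_bounded (mollifier_partial j kk).
have I0 : `](-1), 1[%classic (0 : R) by rewrite /= in_itv/= ltrN10 ltr01.
have intF (h : R) : `](-1), 1[%classic h -> (area R).-integrable setT (EFin \o F h).
  by move=> _; apply: bbs_integrable; exact: bbs_convol.
have derF (h : R) w : `](-1), 1[%classic h -> setT w -> derivable (F ^~ w) h 1.
  by move=> _ _; case: (dk h w).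
have C0 : 0 <= C by apply: le_trans (kC 0).
have G0 w : 0 <= C * `|f w| by rewrite mulr_ge0.
have intG : (area R).-integrable setT (EFin \o (fun w => C * `|f w|)).
  by apply: bbs_integrable; apply: bbsZ; exact: bbs_norm.
have Gub (h : R) w : `](-1), 1[%classic h -> setT w -> `|partial1of2 F h w| <= C * `|f w|.
  by move=> _ _; rewrite d1F /dF normrM ler_wpM2r.
have H1 := derivable_under_integral measurableT I0 intF derF G0 intG Gub.
have H2 := differentiation_under_integral measurableT I0 intF derF G0 intG Gub.
split; first exact: H1.
transitivity ((fun x' : R => \int[area R]_y F x' y)^`()%classic 0).
  by rewrite derive1E.
rewrite H2 d1F /dF /convol; apply: eq_Rintegral => w _.
by rewrite scale0r add0r.
Qed.

Lemma convol_continuous k f : mollifier k -> bbs (area R) f -> continuous (convol k f).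
Proof.
move=> kk bf.
have [C0 hC0] := convol_bounded (mollifier_partial 0 kk) bf.
have [C1 hC1] := convol_bounded (mollifier_partial 1 kk) bf.
apply: (@bounded_partial_continuous _ _ (fun j => convol (partial j k) f) (Num.max C0 C1)).
  by move=> j z; exact: is_derive_convol.
move=> j z; rewrite le_max; have [->|->] := ord2P j; first by rewrite hC0.
by rewrite hC1 orbT.
Qed.

End convolution.

(** * Averages and weak derivatives under convolution *)

Lemma young_disc (R : realType) (p q a b : R) : a ^+ 2 + b ^+ 2 <= 1 ->
  p * a + q * b <= (p ^+ 2 + q ^+ 2 + 1) / 2.
Proof.
by move=> ab1; have := sqr_ge0 (p - a); have := sqr_ge0 (q - b); nra.
Qed.

Section averages.
Context d (T : measurableType d) (R : realType) (mu : {measure set T -> \bar R}).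
Implicit Types (rho f g : T -> R).

Lemma le_average rho f (M : R) : bbs mu rho -> (forall w, 0 <= rho w) ->
  \int[mu]_w rho w = 1 -> bmeas f -> (forall w, `|f w| <= M) ->
  `|\int[mu]_w (rho w * f w)| <= M.
Proof.
move=> br r0 r1 bf fM; have brf := bbsM br bf.
rewrite ler_norml; apply/andP; split.
  have -> : - M = \int[mu]_w (- M * rho w) by rewrite intZ// r1 mulr1.
  apply: le_int => // [|w]; first exact: bbsZ.
  by rewrite mulrC ler_wpM2l//; move: (fM w); rewrite ler_norml => /andP[].
have -> : M = \int[mu]_w (M * rho w) by rewrite intZ// r1 mulr1.
apply: le_int => // [|w]; first exact: bbsZ.
by rewrite mulrC ler_wpM2r//; move: (fM w); rewrite ler_norml => /andP[].
Qed.

(** Averages of points of the unit disc stay in the disc: with [p] and [q] the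
    averages, [p ^ 2 + q ^ 2] is the average of [p f + q g], which is at most
    [(p ^ 2 + q ^ 2 + 1) / 2]. *)
Lemma average_disc rho f g : bbs mu rho -> (forall w, 0 <= rho w) ->
  \int[mu]_w rho w = 1 -> bmeas f -> bmeas g ->
  (forall w, f w ^+ 2 + g w ^+ 2 <= 1) ->
  (\int[mu]_w (rho w * f w)) ^+ 2 + (\int[mu]_w (rho w * g w)) ^+ 2 <= 1.
Proof.
move=> br r0 r1 bf bg fg1.
set p := \int[mu]_w (rho w * f w); set q := \int[mu]_w (rho w * g w).
have brf := bbsM br bf; have brg := bbsM br bg.
have H : p * p + q * q <= (p ^+ 2 + q ^+ 2 + 1) / 2.
  rewrite {2}/p {3}/q -!intZ// -intD; [|exact: bbsZ|exact: bbsZ].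
  have -> : (p ^+ 2 + q ^+ 2 + 1) / 2 = \int[mu]_w ((p ^+ 2 + q ^+ 2 + 1) / 2 * rho w).
    by rewrite intZ// r1 mulr1.
  apply: le_int => [| |w]; first by apply: bbsD; exact: bbsZ.
    exact: bbsZ.
  rewrite mulrCA [X in _ + X]mulrCA -mulrDr [leRHS]mulrC ler_wpM2l//.
  exact: young_disc.
move: H; rewrite -!expr2; move: (p ^+ 2 + q ^+ 2) => t; lra.
Qed.

End averages.

Section test_functions.
Variable R : realType.
Implicit Types (h k f g : R * R -> R) (z w : R * R) (j : 'I_2) (U K : set (R * R)).

Lemma test_function_compact U K h : smooth h -> compact K -> K `<=` U ->
  (forall z, ~ K z -> h z = 0) -> test_function U h.
Proof.
move=> sh cK KU h0.
have sub : closure [set z | h z != 0] `<=` K.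
  have clK : closed K by apply: compact_closed cK; exact: norm_hausdorff.
  apply: subset_trans (_ : closure K `<=` K); last exact: clK.
  apply: closure_subset => z /eqP hz; apply: contrapT => Kz.
  by apply: hz; exact: h0.
split => //; last exact: subset_trans sub KU.
exact: (subclosed_compact (@closed_closure _ _) cK sub).
Qed.

Lemma compact_square z (r : R) : compact [set w | `|z - w| <= r].
Proof.
have -> : [set w | `|z - w| <= r] =
  `[z.1 - r, z.1 + r]%classic `*` `[z.2 - r, z.2 + r]%classic.
  apply/seteqP; split => w /=; rewrite prod_normE/= ge_max !in_itv/= !ler_distlC.
    by move=> /andP[].
  by move=> [-> ->].
by apply: compact_setX; exact: segment_compact.
Qed.

Definition tensor (a b : R -> R) z := a z.1 * b z.2.

Lemma smooth_tensor (a b : R -> R) : smooth1 a -> smooth1 b -> smooth (tensor a b).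
Proof.
move=> sa sb; apply: (@smooth_mul _ (a \o fst) (b \o snd)).
  by apply: smooth_comp => //; exact: smooth_fst.
by apply: smooth_comp => //; exact: smooth_snd.
Qed.

Lemma partial_tensor (a b : R -> R) : smooth1 a -> smooth1 b ->
  partial 0 (tensor a b) = tensor a^`()%classic b /\
  partial 1 (tensor a b) = tensor a b^`()%classic.
Proof.
move=> /smooth1_derive[ad _] /smooth1_derive[bd _].
split; apply/funext => -[x y]; apply: partial_val; rewrite /tensor/=.
  have := (is_derive_slice (tensor a b) (x, y) (a^`()%classic x * b y)).1.
  move=> [_ H]; apply: H => /=; rewrite /tensor/=.
  have -> : a^`()%classic x * b y = b y * a^`()%classic x by rewrite mulrC.
  have := is_deriveM (ad x) (is_derive_cst (b y) x 1).
  by rewrite scaler0 add0r.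
have := (is_derive_slice (tensor a b) (x, y) (a x * b^`()%classic y)).2.
move=> [_ H]; apply: H => /=; rewrite /tensor/=.
exact: is_deriveZ (bd y).
Qed.

Lemma tensor_supp (a b : R -> R) (r : R) :
  (forall s, r <= `|s| -> a s = 0) -> (forall s, r <= `|s| -> b s = 0) ->
  forall z, r < `|z| -> tensor a b z = 0.
Proof.
move=> a0 b0 z; rewrite prod_normE lt_max /tensor => /orP[] /ltW.
  by move=> /a0 ->; rewrite mul0r.
by move=> /b0 ->; rewrite mulr0.
Qed.

Lemma mollifier_tensor (a b : R -> R) (r : R) : smooth1 a -> smooth1 b ->
  (forall s, r <= `|s| -> a s = 0) -> (forall s, r <= `|s| -> b s = 0) ->
  mollifier (tensor a b).
Proof.
move=> sa sb a0 b0; split; first exact: smooth_tensor.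
by exists r; exact: tensor_supp.
Qed.

Lemma tensor_mixed_partial (a b : R -> R) : smooth1 a -> smooth1 b ->
  partial 1 (partial 0 (tensor a b)) = partial 0 (partial 1 (tensor a b)).
Proof.
move=> sa sb; rewrite !(partial_tensor sa sb).1 !(partial_tensor sa sb).2.
have [_ sa'] := smooth1_derive sa; have [_ sb'] := smooth1_derive sb.
by rewrite (partial_tensor sa' sb).2 (partial_tensor sa sb').1.
Qed.

Lemma test_reflected_tensor U (a b : R -> R) (r : R) z :
  smooth1 a -> smooth1 b ->
  (forall s, r <= `|s| -> a s = 0) -> (forall s, r <= `|s| -> b s = 0) ->
  [set w | `|z - w| <= r] `<=` U ->
  test_function U (fun w => tensor a b (z - w)).
Proof.
move=> sa sb a0 b0 zU.
have sk : smooth (fun w => tensor a b (z - w)).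
  have -> : (fun w => tensor a b (z - w)) =
            tensor (fun s => a (-1 * s + z.1)) (fun s => b (-1 * s + z.2)).
    by apply/funext => w; rewrite /tensor /= !mulN1r ![- _ + _]addrC.
  by apply: smooth_tensor; exact: smooth1_affine.
apply: (test_function_compact sk (@compact_square z r) zU) => w /= zw.
by apply: (@tensor_supp a b r) => //; rewrite ltNge; apply/negP.
Qed.

Lemma partial_reflect k j z w : smooth k ->
  partial j (fun w => k (z - w)) w = - partial j k (z - w).
Proof.
move=> sk; apply: partial_val; apply/is_derive_line.
have := smooth_is_derive j (z - w) sk => /is_derive_line H.
have H' : is_derive (- (0 : R)) 1 (fun h : R => k (h *: basis_vec R j + (z - w)))
   (partial j k (z - w)) by rewrite oppr0.
have := is_derive1_comp H' (is_deriveN (is_derive_id (0 : R) 1)).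
rewrite mulrN1.
suff -> : (fun h : R => k (z - (h *: basis_vec R j + w))) =
  (fun h : R => k (h *: basis_vec R j + (z - w))) \o (- id) by [].
apply/funext => h /=; congr k.
by rewrite scaleNr opprD addrCA.
Qed.

(** Convolution turns a weak derivative into a classical one, at the points at
    which the reflected kernel is an admissible test function. *)
Lemma convol_weak_partial U j f g (k : R * R -> R) z : mollifier k ->
  bbs (area R) f -> bbs (area R) g ->
  (forall h, test_function U h ->
     \int[area R]_w (f w * partial j h w) = - \int[area R]_w (g w * h w)) ->
  test_function U (fun w => k (z - w)) ->
  convol (partial j k) f z = convol k g z.
Proof.
move=> kk bf bg wk /wk.
have -> : \int[area R]_w (f w * partial j (fun w => k (z - w)) w) =
          - convol (partial j k) f z.
  rewrite /convol -intN; last by apply: bbs_convol => //; exact: mollifier_partial.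
  by apply: eq_Rintegral => w _; rewrite (partial_reflect j z w kk.1) mulrN mulrC.
move=> /oppr_inj ->; rewrite /convol; apply: eq_Rintegral => w _.
by rewrite mulrC.
Qed.

End test_functions.

(** * Mollification by a tensor product *)

Lemma measurable_Rintegral d1 d2 (T1 : measurableType d1) (T2 : measurableType d2)
    (R : realType) (m : {sigma_finite_measure set T2 -> \bar R})
    (F : T1 * T2 -> R) :
  measurable_fun setT F -> measurable_fun setT (fun x => \int[m]_t F (x, t)).
Proof.
move=> mF; have mEF : measurable_fun setT (EFin \o F) by exact/measurable_EFinP.
apply: measurableT_comp => //.
have -> : (fun x => \int[m]_t (F (x, t))%:E)%E =
  (fun x => \int[m]_t ((EFin \o F)^\+ (x, t)) - \int[m]_t ((EFin \o F)^\- (x, t)))%E.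
  apply/funext => x; rewrite [LHS]integralE.
  by congr (_ - _)%E; apply: eq_integral => t _; rewrite ?funeposE ?funenegE.
apply: emeasurable_funB.
- by apply: (@measurable_fun_fubini_tonelli_F _ _ _ _ _ m (EFin \o F)^\+%E) => //;
    exact: measurable_funepos.
- by apply: (@measurable_fun_fubini_tonelli_F _ _ _ _ _ m (EFin \o F)^\-%E) => //;
    exact: measurable_funeneg.
Qed.

Section mollification.
Variable R : realType.
Let leb := @lebesgue_measure R.
Variables (b : R -> R) (B : R).
Hypothesis sb : smooth1 b.
Hypothesis b_ge0 : forall s, 0 <= b s.
Hypothesis b_even : forall s, b (- s) = b s.
Hypothesis b_supp : forall s, 1 <= `|s| -> b s = 0.
Hypothesis b_mass : (\int[leb]_s (b s)%:E)%E = 1%E.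
Hypothesis b_le : forall s, b s <= B.
Implicit Types (f g : R * R -> R) (z w : R * R).

Let cb : continuous b := smooth1_continuous sb.

Lemma smooth1_dilate (delta : R) : smooth1 (dilate b delta).
Proof.
apply: (@smooth1Z _ delta^-1 (fun s => b (delta^-1 * s))).
by apply: (smooth1_ext _ (smooth1_affine delta^-1 0 sb)) => s; rewrite addr0.
Qed.

(** A mollifier whose two widths can be sent to zero separately. *)
Definition moll (delta eps : R) := tensor (dilate b delta) (dilate b eps).

Lemma moll_supp (r delta eps : R) : 0 < delta <= r -> 0 < eps <= r ->
  (forall s, r <= `|s| -> dilate b delta s = 0) /\
  (forall s, r <= `|s| -> dilate b eps s = 0).
Proof.
move=> /andP[d0 dr] /andP[e0 er]; split => s rs; apply: dilate_supp => //.
  exact: le_trans dr rs.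
exact: le_trans er rs.
Qed.

Lemma mollifier_moll (delta eps : R) : 0 < delta -> 0 < eps ->
  mollifier (moll delta eps).
Proof.
move=> d0 e0; have [] := @moll_supp (Num.max delta eps) delta eps.
- by rewrite d0 le_max lexx.
- by rewrite e0 le_max lexx orbT.
by apply: mollifier_tensor; exact: smooth1_dilate.
Qed.

(** The limit of the mollification by [moll delta eps] when [delta] tends to
    zero. *)
Definition havg (eps : R) f z : R := \int[leb]_t (dilate b eps (z.2 - t) * f (z.1, t)).

Lemma havg_bound (eps M N : R) f : 0 < eps -> boxed M N f ->
  forall z, `|havg eps f z| <= M.
Proof.
move=> e0 bf z; apply: le_average.
- exact: bbs_dilate.
- by move=> t; apply: dilate_ge0 => //; exact: ltW.
- by rewrite /Rintegral dilate_mass.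
- exact/bbs_bmeas/(boxed_slice2 _ bf).
- by move=> t; case: bf.
Qed.

Lemma boxed_havg (eps M N : R) f : 0 < eps <= 1 -> boxed M N f ->
  boxed M (N + 1) (havg eps f).
Proof.
move=> /andP[e0 e1] bf; split; last 2 first.
- exact: havg_bound bf.
- case=> x y; rewrite prod_normE lt_max /havg /= => /orP[xN|yN].
    under eq_Rintegral => t _.
      have -> : f (x, t) = 0.
        have [_ _ fN] := bf; apply: fN; apply: lt_norm_fst.
        by apply: lt_trans xN; rewrite ltrDl.
      rewrite mulr0; over.
    by rewrite /Rintegral integral0.
  under eq_Rintegral => t _.
    have -> : dilate b eps (y - t) * f (x, t) = 0.
      have [tN|tN] := ltP N `|t|.
        have [_ _ ->] := bf; first by rewrite mulr0.
        exact: lt_norm_snd.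
      rewrite dilate_supp ?mul0r//; apply: le_trans e1 _.
      by have := lerB_dist y t; move: yN tN; lra.
    over.
  by rewrite /Rintegral integral0.
have [mf _ _] := bf.
apply: (@measurable_Rintegral _ _ _ _ _ leb
  (fun p : (R * R) * R => dilate b eps (p.1.2 - p.2) * f (p.1.1, p.2))).
apply: measurable_funM.
  have md : measurable_fun setT (dilate b eps).
    by apply: continuous_measurable_fun; exact: dilate_continuous.
  apply: (measurableT_comp md); apply: measurable_funB => //.
  exact: measurableT_comp.
apply: (measurableT_comp mf); apply: measurable_fun_pair => //.
exact: measurableT_comp.
Qed.

Lemma convol_moll_fubini (delta eps M N : R) f : 0 < delta -> 0 < eps ->
  boxed M N f -> forall z,
  convol (moll delta eps) f z =
  \int[leb]_s (dilate b delta (z.1 - s) * havg eps f (s, z.2)).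
Proof.
move=> d0 e0 bf z; have km := mollifier_moll d0 e0.
have [C kC] := mollifier_bounded km.
have bx : boxed (C * M) N (fun w => moll delta eps (z - w) * f w).
  have [mf fM fN] := bf; split.
  - apply: measurable_funM => //.
    by case: (mollifier_reflect_bmeas z km).
  - by move=> w; rewrite normrM; apply: ler_pM.
  - by move=> w /fN ->; rewrite mulr0.
rewrite /convol (int_fubini12 bx).2; apply: eq_Rintegral => s _.
rewrite /havg -intZ.
  apply: eq_Rintegral => t _; exact: esym (mulrA _ _ _).
apply: bbsM; first exact: bbs_dilate.
exact/bbs_bmeas/(boxed_slice2 _ bf).
Qed.

Lemma moll_mass (delta eps : R) z : 0 < delta -> 0 < eps ->
  [/\ bbs (area R) (fun w => moll delta eps (z - w)),
      forall w, 0 <= moll delta eps (z - w) &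
      \int[area R]_w moll delta eps (z - w) = 1].
Proof.
move=> d0 e0; have km := mollifier_moll d0 e0.
have [C kC] := mollifier_bounded km.
have [_ [r kr]] := km.
have bx : boxed C (`|z| + r) (fun w => moll delta eps (z - w)).
  split => //; first by case: (mollifier_reflect_bmeas z km).
  move=> w zw; apply: kr; have := ler_normD z (w - z).
  by rewrite addrC subrK (distrC w); move: zw; lra.
split; first exact: boxed_bbs bx.
  by move=> w; rewrite mulr_ge0// dilate_ge0// ltW.
rewrite (int_fubini12 bx).2.
transitivity (\int[leb]_s dilate b delta (z.1 - s)); last first.
  by rewrite /Rintegral dilate_mass.
apply: eq_Rintegral => s _; rewrite /moll /tensor /=.
rewrite intZ ?bbs_dilate//; last exact: bbs_dilate.
by rewrite [X in _ * X]/Rintegral dilate_mass// mulr1.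
Qed.

Lemma convol_moll_bound (delta eps M N : R) f : 0 < delta -> 0 < eps ->
  boxed M N f -> forall z, `|convol (moll delta eps) f z| <= M.
Proof.
move=> d0 e0 bf z; have [H1 H2 H3] := moll_mass z d0 e0.
apply: le_average => //; first exact: (bbs_bmeas (boxed_bbs bf)).
by case: bf.
Qed.

Lemma convol_moll_disc (delta eps M N : R) f g : 0 < delta -> 0 < eps ->
  boxed M N f -> boxed M N g -> (forall w, f w ^+ 2 + g w ^+ 2 <= 1) ->
  forall z, convol (moll delta eps) f z ^+ 2 + convol (moll delta eps) g z ^+ 2 <= 1.
Proof.
move=> d0 e0 bf bg fg z; have [H1 H2 H3] := moll_mass z d0 e0.
apply: average_disc => //; first exact: (bbs_bmeas (boxed_bbs bf)).
exact: (bbs_bmeas (boxed_bbs bg)).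
Qed.

Lemma havg_disc (eps M N : R) f g : 0 < eps ->
  boxed M N f -> boxed M N g -> (forall w, f w ^+ 2 + g w ^+ 2 <= 1) ->
  forall z, havg eps f z ^+ 2 + havg eps g z ^+ 2 <= 1.
Proof.
move=> e0 bf bg fg z; apply: average_disc => //.
- exact: bbs_dilate.
- by move=> t; apply: dilate_ge0 => //; exact: ltW.
- by rewrite /Rintegral dilate_mass.
- exact/bbs_bmeas/(boxed_slice2 _ bf).
- exact/bbs_bmeas/(boxed_slice2 _ bg).
Qed.

Lemma convol_moll_cvg (delta_ : nat -> R) (eps M N : R) f :
  (forall n, 0 < delta_ n) -> delta_ n @[n --> \oo] --> 0 -> 0 < eps <= 1 ->
  boxed M N f ->
  forall y, {ae leb, forall x,
    convol (moll (delta_ n) eps) f (x, y) @[n --> \oo] --> havg eps f (x, y)}.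
Proof.
move=> d_gt0 d_0 e01 bf y; have /andP[e0 _] := e01.
have ff : Filter (nbhs (almost_everywhere leb)) by exact: ae_filter_ringOfSetsType.
have bu := boxed_slice1 y (boxed_havg e01 bf).
have := dilate_cvg_ae cb b_ge0 b_even b_supp b_mass b_le bu d_gt0 d_0.
apply: filterS => x; apply: cvg_trans.
apply: near_eq_cvg; apply: nearW => n.
by rewrite (convol_moll_fubini (d_gt0 n) e0 bf).
Qed.

Lemma havg_cvg (eps_ : nat -> R) (M N : R) f :
  (forall n, 0 < eps_ n) -> eps_ n @[n --> \oo] --> 0 -> boxed M N f ->
  forall x, {ae leb, forall y, havg (eps_ n) f (x, y) @[n --> \oo] --> f (x, y)}.
Proof.
move=> e_gt0 e_0 bf x; have bu := boxed_slice2 x bf.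
exact: (dilate_cvg_ae cb b_ge0 b_even b_supp b_mass b_le bu e_gt0 e_0).
Qed.

End mollification.

(** * The Piola identity *)

Section piola.
Variable R : realType.
Implicit Types (z w : R * R) (i j : 'I_2) (e : R * R -> R) (de : 'I_2 -> R * R -> R)
  (p : 'I_2 -> R * R -> R) (d : 'I_2 -> 'I_2 -> R * R -> R).

(* The radial field is [F u = kappa (|u| ^ 2) u], whose divergence is
   [2 kappa + 2 |u| ^ 2 kappa'] at [|u| ^ 2]. It is only controlled on the closed
   unit disc, where the maps below take their values. *)
Variables (kappa dkappa : R -> R) (C : R).
Hypothesis kappa_der : forall t : R, 0 <= t <= 1 -> is_derive t 1 kappa (dkappa t).
Hypothesis dkappa_cont : forall t : R, 0 <= t <= 1 -> {for t, continuous dkappa}.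
Hypothesis kappa_le : forall t : R, 0 <= t <= 1 -> `|kappa t| <= C.
Hypothesis dkappa_le : forall t : R, 0 <= t <= 1 -> `|dkappa t| <= C.

Definition sqmod p z := p 0 z ^+ 2 + p 1 z ^+ 2.

(** The two components of [adj (Dp) F (p)]. *)
Definition piola_field p d (j : 'I_2) z : R :=
  kappa (sqmod p z) *
  (if j == 0 then p 0 z * d 1 1 z - p 1 z * d 0 1 z
   else p 1 z * d 0 0 z - p 0 z * d 1 0 z).

Definition jac d z : R := d 0 0 z * d 1 1 z - d 0 1 z * d 1 0 z.

(** [grad e . adj (Dp) F (p) + e det (Dp) (div F) (p)], which is the divergence of
    [e adj (Dp) F (p)] when [p] is smooth and [de] is the gradient of [e]. The
    derivatives are separate arguments so that one formula serves the map, its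
    mollifications and their limits. *)
Definition piola_integrand e de p d z : R :=
  de 0 z * piola_field p d 0 z + de 1 z * piola_field p d 1 z +
  e z * (jac d z * (2 * kappa (sqmod p z) + 2 * sqmod p z * dkappa (sqmod p z))).

Lemma sqmod_itv p z : sqmod p z <= 1 -> 0 <= sqmod p z <= 1.
Proof. by move=> ->; rewrite addr_ge0 ?sqr_ge0. Qed.

Lemma kappa_cont (t : R) : 0 <= t <= 1 -> {for t, continuous kappa}.
Proof.
move=> /kappa_der[kd _]; apply: differentiable_continuous.
exact/derivable1_diffP.
Qed.

Lemma cvg_sqmod (T : Type) (F : set_system T) {FF : Filter F}
    (a b : T -> R) (a0 b0 : R) : a x @[x --> F] --> a0 -> b x @[x --> F] --> b0 ->
  (a x ^+ 2 + b x ^+ 2) @[x --> F] --> a0 ^+ 2 + b0 ^+ 2.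
Proof.
by move=> ha hb; apply: cvgD; rewrite expr2; under eq_fun do rewrite expr2; exact: cvgM.
Qed.

Lemma piola_integrand_cvg (T : Type) (F : set_system T) {FF : Filter F}
   e de (p_ : T -> 'I_2 -> R * R -> R) (d_ : T -> 'I_2 -> 'I_2 -> R * R -> R) p d z :
  sqmod p z <= 1 ->
  (forall i, p_ n i z @[n --> F] --> p i z) ->
  (forall i j, d_ n i j z @[n --> F] --> d i j z) ->
  piola_integrand e de (p_ n) (d_ n) z @[n --> F] --> piola_integrand e de p d z.
Proof.
move=> pz hp hd; have hr := cvg_sqmod (hp 0) (hp 1).
have hk : kappa (sqmod (p_ n) z) @[n --> F] --> kappa (sqmod p z).
  apply: (@cvg_comp _ _ _ (fun n => sqmod (p_ n) z) kappa F (nbhs (sqmod p z))).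
    exact: hr.
  exact: (kappa_cont (sqmod_itv pz)).
have hdk : dkappa (sqmod (p_ n) z) @[n --> F] --> dkappa (sqmod p z).
  apply: (@cvg_comp _ _ _ (fun n => sqmod (p_ n) z) dkappa F (nbhs (sqmod p z))).
    exact: hr.
  exact: (dkappa_cont (sqmod_itv pz)).
rewrite /piola_integrand /piola_field /jac /=.
have cst2 (c : R) : (fun=> c) @ F --> c by exact: cvg_cst.
apply: cvgD; [apply: cvgD|].
- apply: cvgM; first exact: cst2.
  by apply: cvgM; [exact: hk|apply: cvgB; apply: cvgM].
- apply: cvgM; first exact: cst2.
  by apply: cvgM; [exact: hk|apply: cvgB; apply: cvgM].
- apply: cvgM; first exact: cst2.
  apply: cvgM; first by apply: cvgB; exact: cvgM.
  apply: cvgD; first by apply: cvgM; [exact: cst2|exact: hk].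
  apply: cvgM; last exact: hdk.
  by apply: cvgM; [exact: cst2|exact: hr].
Qed.

Lemma piola_integrand_bound e de p d (E D : R) z :
  `|e z| <= E -> (forall j, `|de j z| <= E) -> (forall i, `|p i z| <= 1) ->
  (forall i j, `|d i j z| <= D) -> sqmod p z <= 1 ->
  `|piola_integrand e de p d z| <= E * (C * (D + D)) + E * (C * (D + D)) +
     E * ((D * D + D * D) * (2 * C + 2 * C)).
Proof.
move=> eE deE p1 dD pz; have pI := sqmod_itv pz.
have E0 : 0 <= E by apply: le_trans eE.
have pd i i' j' : `|p i z * d i' j' z| <= D.
  by rewrite normrM -[leRHS]mul1r; apply: ler_pM.
have dd i j i' j' : `|d i j z * d i' j' z| <= D * D by rewrite normrM; apply: ler_pM.
have kC := kappa_le pI; have dkC := dkappa_le pI.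
have subm a b a' b' : `|a| <= a' -> `|b| <= b' -> `|a - b| <= a' + b' :> R.
  by move=> ha hb; apply: le_trans (ler_normB _ _) _; exact: lerD.
have addm a b a' b' : `|a| <= a' -> `|b| <= b' -> `|a + b| <= a' + b' :> R.
  by move=> ha hb; apply: le_trans (ler_normD _ _) _; exact: lerD.
have mulm a b a' b' : `|a| <= a' -> `|b| <= b' -> `|a * b| <= a' * b' :> R.
  by move=> ha hb; rewrite normrM; apply: ler_pM.
have two : `|2| <= 2 :> R by rewrite ger0_norm.
rewrite /piola_integrand /piola_field /jac /=.
apply: (addm); [apply: (addm)|]; apply: (mulm) => //.
- by apply: (mulm) => //; apply: (subm).
- by apply: (mulm) => //; apply: (subm).
- apply: (mulm) => //; first by apply: (subm).
  apply: (addm); apply: (mulm) => //.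
  have /andP[p0 _] := pI.
  by rewrite normrM ger0_norm// (ger0_norm p0) -[leRHS]mulr1 ler_wpM2l.
Qed.

(* Turns continuity on [[0, 1]] into measurability on the whole line. *)
Let clamp (t : R) : R := Num.max 0 (Num.min t 1).

Lemma measurable_clamped (k : R -> R) (u : R * R -> R) :
  (forall t, 0 <= t <= 1 -> {for t, continuous k}) ->
  measurable_fun setT u -> (forall z, 0 <= u z <= 1) ->
  measurable_fun setT (fun z => k (u z)).
Proof.
move=> ck mu uI.
have clampI t : 0 <= clamp t <= 1.
  by rewrite /clamp le_max lexx ge_max ler01 ge_min lexx orbT.
have cclamp : continuous clamp.
  move=> t; apply: (@continuous_max _ _ (cst 0) (fun t : R => Num.min t 1) t).
    exact: cvg_cst.
  by apply: (@continuous_min _ _ id (cst 1) t); [exact: cvg_id|exact: cvg_cst].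
have ckc : continuous (k \o clamp).
  by move=> t; apply: continuous_comp; [exact: cclamp|exact: ck].
have -> : (fun z => k (u z)) = (k \o clamp) \o u.
  apply/funext => z /=; congr k; have /andP[u0 u1] := uI z.
  by rewrite /clamp (min_l u1) (max_r u0).
by apply: measurableT_comp => //; exact: continuous_measurable_fun.
Qed.

Lemma measurable_piola_integrand e de p d :
  measurable_fun setT e -> (forall j, measurable_fun setT (de j)) ->
  (forall i, measurable_fun setT (p i)) ->
  (forall i j, measurable_fun setT (d i j)) -> (forall z, sqmod p z <= 1) ->
  measurable_fun setT (piola_integrand e de p d).
Proof.
move=> me mde mp md p1.
have msq : measurable_fun setT (sqmod p).
  by apply: measurable_funD; apply: measurable_funX.
have mk : measurable_fun setT (fun z => kappa (sqmod p z)).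
  apply: measurable_clamped => //; first exact: kappa_cont.
  by move=> z; exact: sqmod_itv.
have mdk : measurable_fun setT (fun z => dkappa (sqmod p z)).
  by apply: measurable_clamped => // z; exact: sqmod_itv.
have mM (f g : R * R -> R) : measurable_fun setT f -> measurable_fun setT g ->
  measurable_fun setT (fun z => f z * g z) by move=> *; exact: measurable_funM.
have mB (f g : R * R -> R) : measurable_fun setT f -> measurable_fun setT g ->
  measurable_fun setT (fun z => f z - g z) by move=> *; exact: measurable_funB.
have mD (f g : R * R -> R) : measurable_fun setT f -> measurable_fun setT g ->
  measurable_fun setT (fun z => f z + g z) by move=> *; exact: measurable_funD.
rewrite /piola_integrand /piola_field /jac /=.
apply: (mD); [apply: (mD)|]; apply: (mM) => //.
- by apply: (mM) => //; apply: (mB); exact: mM.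
- by apply: (mM) => //; apply: (mB); exact: mM.
- apply: (mM); first by apply: (mB); exact: mM.
  by apply: (mD); [exact: mM|apply: (mM) => //; exact: mM].
Qed.

Lemma is_derive_sub (f g : R * R -> R) z v (df dg : R) :
  is_derive z v f df -> is_derive z v g dg ->
  is_derive z v (fun x => f x - g x) (df - dg).
Proof. exact: is_deriveB. Qed.

(** The classical Piola identity: the field [kappa (|p| ^ 2) adj (Dp) p] has
    divergence [det (Dp)] times the divergence of the radial field at [p]; the
    second derivatives cancel by symmetry. *)
Lemma piola_classical e p d (q : 'I_2 -> R * R -> R) (N : R) :
  smooth e -> (forall z, N < `|z| -> e z = 0) ->
  (forall i j z, is_derive z (basis_vec R j) (p i) (d i j z)) ->
  (forall i z, is_derive z (basis_vec R 1) (d i 0) (q i z)) ->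
  (forall i z, is_derive z (basis_vec R 0) (d i 1) (q i z)) ->
  (forall i, continuous (p i)) -> (forall i j, continuous (d i j)) ->
  (forall i, continuous (q i)) -> (forall z, sqmod p z <= 1) ->
  \int[area R]_z piola_integrand e (fun j => partial j e) p d z = 0.
Proof.
move=> se eN dp dq1 dq0 cp cd cq p1.
have pI z := sqmod_itv (p1 z).
have ce := smooth_continuous se.
have cde j : continuous (partial j e) by exact: smooth_partial_continuous.
have de0 j z : N < `|z| -> partial j e z = 0.
  by move=> zN; exact: is_derive_outside eN zN (smooth_is_derive j z se).
pose s j z := 2 * (p 0 z * d 0 j z + p 1 z * d 1 j z).
have ds j z : is_derive z (basis_vec R j) (sqmod p) (s j z).
  have -> : s j z = (p 0 z * d 0 j z + p 0 z * d 0 j z) + (p 1 z * d 1 j z + p 1 z * d 1 j z).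
    by rewrite /s; ring.
  have -> : sqmod p = (fun z => p 0 z * p 0 z + p 1 z * p 1 z).
    by apply/funext => w; rewrite /sqmod !expr2.
  by apply: is_deriveDd; apply: is_deriveMm; exact: dp.
have dk j z : is_derive z (basis_vec R j) (fun z => kappa (sqmod p z))
                 (dkappa (sqmod p z) * s j z).
  exact: is_derive_chain (ds j z) (kappa_der (pI z)).
pose m0 z := p 0 z * d 1 1 z - p 1 z * d 0 1 z.
pose m1 z := p 1 z * d 0 0 z - p 0 z * d 1 0 z.
pose dm0 z := (p 0 z * q 1 z + d 1 1 z * d 0 0 z) - (p 1 z * q 0 z + d 0 1 z * d 1 0 z).
pose dm1 z := (p 1 z * q 0 z + d 0 0 z * d 1 1 z) - (p 0 z * q 1 z + d 1 0 z * d 0 1 z).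
have hm0 z : is_derive z (basis_vec R 0) m0 (dm0 z).
  by apply: is_derive_sub; apply: is_deriveMm.
have hm1 z : is_derive z (basis_vec R 1) m1 (dm1 z).
  by apply: is_derive_sub; apply: is_deriveMm.
pose y0 z := kappa (sqmod p z) * m0 z; pose y1 z := kappa (sqmod p z) * m1 z.
pose dy0 z := kappa (sqmod p z) * dm0 z + m0 z * (dkappa (sqmod p z) * s 0 z).
pose dy1 z := kappa (sqmod p z) * dm1 z + m1 z * (dkappa (sqmod p z) * s 1 z).
have hy0 z : is_derive z (basis_vec R 0) y0 (dy0 z) by exact: is_deriveMm.
have hy1 z : is_derive z (basis_vec R 1) y1 (dy1 z) by exact: is_deriveMm.
pose dG0 z := e z * dy0 z + y0 z * partial 0 e z.
pose dG1 z := e z * dy1 z + y1 z * partial 1 e z.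
have hG0 z : is_derive z (basis_vec R 0) (fun z => e z * y0 z) (dG0 z).
  by apply: is_deriveMm => //; exact: smooth_is_derive.
have hG1 z : is_derive z (basis_vec R 1) (fun z => e z * y1 z) (dG1 z).
  by apply: is_deriveMm => //; exact: smooth_is_derive.
have cM (f g : R * R -> R) : continuous f -> continuous g ->
    continuous (fun z => f z * g z).
  by move=> cf cg z; apply: cvgM; [exact: cf|exact: cg].
have cB (f g : R * R -> R) : continuous f -> continuous g ->
    continuous (fun z => f z - g z).
  by move=> cf cg z; apply: cvgB; [exact: cf|exact: cg].
have cD (f g : R * R -> R) : continuous f -> continuous g ->
    continuous (fun z => f z + g z).
  by move=> cf cg z; apply: cvgD; [exact: cf|exact: cg].
have csq : continuous (sqmod p).
  by move=> z; apply: cvg_sqmod; exact: cp.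
have ck : continuous (fun z => kappa (sqmod p z)).
  by move=> z; apply: continuous_comp; [exact: csq|exact: (kappa_cont (pI z))].
have cdk : continuous (fun z => dkappa (sqmod p z)).
  by move=> z; apply: continuous_comp; [exact: csq|exact: (dkappa_cont (pI z))].
have cs j : continuous (s j).
  apply: (cM); first by move=> z; exact: cvg_cst.
  by apply: (cD); apply: (cM).
have cm0 : continuous m0 by apply: (cB); apply: (cM).
have cm1 : continuous m1 by apply: (cB); apply: (cM).
have cdm0 : continuous dm0 by apply: (cB); apply: (cD); apply: (cM).
have cdm1 : continuous dm1 by apply: (cB); apply: (cD); apply: (cM).
have cdy0 : continuous dy0 by apply: (cD); apply: (cM) => //; apply: (cM).
have cdy1 : continuous dy1 by apply: (cD); apply: (cM) => //; apply: (cM).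
have cy0 : continuous y0 by apply: (cM).
have cy1 : continuous y1 by apply: (cM).
have cG0 : continuous dG0 by apply: (cD); apply: (cM).
have cG1 : continuous dG1 by apply: (cD); apply: (cM).
have G0N z : N < `|z| -> e z * y0 z = 0 by move=> /eN ->; rewrite mul0r.
have G1N z : N < `|z| -> e z * y1 z = 0 by move=> /eN ->; rewrite mul0r.
have dG0N z : N < `|z| -> dG0 z = 0.
  by move=> zN; rewrite /dG0 eN// de0// mul0r mulr0 addr0.
have dG1N z : N < `|z| -> dG1 z = 0.
  by move=> zN; rewrite /dG1 eN// de0// mul0r mulr0 addr0.
have -> : \int[area R]_z piola_integrand e (fun j => partial j e) p d z =
          \int[area R]_z (dG0 z + dG1 z).
  apply: eq_Rintegral => z _.
  rewrite /piola_integrand /piola_field /jac /dG0 /dG1 /dy0 /dy1 /y0 /y1 /m0 /m1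
          /dm0 /dm1 /s /=.
  have -> : 2 * sqmod p z = 2 * (p 0 z * p 0 z + p 1 z * p 1 z).
    by rewrite /sqmod !expr2.
  move: (kappa _) (dkappa _) (e z) (partial 0 e z) (partial 1 e z).
  move: (p 0 z) (p 1 z) (d 0 0 z) (d 0 1 z) (d 1 0 z) (d 1 1 z) (q 0 z) (q 1 z).
  by move=> *; ring.
rewrite intD; [|exact: continuous_bbs cG0 dG0N|exact: continuous_bbs cG1 dG1N].
by rewrite (int_partial hG0 cG0 G0N) (int_partial hG1 cG1 G1N) addr0.
Qed.

End piola.

Lemma compact_thickening (R : realType) (K U : set (R * R)) : compact K ->
  open U -> K `<=` U ->
  exists2 r : R, 0 < r <= 1 &
    forall z w, K z -> `|z - w| <= r -> U w.
Proof.
move=> /compact_near_coveringP cK oU KU.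
have : \forall r \near (0 : R)^'+, K `<=` [set z | forall w, `|z - w| <= r -> U w].
  apply: (cK _ _ (fun r z => forall w, `|z - w| <= r -> U w)) => z Kz.
  have /nbhs_ballP[e /= e0 zeU] := open_nbhs_nbhs (conj oU (KU _ Kz)).
  have e20 : 0 < e / 2 by rewrite divr_gt0.
  exists (ball z (e / 2), [set r : R | 0 < r < e / 2]); first split.
  - exact: nbhsx_ballx.
  - by near=> r => /=; apply/andP; split.
  - move=> [z' r] /= []; rewrite -ball_normE/= => zz' /andP[r0 re] w zw.
    apply: zeU; rewrite -ball_normE/=.
    have := ler_distD z' z w; move: zz' zw; lra.
move=> H.
have : \forall r \near (0 : R)^'+, (0 < r <= 1) /\
   K `<=` [set z | forall w, `|z - w| <= r -> U w].
  near=> r; split; last by near: r.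
  apply/andP; split; near: r; [exact: nbhs_right_gt|exact: nbhs_right_le].
move=> /filter_ex[r [r01 KrU]]; exists r => // z w Kz; exact: KrU.
Unshelve. all: by end_near. Qed.

Section weak_piola.
Variable R : realType.
Let leb := @lebesgue_measure R.
Variables (kappa dkappa : R -> R) (C : R).
Hypothesis kappa_der : forall t : R, 0 <= t <= 1 -> is_derive t 1 kappa (dkappa t).
Hypothesis dkappa_cont : forall t : R, 0 <= t <= 1 -> {for t, continuous dkappa}.
Hypothesis kappa_le : forall t : R, 0 <= t <= 1 -> `|kappa t| <= C.
Hypothesis dkappa_le : forall t : R, 0 <= t <= 1 -> `|dkappa t| <= C.
Let pint := piola_integrand kappa dkappa.

Lemma piola_integrand_local (e : R * R -> R) (p p' : 'I_2 -> R * R -> R)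
    (d d' : 'I_2 -> 'I_2 -> R * R -> R) (K : set (R * R)) :
  (forall z, ~ K z -> e z = 0 /\ forall j, partial j e z = 0) ->
  (forall i z, K z -> p i z = p' i z) -> (forall i j z, K z -> d i j z = d' i j z) ->
  pint e (fun j => partial j e) p d = pint e (fun j => partial j e) p' d'.
Proof.
move=> e0 pp dd; apply/funext => z; rewrite /pint /piola_integrand.
have [Kz|Kz] := pselect (K z); last first.
  by have [-> de] := e0 z Kz; rewrite !de !mul0r.
by rewrite /piola_field /jac /sqmod !pp// !dd.
Qed.

Lemma test_function_zero (U : set (R * R)) (e : R * R -> R) : test_function U e ->
  let K := closure [set z | e z != 0] in
  forall z, ~ K z -> e z = 0 /\ forall j, partial j e z = 0.
Proof.
move=> [se _ _] K z Kz.
have nz : \forall w \near z, e w = 0.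
  have oK : open (~` K) by apply: closed_openC; exact: closed_closure.
  have := open_nbhs_nbhs (conj oK Kz); apply: filterS => w Kw.
  by apply/eqP; apply: contrapT => /negP ew; apply: Kw; exact: subset_closure.
split=> [|j]; first exact: nbhs_singleton nz.
have -> : partial j e z = 'D_(basis_vec R j) (cst 0) z by exact: near_eq_derive.
exact: derive_cst.
Qed.

Lemma compact_in_box (K : set (R * R)) : compact K ->
  exists N, forall z, K z -> `|z| <= N.
Proof.
move=> /compact_bounded[M [_ KM]]; exists (M + 1) => z Kz.
by apply: (KM (M + 1)) => //; rewrite ltrDl.
Qed.

Lemma boxed_piola (e : R * R -> R) (E D N : R) (p : 'I_2 -> R * R -> R)
    (d : 'I_2 -> 'I_2 -> R * R -> R) :
  smooth e -> (forall z, `|e z| <= E) -> (forall j z, `|partial j e z| <= E) ->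
  (forall z, N < `|z| -> e z = 0 /\ forall j, partial j e z = 0) ->
  (forall i, measurable_fun setT (p i)) -> (forall i j, measurable_fun setT (d i j)) ->
  (forall i z, `|p i z| <= 1) -> (forall i j z, `|d i j z| <= D) ->
  (forall z, sqmod p z <= 1) ->
  boxed (E * (C * (D + D)) + E * (C * (D + D)) + E * ((D * D + D * D) * (2 * C + 2 * C))) N
    (pint e (fun j => partial j e) p d).
Proof.
move=> se eE deE eN mp md p1 dD sp; split.
- apply: measurable_piola_integrand => //.
  + by apply: continuous_measurable_plane; exact: smooth_continuous.
  + by move=> j; apply: continuous_measurable_plane; exact: smooth_partial_continuous.
- by move=> z; apply: piola_integrand_bound.
- by move=> z /eN[e0 de0]; rewrite /pint /piola_integrand e0 !de0 !mul0r !addr0.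
Qed.

Lemma zero_limit (u : nat -> R) (l : R) : (forall n, u n = 0) ->
  u n @[n --> \oo] --> l -> l = 0.
Proof.
move=> /funext -> ul.
exact: (cvg_unique (@Rhausdorff R) ul (@cvg_cst _ (0 : R) _ _ _)).
Qed.

#[local] Instance ae_leb_filter : Filter (nbhs (almost_everywhere leb)).
Proof. exact: ae_filter_ringOfSetsType. Qed.

Lemma ae_ord2 (P : 'I_2 -> R -> Prop) : (forall i, {ae leb, forall x, P i x}) ->
  {ae leb, forall x, forall i, P i x}.
Proof.
move=> aeP; apply: filterS2 (aeP 0) (aeP 1) => x P0 P1 i.
by have [->|->] := ord2P i.
Qed.

(** Piola's identity for a bounded map with bounded weak derivatives. The map
    is averaged with a tensor mollifier of widths [delta] and [eps]; the widths
    are sent to zero one after the other, because Lebesgue's differentiation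
    theorem on lines then gives the convergence almost everywhere that the
    product of derivatives in the Jacobian requires. *)
Lemma piola_weak (U : set (R * R)) (e : R * R -> R) (D N : R)
    (p : 'I_2 -> R * R -> R) (d : 'I_2 -> 'I_2 -> R * R -> R) :
  open U -> test_function U e ->
  (forall i, boxed 1 N (p i)) -> (forall i j, boxed D N (d i j)) ->
  (forall z, sqmod p z <= 1) ->
  (forall i j h, test_function U h ->
     \int[area R]_w (p i w * partial j h w) = - \int[area R]_w (d i j w * h w)) ->
  \int[area R]_z pint e (fun j => partial j e) p d z = 0.
Proof.
move=> oU te bp bd p1 wk; have [se cK KU] := te.
set K := closure [set z | e z != 0] in cK KU.
have e0 := test_function_zero te; rewrite /= -/K in e0.
have [r /andP[r0 r1] KrU] := compact_thickening cK oU KU.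
have [Ne KN] := compact_in_box cK.
have eN z : Ne < `|z| -> e z = 0 /\ forall j, partial j e z = 0.
  by move=> zN; apply: e0 => /KN; rewrite leNgt zN.
have [E0 hE0] := (bbs_bmeas (continuous_bbs (smooth_continuous se) (fun z h => (eN z h).1))).2.
have hdE j := (bbs_bmeas (continuous_bbs
  (smooth_partial_continuous (j := j) se) (fun z h => (eN z h).2 j))).2.
have [E1 hE1] := hdE 0; have [E2 hE2] := hdE 1.
pose E := Num.max E0 (Num.max E1 E2).
have eE z : `|e z| <= E by rewrite le_max hE0.
have deE j z : `|partial j e z| <= E.
  rewrite !le_max; have [->|->] := ord2P j; first by rewrite hE1 orbT.
  by rewrite hE2 !orbT.
have [b [sb b_ge0 b_even b_supp [b_mass [B b_le]]]] := bump_exists R.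
pose w_ (n : nat) : R := r / n.+1%:R.
have w_gt0 n : 0 < w_ n by rewrite divr_gt0.
have w_r n : w_ n <= r by rewrite ler_pdivrMr// ler_peMr ?ler1n// ltW.
have w_1 n : 0 < w_ n <= 1 by rewrite w_gt0 (le_trans (w_r n)).
have w_0 : w_ n @[n --> \oo] --> 0.
  rewrite -(mulr0 r); apply: cvgM; first exact: cvg_cst.
  exact: cvg_harmonic.
have mp i : measurable_fun setT (p i) by case: (bp i).
have md i j : measurable_fun setT (d i j) by case: (bd i j).
have sb' (m : nat) := smooth1_dilate sb (w_ m).
have bbp i := boxed_bbs (bp i); have bbd i j := boxed_bbs (bd i j).
pose mol m n := moll b (w_ m) (w_ n).
have kmol m n : mollifier (mol m n).
  exact: (mollifier_moll sb b_supp (w_gt0 m) (w_gt0 n)).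
pose pa m n i := convol (mol m n) (p i).
pose da m n i j := convol (mol m n) (d i j).
pose ph n i := havg b (w_ n) (p i).
pose dh n i j := havg b (w_ n) (d i j).
(* At fixed widths the averages are smooth, and on the support of [e] their
   derivatives are the averages of the weak derivatives. *)
have step0 m n : \int[area R]_z pint e (fun j => partial j e) (pa m n) (da m n) z = 0.
  pose dp i j := convol (partial j (mol m n)) (p i).
  have -> : pint e (fun j => partial j e) (pa m n) (da m n) =
            pint e (fun j => partial j e) (pa m n) dp.
    apply: (piola_integrand_local e0) => // i j z Kz.
    rewrite /da /dp; apply/esym.
    apply: (convol_weak_partial (kmol m n) (bbp i) (bbd i j) (wk i j)).
    have [s1 s2] := @moll_supp _ b b_supp r (w_ m) (w_ n)
       (introT andP (conj (w_gt0 m) (w_r m))) (introT andP (conj (w_gt0 n) (w_r n))).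
    apply: (test_reflected_tensor (sb' m) (sb' n) s1 s2) => w /=.
    exact: KrU.
  have dk j : mollifier (partial j (mol m n)) by exact: mollifier_partial.
  apply: (@piola_classical _ _ _ kappa_der dkappa_cont e (pa m n) dp
     (fun i => convol (partial 1 (partial 0 (mol m n))) (p i)) Ne) => //.
  - by move=> z /eN[].
  - by move=> i j z; exact: is_derive_convol.
  - by move=> i z; apply: is_derive_convol.
  - move=> i z; rewrite /mol /moll (tensor_mixed_partial (sb' m) (sb' n)).
    exact: is_derive_convol.
  - by move=> i; exact: convol_continuous.
  - by move=> i j; exact: convol_continuous.
  - by move=> i; apply: convol_continuous => //; exact: mollifier_partial.
  - move=> z; exact: (convol_moll_disc sb b_ge0 b_even b_supp b_mass b_le (w_gt0 m)
      (w_gt0 n) (bp 0) (bp 1) p1).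
have bph n i := boxed_havg sb b_ge0 b_even b_supp b_mass b_le (w_1 n) (bp i).
have bdh n i j := boxed_havg sb b_ge0 b_even b_supp b_mass b_le (w_1 n) (bd i j).
have sph n : forall z, sqmod (ph n) z <= 1.
  exact: (havg_disc sb b_ge0 b_even b_supp b_mass b_le (w_gt0 n) (bp 0) (bp 1) p1).
have bpint1 n := @boxed_piola e E D Ne (ph n) (dh n) se eE deE eN
  (fun i => let: And3 m _ _ := bph n i in m) (fun i j => let: And3 m _ _ := bdh n i j in m)
  (fun i => let: And3 _ m _ := bph n i in m) (fun i j => let: And3 _ m _ := bdh n i j in m)
  (sph n).
(* First limit, along horizontal lines. *)
have step1 n : \int[area R]_z pint e (fun j => partial j e) (ph n) (dh n) z = 0.
  have bpa m : boxed (E * (C * (D + D)) + E * (C * (D + D)) +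
      E * ((D * D + D * D) * (2 * C + 2 * C))) Ne
      (pint e (fun j => partial j e) (pa m n) (da m n)).
    apply: boxed_piola => //.
    + by move=> i; apply: continuous_measurable_plane; exact: convol_continuous.
    + by move=> i j; apply: continuous_measurable_plane; exact: convol_continuous.
    + move=> i z; exact: (convol_moll_bound sb b_ge0 b_even b_supp b_mass b_le
        (w_gt0 m) (w_gt0 n) (bp i)).
    + move=> i j z; exact: (convol_moll_bound sb b_ge0 b_even b_supp b_mass b_le
        (w_gt0 m) (w_gt0 n) (bd i j)).
    + exact: (convol_moll_disc sb b_ge0 b_even b_supp b_mass b_le (w_gt0 m)
        (w_gt0 n) (bp 0) (bp 1) p1).
  apply: (zero_limit (fun m => step0 m n)).
  apply: (@slice_dct R 0 _ _ _ _ bpa (bpint1 n)) => y.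
  have cp i := convol_moll_cvg sb b_ge0 b_even b_supp b_mass b_le w_gt0 w_0 (w_1 n) (bp i) y.
  have cd i j := convol_moll_cvg sb b_ge0 b_even b_supp b_mass b_le w_gt0 w_0 (w_1 n) (bd i j) y.
  apply: filterS2 (ae_ord2 cp) (ae_ord2 (fun i => ae_ord2 (cd i))) => x hp hd.
  exact: piola_integrand_cvg.
apply: (zero_limit step1).
have bpint : boxed (E * (C * (D + D)) + E * (C * (D + D)) +
    E * ((D * D + D * D) * (2 * C + 2 * C))) Ne
    (pint e (fun j => partial j e) p d).
  apply: boxed_piola => //; first by move=> i z; case: (bp i).
  by move=> i j z; case: (bd i j).
(* Second limit, along vertical lines. *)
apply: (@slice_dct R 1 _ _ _ _ bpint1 bpint) => x.
have cp i := havg_cvg sb b_ge0 b_even b_supp b_mass b_le w_gt0 w_0 (bp i) x.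
have cd i j := havg_cvg sb b_ge0 b_even b_supp b_mass b_le w_gt0 w_0 (bd i j) x.
apply: filterS2 (ae_ord2 cp) (ae_ord2 (fun i => ae_ord2 (cd i))) => y hp hd.
exact: piola_integrand_cvg.
Qed.

End weak_piola.

(** * The Bessel function in the squared radius *)

Section bessel.
Variable R : realType.
Implicit Types (i k n : nat) (x t : R).

Definition bessel_coef i k : R := (-1) ^+ (k + i) / (k`! * (k + i)`!)%N%:R.

(** [bessel i (s ^ 2 / 4)] is [(-2 / s) ^ i J_i (s)]; in particular [bessel 0] is
    up to scaling the radial profile of the first Dirichlet eigenfunction of a
    disc, written in the squared radius. The index counts derivatives. *)
Definition bessel i x : R := limn (pseries (bessel_coef i) x).

Lemma pseries_diffs_bessel i : pseries_diffs (bessel_coef i) = bessel_coef i.+1.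
Proof.
apply/funext => k; rewrite /pseries_diffs /bessel_coef addSn addnS mulrCA.
congr (_ * _); rewrite factS -mulnA natrM invfM mulrA mulfV ?mul1r//.
Qed.

Lemma cvg_pseries_bessel i x : cvgn (pseries (bessel_coef i) x).
Proof.
apply: normed_cvg; apply: series_le_cvg (is_cvg_series_exp_coeff `|x|) => n /=.
- exact: normr_ge0.
- by rewrite /exp_coeff /= divr_ge0// exprn_ge0.
rewrite /bessel_coef /exp_coeff /= normrM normrM normfV normrX normrN1 expr1n.
rewrite mul1r normrX mulrC ler_wpM2l ?exprn_ge0// ger0_norm// lef_pV2 ?posrE.
- by rewrite ler_nat leq_pmulr// fact_gt0.
- by rewrite ltr0n muln_gt0 !fact_gt0.
- by rewrite ltr0n fact_gt0.
Qed.

Lemma is_derive_bessel i x : is_derive x 1 (bessel i) (bessel i.+1 x).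
Proof.
rewrite /bessel -pseries_diffs_bessel; apply: (@pseries_snd_diffs _ _ (`|x| + 1)).
- exact: cvg_pseries_bessel.
- by rewrite pseries_diffs_bessel; exact: cvg_pseries_bessel.
- by rewrite !pseries_diffs_bessel; exact: cvg_pseries_bessel.
- by rewrite [ltRHS]ger0_norm ?ltrDl// addr_ge0.
Qed.

Lemma smooth1_bessel i : smooth1 (bessel i).
Proof.
move=> n; elim: n i => [//|n ih] i; exists (bessel i.+1); split => // x.
exact: is_derive_bessel.
Qed.

Lemma bessel_continuous i : continuous (bessel i).
Proof. exact/smooth1_continuous/smooth1_bessel. Qed.

Lemma bessel_coef_ode k :
  bessel_coef 2 k + bessel_coef 1 k.+1 + bessel_coef 0 k.+1 = 0.
Proof.
rewrite /bessel_coef !addn2 !addn1 addn0 !exprS.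
rewrite !factS !natrM.
have k0 : k`!%:R != 0 :> R by rewrite pnatr_eq0 -lt0n fact_gt0.
have k1 : k.+1%:R != 0 :> R by rewrite pnatr_eq0.
have k2 : k.+2%:R != 0 :> R by rewrite pnatr_eq0.
have e1 : k.+1%:R = k%:R + 1 :> R by rewrite -natr1.
have e2 : k.+2%:R = k%:R + 2 :> R by rewrite -natr1 -natr1 -addrA.
rewrite e1 in k1 *; rewrite e2 in k2 *.
by field; rewrite k0 k1 k2.
Qed.

(** The Bessel equation in the squared radius. It holds for the partial sums, the
    one of [bessel 2] having one term less since it carries the factor [x]. *)
Lemma bessel_ode x : x * bessel 2 x + bessel 1 x + bessel 0 x = 0.
Proof.
have cv i := @cvg_pseries_bessel i x.
have part n : x * pseries (bessel_coef 2) x n + pseries (bessel_coef 1) x n.+1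
    + pseries (bessel_coef 0) x n.+1 = 0.
  elim: n => [|n ih].
    rewrite /pseries /series /= !big_nat1 big_geq// /bessel_coef /= !expr0.
    by rewrite !factS !fact0; lra.
  rewrite /pseries /series /=.
  rewrite big_nat_recr// [X in _ + X + _]big_nat_recr// [X in _ + X = 0]big_nat_recr//=.
  move: ih (bessel_coef_ode n); rewrite /pseries /series /=.
  set s2 := \sum_(0 <= _ < n) _; set s1 := \sum_(0 <= _ < n.+1) _.
  set s0 := \sum_(0 <= _ < n.+1) _ => ih ode.
  have -> : x * (s2 + bessel_coef 2 n * x ^+ n) + (s1 + bessel_coef 1 n.+1 * x ^+ n.+1)
     + (s0 + bessel_coef 0 n.+1 * x ^+ n.+1) =
     (x * s2 + s1 + s0) + (bessel_coef 2 n + bessel_coef 1 n.+1 + bessel_coef 0 n.+1) * x ^+ n.+1.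
    by rewrite exprS; ring.
  by rewrite ih ode mul0r addr0.
have lim : (x * pseries (bessel_coef 2) x n + pseries (bessel_coef 1) x n.+1
    + pseries (bessel_coef 0) x n.+1) @[n --> \oo] -->
    x * bessel 2 x + bessel 1 x + bessel 0 x.
  apply: cvgD; [apply: cvgD|].
  - by apply: cvgM; [exact: cvg_cst|exact: cv].
  - by have := cv 1%N; rewrite -(cvg_shiftS (pseries (bessel_coef 1) x)).
  - by have := cv 0%N; rewrite -(cvg_shiftS (pseries (bessel_coef 0) x)).
exact: zero_limit part lim.
Qed.

Lemma bessel0 : bessel 0 0 = 1.
Proof.
apply/cvg_lim => //.
apply: (@cvg_trans _ ((fun=> 1 : R) @ \oo)); last exact: cvg_cst.
apply: near_eq_cvg; near=> n.
have n0 : (0 < n)%N by near: n; exact: nbhs_infty_gt.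
rewrite /pseries /series /= big_ltn// big_nat_cond big1 ?addr0.
  by rewrite expr0 /bessel_coef fact0 expr0 divr1 mulr1.
by move=> i /andP[/andP[i0 _] _]; rewrite expr0n gtn_eqF// mulr0.
Unshelve. all: by end_near. Qed.

(** The lower bound holds with [4 t] for all [t] below the first zero. In the
    other alternative it holds with every constant, so that every quotient on
    [Omega] is infinite and the comparison follows as well. *)
Lemma bessel_first_zero : (forall t, 0 <= t -> 0 < bessel 0 t) \/
  exists t0, [/\ 0 < t0, bessel 0 t0 = 0 &
    forall t, 0 <= t -> t < t0 -> 0 < bessel 0 t].
Proof.
have cf := @bessel_continuous 0.
pose Z := [set t : R | 0 <= t /\ bessel 0 t <= 0].
have [[t1 Zt1]|Z0] := pselect (Z !=set0); last first.
  by left=> t t0; rewrite ltNge; apply/negP => ft; apply: Z0; exists t.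
right; have lbZ : has_inf Z by split; [exists t1|exists 0 => t []].
pose t0 := inf Z; exists t0.
have before t : 0 <= t -> t < t0 -> 0 < bessel 0 t.
  move=> t_ge0 tt0; rewrite ltNge; apply/negP => ft.
  have : t0 <= t by apply: ge_inf => //; case: lbZ.
  by rewrite leNgt tt0.
have t0_ge0 : 0 <= t0 by apply: lb_le_inf => [|t []//]; exists t1.
have ft0 : bessel 0 t0 <= 0.
  rewrite leNgt; apply/negP => ft0.
  have H : \forall t \near t0, 0 < bessel 0 t by exact: (cvgr_gt _ (cf t0) _ ft0).
  have /nbhs_ballP[e /= e0 fe] := H.
  have [t [t_ge0 ft] tt0] : exists2 t, Z t & t < t0 + e by exact: inf_adherent.
  have t0t : t0 <= t by apply: ge_inf; [case: lbZ|split].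
  have : 0 < bessel 0 t.
    apply: (fe t); rewrite -ball_normE /= distrC ger0_norm ?subr_ge0//.
    by rewrite ltrBlDl.
  by rewrite ltNge ft.
have t0_gt0 : 0 < t0.
  rewrite lt_neqAle t0_ge0 andbT; apply/eqP => t00.
  by move: ft0; rewrite -t00 bessel0 ler10.
split => //; apply/eqP; rewrite eq_le ft0 /= leNgt; apply/negP => ft0'.
have H : \forall t \near t0, bessel 0 t < 0 by exact: (cvgr_lt _ (cf t0) _ ft0').
have /nbhs_ballP[e /= e0 fe] := H.
pose t := Num.max 0 (t0 - e / 2).
have tt0 : t < t0 by rewrite /t gt_max t0_gt0 /=; lra.
have t_ge0 : 0 <= t by rewrite le_max lexx.
have := before t t_ge0 tt0; rewrite ltNge => /negP; apply; apply: ltW.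
apply: fe; rewrite -ball_normE /= ger0_norm ?subr_ge0 ?ltW//.
have : t0 - e / 2 <= t by rewrite le_max lexx orbT.
lra.
Qed.

End bessel.

(** * Algebra of the Beltrami equation *)

Section beltrami.
Variable R : realType.
Implicit Types (M D : 'M[R]_2) (g : 'cV[R]_2).

(** The real form of the Beltrami equation: the differential [(p, q; r, s)]
    satisfies [D M = cof D], the Cauchy-Riemann equations twisted by [M]. *)
Lemma beltrami_real (a b c p q r s : R) : 0 < a -> 0 < c -> a * c - b ^+ 2 = 1 ->
  (p - s) * (2 + a + c) = (c - a) * (p + s) + 2 * b * (r - q) ->
  (r + q) * (2 + a + c) = (c - a) * (r - q) - 2 * b * (p + s) ->
  s = a * p + b * q /\ r = - b * p - c * q.
Proof.
move=> a0 c0 det1 E1 E2.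
have T0 : 2 + a + c != 0 by rewrite gt_eqF//; lra.
have e1 : (1 + a) * p - (1 + c) * s - b * (r - q) = 0 by lra.
have e2 : (1 + a) * r + (1 + c) * q + b * (p + s) = 0 by lra.
have acE : a * c = 1 + b ^+ 2 by lra.
have Tu : (2 + a + c) * (s - (a * p + b * q)) =
  - ((1 + a) * ((1 + a) * p - (1 + c) * s - b * (r - q)) +
     b * ((1 + a) * r + (1 + c) * q + b * (p + s)))
  + (a * c - 1 - b ^+ 2) * (- s - p) by ring.
have Tv : (2 + a + c) * (r - (- b * p - c * q)) =
  (1 + c) * ((1 + a) * r + (1 + c) * q + b * (p + s)) +
     b * ((1 + a) * p - (1 + c) * s - b * (r - q))
  + (a * c - 1 - b ^+ 2) * (q - r) by ring.
rewrite e1 e2 acE !mulr0 addr0 oppr0 add0r in Tu.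
rewrite e1 e2 acE !mulr0 addr0 add0r in Tv.
split; apply/eqP; rewrite -subr_eq0 -(mulrI_eq0 _ (mulfI T0)) ?Tu ?Tv; apply/eqP; ring.
Qed.

(** The determinant is the value of the form of [(a, b; b, c)] at [(p, q)], hence
    nonnegative; once it is one, [a], [b] and [c] follow from [a c - b ^ 2 = 1]. *)
Lemma beltrami_quadratic (a b c p q : R) : a * c - b ^+ 2 = 1 -> 0 < a ->
  let s := a * p + b * q in let r := - b * p - c * q in
  `|p * s - q * r| = 1 ->
  [/\ p * s - q * r = 1, a = s ^+ 2 + q ^+ 2, b = - (s * r) - q * p & c = r ^+ 2 + p ^+ 2].
Proof.
move=> det1 a0 s r.
have acE : a * c = 1 + b ^+ 2 by lra.
pose J := a * p ^+ 2 + 2 * b * p * q + c * q ^+ 2.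
have JE : p * s - q * r = J by rewrite /s /r /J; ring.
have J0 : 0 <= J.
  rewrite -(pmulr_rge0 _ a0).
  have -> : a * J = (a * p + b * q) ^+ 2 + q ^+ 2 + (a * c - 1 - b ^+ 2) * q ^+ 2.
    by rewrite /J; ring.
  have -> : a * c - 1 - b ^+ 2 = 0 by lra.
  by rewrite mul0r addr0 addr_ge0 ?sqr_ge0.
rewrite JE ger0_norm// => J1; split => //.
- have -> : s ^+ 2 + q ^+ 2 = a * J - (a * c - 1 - b ^+ 2) * q ^+ 2.
    by rewrite /s /J; ring.
  by rewrite J1 acE; ring.
- have -> : - (s * r) - q * p = b * J + (a * c - 1 - b ^+ 2) * p * q.
    by rewrite /s /r /J; ring.
  by rewrite J1 acE; ring.
- have -> : r ^+ 2 + p ^+ 2 = c * J - (a * c - 1 - b ^+ 2) * p ^+ 2.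
    by rewrite /r /J; ring.
  by rewrite J1 acE; ring.
Qed.

Lemma innerE (u v : 'cV[R]_2) : inner u v = u 0 0 * v 0 0 + u 1 0 * v 1 0.
Proof. by rewrite /inner !big_ord_recl big_ord0 addr0; do 4 f_equal; exact: val_inj. Qed.

Lemma mulmx2E M g (i : 'I_2) : (M *m g) i 0 = M i 0 * g 0 0 + M i 1 * g 1 0.
Proof. by rewrite mxE !big_ord_recl big_ord0 addr0; do 4 f_equal; exact: val_inj. Qed.

Lemma det2E M : \det M = M 0 0 * M 1 1 - M 0 1 * M 1 0.
Proof.
rewrite (expand_det_row _ 0) !big_ord_recl big_ord0 addr0 /cofactor !det_mx11 !mxE /=.
rewrite expr0 mul1r expr1 mulN1r mulrN.
by congr (_ * M _ _ - M _ _ * M _ _); exact: val_inj.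
Qed.

Lemma enorm_sqr (u : 'cV[R]_2) : enorm u ^+ 2 = inner u u.
Proof.
by rewrite sqr_sqrtr// innerE addr_ge0// -expr2 sqr_ge0.
Qed.

(** The square of the Euclidean norm of [adj(D)^T g]. *)
Definition cof_form D g : R :=
  (D 1 1 * g 0 0 - D 1 0 * g 1 0) ^+ 2 + (D 0 0 * g 1 0 - D 0 1 * g 0 0) ^+ 2.

(** The Jacobian is a value of the form of [M], so that being unimodular it is
    one, and the coefficient matrix is recovered from the differential as
    [adj(D) adj(D)^T]. The diagonal entries of [M] are thus the squared norms of
    the columns of [adj(D)^T], and they are at most [K] by ellipticity. *)
Lemma beltrami_unimodular M D (K : R) : M^T = M -> \det M = 1 -> 1 <= K ->
  (forall xi : 'cV[R]_2,
     K^-1 * enorm xi ^+ 2 <= inner (M *m xi) xi <= K * enorm xi ^+ 2) ->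
  dzbar D = beltrami_coef M * dz D -> `|\det D| = 1 ->
  [/\ \det D = 1, forall g, inner (M *m g) g = cof_form D g &
      forall i j, `|D i j| <= K].
Proof.
move=> Msym det1 K1 ell belt J1.
have b01 : M 1 0 = M 0 1 by rewrite -{1}Msym mxE.
have K0 : 0 < K^-1 by rewrite invr_gt0; lra.
have ell0 := ell (delta_mx 0 0); have ell1 := ell (delta_mx 1 0).
rewrite !enorm_sqr !innerE !mulmx2E !mxE /= in ell0 ell1.
move: ell0 ell1; rewrite !(mulr1, mulr0, mul1r, mul0r, addr0, add0r).
move=> /andP[a_lo a_up] /andP[c_lo c_up].
move: det1; rewrite det2E b01 -expr2 => det1.
have T0 : \det (1%:M + M) = 2 + M 0 0 + M 1 1.
  rewrite det2E !mxE /= b01; move: det1.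
  move: (M 0 0) (M 0 1) (M 1 1) => a b c det1.
  have -> : (1%:R + a) * (1%:R + c) - (0%:R + b) * (0%:R + b) =
    1 + a + c + (a * c - b ^+ 2) by ring.
  by rewrite det1; ring.
have T1 : 2 + M 0 0 + M 1 1 != 0 by rewrite gt_eqF//; lra.
have bel2 : dzbar D * 2 * (2 + M 0 0 + M 1 1)%:C%C =
   ((M 1 1 - M 0 0) +i* (- (2 * M 0 1)))%C * (dz D * 2).
  rewrite belt /beltrami_coef T0.
  have TC : (2 + M 0 0 + M 1 1)%:C%C != 0 :> R[i].
    by apply: contra T1 => /eqP[->].
  by field; move: TC; rewrite !rmorphD rmorph1.
move: bel2; rewrite /dzbar /dz !divfK ?pnatr_eq0//.
have cM (x y x' y' : R) :
  ((x +i* y) * (x' +i* y') = (x * x' - y * y') +i* (x * y' + y * x'))%C by [].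
have cD (x y x' y' : R) : ((x +i* y) + (x' +i* y') = (x + x') +i* (y + y'))%C by [].
have cN (x y : R) : (- (x +i* y) = (- x) +i* (- y))%C by [].
have cR (x : R) : (x%:C = x +i* 0)%C by [].
rewrite cR !(cM, cN, cD) => -[E1 E2].
have [] := @beltrami_real (M 0 0) (M 0 1) (M 1 1) (D 0 0) (D 0 1) (D 1 0) (D 1 1).
- lra.
- lra.
- by [].
- by move: E1; lra.
- by move: E2; lra.
move=> sE rE; move: J1; rewrite det2E sE rE => J1.
have a0 : 0 < M 0 0 by lra.
have [detD aE bE cE] := beltrami_quadratic det1 a0 J1.
rewrite -sE -rE in detD aE bE cE; split.
- by rewrite -sE -rE.
- move=> g; rewrite innerE !mulmx2E b01 aE bE cE /cof_form; ring.
have sq (x y : R) : x ^+ 2 + y ^+ 2 <= K -> `|x| <= K /\ `|y| <= K.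
  have tr (z : R) : z ^+ 2 <= K -> `|z| <= K.
    move=> zK; have : `|z| ^+ 2 <= K ^+ 2.
      by rewrite real_normK ?num_real// (le_trans zK)// expr2 ler_peMl//; lra.
    by rewrite ler_pXn2r// nnegrE//; lra.
  by move=> xyK; split; apply: tr; apply: le_trans xyK; rewrite ?lerDl ?lerDr sqr_ge0.
have [h11 h01] : `|D 1 1| <= K /\ `|D 0 1| <= K by apply: sq; rewrite -aE.
have [h10 h00] : `|D 1 0| <= K /\ `|D 0 0| <= K by apply: sq; rewrite -cE.
by move=> i j; have [->|->] := ord2P i; have [->|->] := ord2P j.
Qed.

End beltrami.

(** * Picone's inequality *)

Section picone.
Variable R : realType.

(** The logarithmic gradient of [z |-> bessel 0 (t1 |z| ^ 2)], as a radial field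
    on the closed unit disc; the last property says
    [div F + |F| ^ 2 = - 4 t1]. *)
Lemma riccati_field (t1 : R) : 0 <= t1 ->
  (forall t, 0 <= t -> t <= t1 -> 0 < bessel 0 t) ->
  exists (kappa dkappa : R -> R) (C : R),
  [/\ (forall t : R, 0 <= t <= 1 -> is_derive t 1 kappa (dkappa t)),
      (forall t : R, 0 <= t <= 1 -> {for t, continuous dkappa}),
      (forall t : R, 0 <= t <= 1 -> `|kappa t| <= C),
      (forall t : R, 0 <= t <= 1 -> `|dkappa t| <= C) &
      (forall t : R, 0 <= t <= 1 ->
         2 * kappa t + 2 * t * dkappa t + t * kappa t ^+ 2 = - (4 * t1))].
Proof.
move=> t1_ge0 fpos.
pose f i t : R := bessel i (t1 * t + 0).
have sf i : smooth1 (f i) by apply: smooth1_affine; exact: smooth1_bessel.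
have cf i : continuous (f i) by exact: smooth1_continuous.
have df i (t : R) : is_derive t 1 (f i) (t1 * f i.+1 t).
  rewrite mulrC; apply: (@is_derive1_comp _ (bessel i) (fun t => t1 * t + 0)).
    exact: is_derive_bessel.
  exact: is_derive_affine.
have f0 t : 0 <= t <= 1 -> 0 < f 0%N t.
  move=> /andP[t0 t_le1]; apply: fpos; rewrite addr0 ?mulr_ge0//.
  by rewrite ler_piMr.
pose kappa t : R := 2 * t1 * (f 1%N t * (f 0%N t)^-1).
pose dkappa t : R := 2 * t1 * (f 1%N t * (- (f 0%N t) ^- 2 * (t1 * f 1%N t))
   + (f 0%N t)^-1 * (t1 * f 2%N t)).
have dk (t : R) : 0 <= t <= 1 -> is_derive t 1 kappa (dkappa t).
  move=> /f0 ft; have nz : f 0%N t != 0 by rewrite gt_eqF.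
  exact: is_deriveZ (is_deriveM (df 1%N t) (is_deriveV nz (df 0%N t))).
have cinv (t : R) : 0 <= t <= 1 -> {for t, continuous (fun t => (f 0%N t)^-1)}.
  by move=> /f0 ft; apply: cvgV; [rewrite gt_eqF|exact: cf].
have cst (t c : R) : {for t, continuous (fun _ : R => c)} by exact: cvg_cst.
have cdk (t : R) : 0 <= t <= 1 -> {for t, continuous dkappa}.
  move=> tI; have ci := cinv t tI.
  apply: cvgM; first exact: (cst t).
  apply: cvgD; apply: cvgM.
  - exact: cf.
  - apply: cvgM; last by apply: cvgM; [exact: (cst t)|exact: cf].
    apply: cvgN; apply: cvgV; first by rewrite expf_neq0// gt_eqF// f0.
    have -> : (fun x => f 0%N x ^+ 2) = (fun x => f 0%N x * f 0%N x).
      by apply/funext => x; rewrite expr2.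
    by rewrite expr2; apply: cvgM; exact: cf.
  - exact: ci.
  - by apply: cvgM; [exact: (cst t)|exact: cf].
have ck (t : R) : 0 <= t <= 1 -> {for t, continuous kappa}.
  by move=> /dk[kd _]; apply: differentiable_continuous; apply/derivable1_diffP.
have bnd (k : R -> R) : (forall t : R, 0 <= t <= 1 -> {for t, continuous k}) ->
    exists M, forall t : R, 0 <= t <= 1 -> `|k t| <= M.
  move=> kc; have /compact_bounded[M [_ MP]] : compact (k @` `[0, 1]).
    apply: continuous_compact; last exact: segment_compact.
    apply: continuous_in_subspaceT => t /set_mem /=.
    by rewrite in_itv/=; exact: kc.
  exists (M + 1) => t tI; apply: (MP (M + 1)); first by rewrite ltrDl.
  by exists t => //=; rewrite in_itv.
have [C1 hC1] := bnd _ ck; have [C2 hC2] := bnd _ cdk.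
exists kappa, dkappa, (Num.max C1 C2); split => //.
- by move=> t /hC1 h; rewrite le_max h.
- by move=> t /hC2 h; rewrite le_max h orbT.
- move=> t /f0 ft; have nz : f 0%N t != 0 by rewrite gt_eqF.
  have := bessel_ode (t1 * t + 0); rewrite -/(f 0%N t) -/(f 1%N t) -/(f 2%N t) addr0.
  rewrite /kappa /dkappa; move: nz; move: (f 0%N t) (f 1%N t) (f 2%N t) => g0 g1 g2 nz ode.
  have -> : 2 * (2 * t1 * (g1 / g0)) +
    2 * t * (2 * t1 * (g1 * (- g0 ^- 2 * (t1 * g1)) + g0^-1 * (t1 * g2))) +
    t * (2 * t1 * (g1 / g0)) ^+ 2 = 4 * t1 * ((t1 * t * g2 + g1) / g0) by field.
  have -> : t1 * t * g2 + g1 = - g0 by lra.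
  by rewrite mulNr divff// mulrN1.
Qed.

Lemma ae_int_ge0 (f : R * R -> R) : bbs (area R) f ->
  {ae area R, forall z, 0 <= f z} -> 0 <= \int[area R]_z f z.
Proof.
move=> bf f0.
have -> : \int[area R]_z f z = \int[area R]_z `|f z|.
  apply: ae_eq_int => //; first exact: bbs_norm.
  by apply: filterS f0 => z ?; rewrite ger0_norm.
exact: Rintegral_ge0.
Qed.

Lemma test_function_bbs (U : set (R * R)) h : test_function U h ->
  bbs (area R) h /\ forall j, bbs (area R) (partial j h).
Proof.
move=> th; have [sh cK _] := th; have h0 := test_function_zero th.
have [N KN] := compact_in_box cK.
have hN z : N < `|z| -> h z = 0 /\ forall j, partial j h z = 0.
  by move=> zN; apply: h0 => /KN; rewrite leNgt zN.
split; first exact: continuous_bbs (smooth_continuous sh) (fun z zN => (hN z zN).1).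
move=> j; apply: continuous_bbs (fun z zN => (hN z zN).2 j).
exact: smooth_partial_continuous.
Qed.

(** [|adj(d)^T grad h| ^ 2]. *)
Definition pull_form (d : 'I_2 -> 'I_2 -> R * R -> R) (h : R * R -> R) z : R :=
  (d 1 1 z * partial 0 h z - d 1 0 z * partial 1 h z) ^+ 2 +
  (d 0 0 z * partial 1 h z - d 0 1 z * partial 0 h z) ^+ 2.

Lemma bbs_sqr (f : R * R -> R) : bbs (area R) f -> bbs (area R) (fun z => f z ^+ 2).
Proof. by move=> bf; under eq_fun do rewrite expr2; apply: bbsM => //; exact: (bbs_bmeas bf). Qed.

Lemma bbs_pull_form (U : set (R * R)) d h : test_function U h ->
  (forall i j, bmeas (d i j)) -> bbs (area R) (pull_form d h).
Proof.
move=> th bd; have [_ bh] := test_function_bbs th.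
have bdh i j k : bbs (area R) (fun z => d i j z * partial k h z).
  by apply: bbsMr; [exact: bd|exact: bh].
by apply: bbsD; apply: bbs_sqr; apply: bbsB; exact: bdh.
Qed.

Lemma smooth_sqr (h : R * R -> R) : smooth h -> smooth (fun z => h z ^+ 2).
Proof.
by move=> sh; under eq_fun do rewrite expr2; exact: smooth_mul.
Qed.

Lemma partial_sqr (h : R * R -> R) j z : smooth h ->
  partial j (fun z => h z ^+ 2) z = 2 * h z * partial j h z.
Proof.
move=> sh; apply: partial_val; have hd := smooth_is_derive j z sh.
have -> : 2 * h z * partial j h z = h z * partial j h z + h z * partial j h z by ring.
have -> : (fun z => h z ^+ 2) = (fun z => h z * h z).
  by apply/funext => w; rewrite expr2.
exact: is_deriveMm.
Qed.

Lemma test_function_sqr (U : set (R * R)) h : test_function U h ->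
  test_function U (fun z => h z ^+ 2).
Proof.
move=> th; have [sh cK KU] := th.
apply: (test_function_compact (smooth_sqr sh) cK KU) => z /(test_function_zero th)[-> _].
by rewrite expr0n.
Qed.

(** Picone's inequality: with [F] the radial field, expand the square of
    [adj(d)^T grad h - h F(p)] and integrate the cross term by parts with
    Piola's identity. *)
Lemma picone_test (t1 : R) (U : set (R * R)) (D N : R)
    (p : 'I_2 -> R * R -> R) (d : 'I_2 -> 'I_2 -> R * R -> R) h :
  0 <= t1 -> (forall t, 0 <= t -> t <= t1 -> 0 < bessel 0 t) ->
  open U -> test_function U h ->
  (forall i, boxed 1 N (p i)) -> (forall i j, boxed D N (d i j)) ->
  (forall z, sqmod p z <= 1) ->
  (forall i j h, test_function U h ->
     \int[area R]_w (p i w * partial j h w) = - \int[area R]_w (d i j w * h w)) ->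
  {ae area R, forall z, U z -> jac d z = 1} ->
  4 * t1 * \int[area R]_z (h z ^+ 2) <= \int[area R]_z pull_form d h z.
Proof.
move=> t1_ge0 fpos oU th bp bd p1 wk jac1.
have [kappa [dkappa [C [dk cdk kC dkC ric]]]] := riccati_field t1_ge0 fpos.
have th2 := test_function_sqr th; have [sh cK KU] := th; have [se cK2 _] := th2.
have piola := piola_weak dk cdk kC dkC oU th2 bp bd p1 wk.
have [bh bdh] := test_function_bbs th; have [be bde] := test_function_bbs th2.
set pint := piola_integrand _ _ _ _ _ _ in piola.
have bpint : bbs (area R) pint.
  have e0 := test_function_zero th2.
  have [Ne KN] := compact_in_box cK2.
  have [E0 hE0] := (bbs_bmeas be).2.
  have [E1 hE1] := (bbs_bmeas (bde 0)).2; have [E2 hE2] := (bbs_bmeas (bde 1)).2.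
  apply: boxed_bbs; apply: (@boxed_piola _ kappa dkappa C dk cdk kC dkC _
    (Num.max E0 (Num.max E1 E2)) D Ne) => //.
  - by move=> z; rewrite le_max hE0.
  - move=> j z; rewrite !le_max; have [->|->] := ord2P j.
      by apply/orP; right; apply/orP; left; exact: hE1.
    by apply/orP; right; apply/orP; right; exact: hE2.
  - by move=> z zN; apply: e0 => /KN; rewrite leNgt zN.
  - by move=> i; case: (bp i).
  - by move=> i j; case: (bd i j).
  - by move=> i z; case: (bp i).
  - by move=> i j z; case: (bd i j).
have bQ : bbs (area R) (pull_form d h).
  by apply: (bbs_pull_form th) => i j; exact: (bbs_bmeas (boxed_bbs (bd i j))).
have bt : bbs (area R) (fun z => 4 * t1 * h z ^+ 2) by exact: bbsZ.
have bh2 := bbs_sqr bh.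
suff : 0 <= \int[area R]_z (pull_form d h z - 4 * t1 * h z ^+ 2 - pint z).
  by rewrite intB ?piola ?subr0 ?intB ?intZ ?subr_ge0//; exact: bbsB.
apply: ae_int_ge0; first by apply: bbsB => //; exact: bbsB.
apply: filterS jac1 => z jz.
have sI := sqmod_itv (p1 z).
rewrite /pint /piola_integrand !partial_sqr// /pull_form /piola_field /=.
have [Uz|Uz] := pselect (U z); last first.
  have [-> dh] := test_function_zero th (fun Kz => Uz (KU _ Kz)).
  by rewrite !dh le_eqVlt; apply/orP; left; apply/eqP; ring.
have := ric _ sI; rewrite (jz Uz).
set k := kappa _; set dk' := dkappa _ => ricz.
have := sqr_ge0 (d 1 1 z * partial 0 h z - d 1 0 z * partial 1 h z - h z * (k * p 0 z)).
have := sqr_ge0 (d 0 0 z * partial 1 h z - d 0 1 z * partial 0 h z - h z * (k * p 1 z)).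
move=> s1 s2; apply: le_trans (addr_ge0 s1 s2) _; rewrite le_eqVlt; apply/orP; left.
apply/eqP; have -> : 4 * t1 = - (2 * k + 2 * sqmod p z * dk' + sqmod p z * k ^+ 2).
  by rewrite ricz opprK.
by rewrite /sqmod; ring.
Qed.

End picone.

Section picone_map.
Variable R : realType.
Implicit Types (Omega U : set (R * R)) (h f g : R * R -> R).

Lemma int_in_zero Omega f : measurable Omega -> bbs (area R) f ->
  (forall z, ~ Omega z -> f z = 0) ->
  (\int[area R]_(z in Omega) (f z)%:E)%E = (\int[area R]_z f z)%:E.
Proof.
move=> mO bf f0; rewrite -(int_EFin bf).
rewrite [LHS](@integral_mkcond _ _ _ (area R)).
apply: eq_integral => z _.
by rewrite patchE; case: ifPn => // /negP zO; rewrite f0// => Oz; apply: zO; rewrite inE.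
Qed.

Lemma Rint_in_zero Omega f : (forall z, ~ Omega z -> f z = 0) ->
  \int[area R]_(z in Omega) f z = \int[area R]_z f z.
Proof.
move=> f0; rewrite Rintegral_mkcond; apply: eq_Rintegral => z _.
by rewrite patchE; case: ifPn => // /negP zO; rewrite f0// => Oz; apply: zO; rewrite inE.
Qed.

Lemma test_function_sub U Omega h : U `<=` Omega -> test_function U h ->
  test_function Omega h.
Proof. by move=> UO [sh cK KU]; split => //; exact: subset_trans KU UO. Qed.

Lemma test_function_out Omega h z : test_function Omega h -> ~ Omega z ->
  h z = 0 /\ forall j, partial j h z = 0.
Proof.
move=> th Oz; have [_ _ KO] := th.
by apply: (test_function_zero th) => Kz; apply: Oz; exact: KO.
Qed.

Definition cutoff (K x : R) : R := if `|x| <= K then x else 0.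

Lemma measurable_cutoff (K : R) : measurable_fun setT (cutoff K).
Proof.
apply: measurable_fun_ifT => //.
by apply: measurable_fun_ler => //; exact: measurableT_comp.
Qed.

Lemma cutoff_le (K x : R) : 0 <= K -> `|cutoff K x| <= K.
Proof. by move=> K0; rewrite /cutoff; case: ifP => // _; rewrite normr0. Qed.

Lemma cutoff_id (K x : R) : `|x| <= K -> cutoff K x = x.
Proof. by rewrite /cutoff => ->. Qed.

Lemma sqL2norm_test Omega h : measurable Omega -> test_function Omega h ->
  sqL2norm Omega h = (\int[area R]_z (h z ^+ 2))%:E.
Proof.
move=> mO th; have [bh _] := test_function_bbs th.
rewrite -(int_in_zero mO (bbs_sqr bh)); last first.
  by move=> z /(test_function_out th)[-> _]; rewrite expr0n.
by apply: eq_integral => z _; rewrite real_normK// num_real.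
Qed.

(** Picone's inequality for the pulled-back form. Near the support of [h] the
    map and its differential agree almost everywhere with bounded Borel
    functions of bounded support, to which the mollification applies. *)
Lemma picone_map (t1 K : R) Omega (phi : R * R -> R * R) (Dphi : R * R -> 'M[R]_2) h :
  0 <= t1 -> (forall t, 0 <= t -> t <= t1 -> 0 < bessel 0 t) -> 0 <= K ->
  open Omega -> (forall z, Omega z -> (phi z).1 ^+ 2 + (phi z).2 ^+ 2 < 1) ->
  weak_differential Omega phi Dphi ->
  {ae area R, forall z, Omega z -> \det (Dphi z) = 1 /\ forall i j, `|Dphi z i j| <= K} ->
  test_function Omega h ->
  ((4 * t1)%:E * sqL2norm Omega h <=
   \int[area R]_(z in Omega) (cof_form (Dphi z) (grad h z))%:E)%E.
Proof.
move=> t1_ge0 fpos K0 oO phiD wd detb th.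
have mO := open_measurable_plane oO.
have [sh cK KO] := th; have [N KN] := compact_in_box cK.
pose U := Omega `&` [set z | `|z| < N + 1].
have oU : open U.
  apply: openI => //.
  have -> : [set z : R * R | `|z| < N + 1] =
      (fun z : R * R => `|z|) @^-1` [set x | x < N + 1] by [].
  by apply: open_comp; [move=> z _; exact: norm_continuous|exact: open_lt].
have mU := open_measurable_plane oU.
have UO : U `<=` Omega by move=> z [].
have thU : test_function U h.
  by split => // z Kz; split; [exact: KO|apply: le_lt_trans (KN _ Kz) _; rewrite ltrDl].
pose p i := (fun z => plane_coord i (phi z)) \_ U.
pose d i j := (fun z => cutoff K (Dphi z i j)) \_ U.
have mphi i : measurable_fun U (fun z => plane_coord i (phi z)).
  by have [[m _] _ _] := wd i 0; apply: measurable_funS m.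
have mD i j : measurable_fun Omega (fun z => Dphi z i j).
  by have [_ [m _] _] := wd i j.
have mDU i j : measurable_fun U (fun z => Dphi z i j) by apply: measurable_funS (mD i j).
have outU z (f : R * R -> R) : ~ U z -> (f \_ U) z = 0.
  by move=> Uz; rewrite patchE memNset.
have inU z (f : R * R -> R) : U z -> (f \_ U) z = f z.
  by move=> Uz; rewrite patchE mem_set.
have U_N z : N + 1 < `|z| -> ~ U z by move=> zN [_ /= zN']; move: zN; rewrite ltNge ltW.
have p1 z : sqmod p z <= 1.
  rewrite /sqmod /p; have [Uz|Uz] := pselect (U z); last by rewrite !outU// expr0n addr0.
  by rewrite !inU//; apply: ltW; exact: phiD Uz.1.
have bp i : boxed 1 (N + 1) (p i).
  split; first exact: (measurable_restrictT _ mU).1 (mphi i).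
    move=> z; rewrite -(ler_pXn2r (ltn0Sn 1)) ?nnegrE// expr1n real_normK ?num_real//.
    have := p1 z; rewrite /sqmod; have [->|->] := ord2P i.
      by apply: le_trans; rewrite lerDl sqr_ge0.
    by apply: le_trans; rewrite lerDr sqr_ge0.
  by move=> z /U_N; exact: outU.
have bd i j : boxed K (N + 1) (d i j).
  split; last by move=> z /U_N; exact: outU.
    apply: (measurable_restrictT _ mU).1.
    by apply: measurableT_comp (mDU i j); exact: measurable_cutoff.
  move=> z; rewrite /d; have [Uz|Uz] := pselect (U z).
    by rewrite inU//; exact: cutoff_le.
  by rewrite outU// normr0.
have dE : {ae area R, forall z, U z -> forall i j, d i j z = Dphi z i j}.
  apply: filterS detb => z H Uz i j; have [_ b] := H (UO _ Uz).
  by rewrite /d inU// cutoff_id.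
have wk i j g : test_function U g ->
   \int[area R]_w (p i w * partial j g w) = - \int[area R]_w (d i j w * g w).
  move=> tg; have [_ _ /(_ g (test_function_sub UO tg)) H] := wd i j.
  have -> : \int[area R]_w (p i w * partial j g w) =
            \int[area R]_(z in Omega) (plane_coord i (phi z) * partial j g z).
    rewrite [RHS]Rintegral_mkcond; apply: eq_Rintegral => z _.
    have [Uz|Uz] := pselect (U z).
      by rewrite /p inU// patchE mem_set//; exact: UO.
    by have [_ dg] := test_function_out tg Uz; rewrite patchE dg !mulr0 if_same.
  rewrite H; congr (- _); rewrite Rintegral_mkcond /Rintegral; congr fine.
  have [mg _] := (test_function_bbs tg).1.
  apply: ae_eq_integral => //.
  - apply/measurable_EFinP; apply: (measurable_restrictT _ mO).1.
    by apply: measurable_funM => //; exact: measurable_funTS.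
  - apply/measurable_EFinP; apply: measurable_funM => //.
    by case: (bd i j).
  - apply: filterS dE => z dz _; congr EFin; have [Uz|Uz] := pselect (U z).
      by rewrite patchE mem_set ?dz//; exact: UO.
    by have [g0 _] := test_function_out tg Uz; rewrite patchE g0 !mulr0 if_same.
have jac1 : {ae area R, forall z, U z -> jac d z = 1}.
  apply: filterS2 dE detb => z dz H Uz; have [<- _] := H (UO _ Uz).
  by rewrite /jac !dz// det2E.
have := picone_test t1_ge0 fpos oU thU bp bd p1 wk jac1.
have bQ : bbs (area R) (pull_form d h).
  by apply: (bbs_pull_form thU) => i j; exact: (bbs_bmeas (boxed_bbs (bd i j))).
rewrite (sqL2norm_test mO th) -EFinM -lee_fin => /le_trans; apply.
have Q0 z : ~ U z -> pull_form d h z = 0.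
  by move=> /(test_function_out thU)[_ dh]; rewrite /pull_form !dh; ring.
rewrite -(int_in_zero mO bQ); last by move=> z Oz; apply: Q0 => /UO.
have cofE z : cof_form (Dphi z) (grad h z) =
  (Dphi z 1 1 * partial 0 h z - Dphi z 1 0 * partial 1 h z) ^+ 2 +
  (Dphi z 0 0 * partial 1 h z - Dphi z 0 1 * partial 0 h z) ^+ 2.
  by rewrite /cof_form /grad !mxE.
rewrite le_eqVlt; apply/orP; left; apply/eqP; apply: ae_eq_integral => //.
- apply/measurable_EFinP; apply: measurable_funTS; by case: bQ.
- have [_ bdh] := test_function_bbs th.
  have mdh j : measurable_fun Omega (partial j h).
    by apply: measurable_funTS; case: (bdh j).
  apply/measurable_EFinP; rewrite (_ : (fun z => _) = (fun z =>
    (Dphi z 1 1 * partial 0 h z - Dphi z 1 0 * partial 1 h z) ^+ 2 +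
    (Dphi z 0 0 * partial 1 h z - Dphi z 0 1 * partial 0 h z) ^+ 2)); last first.
    by apply/funext => z; exact: cofE.
  by apply: measurable_funD; apply: measurable_funX; apply: measurable_funB;
    apply: measurable_funM; by [exact: mD|exact: mdh].
- apply: filterS dE => z dz Oz; rewrite cofE; congr EFin.
  have [Uz|Uz] := pselect (U z); first by rewrite /pull_form !dz.
  rewrite Q0//; have [_ dh] := test_function_out thU Uz.
  by rewrite !dh; ring.
Qed.

End picone_map.

(** * Extension to the closure of the test functions *)

Section nonmeasurable_integrands.
Local Open Scope ereal_scope.
Context d (T : measurableType d) (R : realType) (mu : {measure set T -> \bar R}).
Implicit Types (D : set T) (f g : T -> \bar R).

(** The integral of a nonnegative function is a supremum over simple functions,
    hence monotone without any measurability. *)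
Lemma ge0_le_integral_sup D f g : (forall x, D x -> 0 <= f x) ->
  (forall x, D x -> f x <= g x) ->
  \int[mu]_(x in D) f x <= \int[mu]_(x in D) g x.
Proof.
move=> f0 fg; have g0 x : D x -> 0 <= g x.
  by move=> Dx; apply: le_trans (f0 x Dx) (fg x Dx).
rewrite (ge0_integralE mu f0) (ge0_integralE mu g0).
apply: le_ereal_sup => _ [h hf <-]; exists h => // x.
apply: le_trans (hf x) _; rewrite !patchE; case: ifPn => // /set_mem Dx.
exact: fg.
Qed.

(** The coefficients of [A] are Lebesgue measurable but perhaps not Borel, so that
    its form is only known to be almost everywhere equal to a Borel function
    [k]. The negative part of [f] is dominated by the function equal to [+oo] on
    a null set, and the positive part of [f] dominates [k] set to zero there. *)
Lemma le_integral_ae_nonmeasurable D (k : T -> R) f : measurable D ->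
  measurable_fun D k -> (forall x, D x -> (0 <= k x)%R) ->
  {ae mu, forall x, D x -> f x = (k x)%:E} ->
  \int[mu]_(x in D) (k x)%:E <= \int[mu]_(x in D) f x.
Proof.
move=> mD mk k0 [N [mN N0 fkN]].
have off x : D x -> ~ N x -> f x = (k x)%:E.
  by move=> Dx Nx; apply: contrapT => H; apply: Nx; apply: fkN => /= /(_ Dx).
have neg0 : \int[mu]_(x in D) f^\- x = 0.
  apply/eqP; rewrite eq_le integral_ge0 ?andbT; last first.
    by move=> x _; exact: funeneg_ge0.
  have -> : 0 = \int[mu]_(x in D) ((cst +oo) \_ N) x.
    have mI : measurable_fun D ((cst +oo : T -> \bar R) \_ N).
      exact: measurable_funTS ((measurable_restrictT _ mN).1 (measurable_cst _)).
    have I0 x : D x -> 0 <= ((cst +oo : T -> \bar R) \_ N) x.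
      by move=> _; rewrite patchE; case: ifP => // _; exact: leey.
    rewrite (ge0_negligible_integral mN mD mI I0 N0) integral0_eq// => x [_ Nx].
    by rewrite patchE memNset.
  apply: ge0_le_integral_sup => x Dx; first exact: funeneg_ge0.
  rewrite patchE; case: ifPn => [_|/negP Nx]; first exact: leey.
  rewrite funenegE off// -?EFinN; last by move=> Nx'; apply: Nx; rewrite inE.
  by rewrite ge_max lexx andbT lee_fin lerNl oppr0 k0.
rewrite [leRHS]integralE neg0 sube0.
rewrite (ge0_negligible_integral mN mD _ _ N0); last 2 first.
  - exact/measurable_EFinP.
  - by move=> x Dx; rewrite lee_fin k0.
have -> : D `\` N = D `&` ~` N by [].
rewrite integral_mkcondr; apply: ge0_le_integral_sup => x Dx.
  by rewrite patchE; case: ifP => // _; rewrite lee_fin k0.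
rewrite patchE; case: ifPn => [/set_mem Nx|_]; last exact: funepos_ge0.
by rewrite funeposE off// le_max lexx.
Qed.

Lemma le_integral_comb D (F G H : T -> R) (a b : R) : measurable D ->
  measurable_fun D F -> measurable_fun D G -> measurable_fun D H ->
  (forall x, D x -> [/\ 0 <= F x, 0 <= G x & 0 <= H x]%R) -> (0 <= a)%R -> (0 <= b)%R ->
  (forall x, D x -> (F x <= a * G x + b * H x)%R) ->
  \int[mu]_(x in D) (F x)%:E <=
  a%:E * \int[mu]_(x in D) (G x)%:E + b%:E * \int[mu]_(x in D) (H x)%:E.
Proof.
move=> mD mF mG mH ge0 a0 b0 FGH.
have mEG : measurable_fun D (fun x => (G x)%:E) by exact/measurable_EFinP.
have mEH : measurable_fun D (fun x => (H x)%:E) by exact/measurable_EFinP.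
have G0 x : D x -> 0 <= (G x)%:E by move=> /ge0[_ ? _]; rewrite lee_fin.
have H0 x : D x -> 0 <= (H x)%:E by move=> /ge0[_ _ ?]; rewrite lee_fin.
rewrite -(ge0_integralZl mu mD mEG G0) ?lee_fin//.
rewrite -(ge0_integralZl mu mD mEH H0) ?lee_fin//.
rewrite -ge0_integralD//; last 4 first.
- by move=> x Dx; rewrite mule_ge0 ?lee_fin// -lee_fin G0.
- exact: measurable_funeM.
- by move=> x Dx; rewrite mule_ge0 ?lee_fin// -lee_fin H0.
- exact: measurable_funeM.
apply: ge0_le_integral_sup => x Dx.
  by rewrite lee_fin; have [] := ge0 x Dx.
by rewrite -!EFinM -EFinD lee_fin FGH.
Qed.

End nonmeasurable_integrands.

Section extension.
Variable R : realType.
Implicit Types (Omega : set (R * R)) (f h : R * R -> R) (g : R * R -> 'cV[R]_2).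

Lemma young_sqr (s x y : R) : 0 < s ->
  y ^+ 2 <= (1 + s) * x ^+ 2 + (1 + s^-1) * (x - y) ^+ 2.
Proof.
move=> s0; rewrite -subr_ge0.
have -> : (1 + s) * x ^+ 2 + (1 + s^-1) * (x - y) ^+ 2 - y ^+ 2 =
          s^-1 * (s * x + (x - y)) ^+ 2.
  by field; rewrite gt_eqF.
by rewrite mulr_ge0 ?sqr_ge0// invr_ge0 ltW.
Qed.

Lemma cof_form_ge0 (D : 'M[R]_2) (u : 'cV[R]_2) : 0 <= cof_form D u.
Proof. by rewrite addr_ge0 ?sqr_ge0. Qed.

Lemma cof_form_young (s : R) (D : 'M[R]_2) (u v : 'cV[R]_2) : 0 < s ->
  cof_form D v <= (1 + s) * cof_form D u + (1 + s^-1) * cof_form D (u - v).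
Proof.
move=> s0; rewrite /cof_form !mxE.
set a := D 1 1 * u 0 0 - D 1 0 * u 1 0; set b := D 0 0 * u 1 0 - D 0 1 * u 0 0.
set a' := D 1 1 * v 0 0 - D 1 0 * v 1 0; set b' := D 0 0 * v 1 0 - D 0 1 * v 0 0.
have -> : D 1 1 * (u 0 0 - v 0 0) - D 1 0 * (u 1 0 - v 1 0) = a - a' by rewrite /a /a'; ring.
have -> : D 0 0 * (u 1 0 - v 1 0) - D 0 1 * (u 0 0 - v 0 0) = b - b' by rewrite /b /b'; ring.
rewrite !mulrDr addrACA; apply: lerD; exact: young_sqr.
Qed.

Lemma sqrte_lt (x : \bar R) (e : R) : (0 <= x)%E -> 0 < e ->
  (sqrte x < e%:E)%E -> (x <= (e ^+ 2)%:E)%E.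
Proof.
move=> x0 e0 xe; rewrite -(sqr_sqrte x0) -lee_sqrt; last by rewrite lee_fin sqr_ge0.
rewrite !sqrte_sqr /= sqrtr_sqr gtr0_norm//.
by rewrite gee0_abs ?sqrte_ge0// ltW.
Qed.

Lemma sqL2norm_ge0 Omega f : (0 <= sqL2norm Omega f)%E.
Proof. by apply: integral_ge0 => z _; rewrite lee_fin exprn_ge0. Qed.

(** A Rayleigh bound for test functions passes to the closure: the Young
    inequality [y ^ 2 <= (1 + s) x ^ 2 + (1 + 1 / s) (x - y) ^ 2], with [s] also
    the distance of the approximating test function. The form [cof_form] is a
    Borel representative of the possibly non-Borel form of [A]. *)
Lemma rayleigh_closure (lam : R) (A : R * R -> 'M[R]_2) Omega
    (Dphi : R * R -> 'M[R]_2) f g :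
  0 <= lam -> open Omega ->
  (forall i j, measurable_fun Omega (fun z => Dphi z i j)) ->
  {ae area R, forall z, Omega z -> forall u,
     inner (A z *m u) u = cof_form (Dphi z) u} ->
  (forall h, test_function Omega h -> (lam%:E * sqL2norm Omega h <=
     \int[area R]_(z in Omega) (cof_form (Dphi z) (grad h z))%:E)%E) ->
  W120 A Omega f g ->
  (lam%:E * sqL2norm Omega f <= energy A Omega g)%E.
Proof.
move=> lam0 oO mD AD ray [wg foo dens].
have mO := open_measurable_plane oO.
have mf : measurable_fun Omega f by have [[m _] _ _] := wg 0.
have mg j : measurable_fun Omega (fun z => g z j 0) by have [_ [m _] _] := wg j.
pose E u : \bar R := (\int[area R]_(z in Omega) (cof_form (Dphi z) (u z))%:E)%E.
have mcof (u : R * R -> 'cV[R]_2) : (forall j, measurable_fun Omega (fun z => u z j 0)) ->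
    measurable_fun Omega (fun z => cof_form (Dphi z) (u z)).
  move=> mu; apply: measurable_funD; apply: measurable_funX; apply: measurable_funB;
    apply: measurable_funM; by [exact: mD|exact: mu].
have EA (u : R * R -> 'cV[R]_2) : (forall j, measurable_fun Omega (fun z => u z j 0)) ->
    (E u <= energy A Omega u)%E.
  move=> mu; apply: le_integral_ae_nonmeasurable => //.
  - exact: mcof.
  - by move=> z _; exact: cof_form_ge0.
  - by apply: filterS AD => z Az Oz; rewrite Az.
have E0 u : (0 <= E u)%E by apply: integral_ge0 => z _; rewrite lee_fin cof_form_ge0.
have N0 := sqL2norm_ge0 Omega f.
have [Noo Eoo] : (sqL2norm Omega f < +oo)%E /\ (energy A Omega g < +oo)%E.
  have Ege0 : (0 <= energy A Omega g)%E by apply: le_trans (E0 g) (EA g mg).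
  move: foo; rewrite /W12norm => foo; split.
    rewrite -ge0_fin_numE// -(sqrte_fin_num N0) ge0_fin_numE ?sqrte_ge0//.
    by apply: le_lt_trans foo; rewrite leeDl// sqrte_ge0.
  rewrite -ge0_fin_numE// -(sqrte_fin_num Ege0) ge0_fin_numE ?sqrte_ge0//.
  by apply: le_lt_trans foo; rewrite leeDr// sqrte_ge0.
apply: le_trans (EA g mg).
have Egoo : (E g < +oo)%E by apply: le_lt_trans (EA g mg) Eoo.
have Nfin : sqL2norm Omega f \is a fin_num by rewrite ge0_fin_numE.
have Efin : E g \is a fin_num by rewrite ge0_fin_numE.
set n := fine (sqL2norm Omega f); set q := fine (E g).
have nE : sqL2norm Omega f = n%:E by rewrite fineK.
have qE : E g = q%:E by rewrite fineK.
have q0 : 0 <= q by rewrite -lee_fin -qE.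
rewrite -/(E g) nE qE -EFinM lee_fin.
have key s : 0 < s <= 1 -> lam * n <= q + s * (3 * q + 4 + 2 * lam).
  move=> /andP[s0 s1]; have [h th hs] := dens s s0.
  have [sh _ _] := th; have [bh bdh] := test_function_bbs th.
  have mh : measurable_fun Omega h by apply: measurable_funTS; case: bh.
  have mdh j : measurable_fun Omega (fun z => grad h z j 0).
    rewrite (_ : (fun z => _) = partial j h); last by apply/funext => z; rewrite mxE.
    by apply: measurable_funTS; case: (bdh j).
  have mgh j : measurable_fun Omega (fun z => (g z - grad h z) j 0).
    rewrite (_ : (fun z => _) = (fun z => g z j 0 - grad h z j 0)); last first.
      by apply/funext => z; rewrite !mxE.
    exact: measurable_funB.
  have Nfh : (sqL2norm Omega (fun z => f z - h z)%R <= (s ^+ 2)%:E)%E.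
    apply: sqrte_lt => //; first exact: sqL2norm_ge0.
    by apply: le_lt_trans hs; rewrite leeDl// sqrte_ge0.
  have Egh : (E (fun z => g z - grad h z)%R <= (s ^+ 2)%:E)%E.
    apply: le_trans (EA _ mgh) _; apply: sqrte_lt => //.
      by apply: le_trans (E0 _) (EA _ mgh).
    by apply: le_lt_trans hs; rewrite leeDr// sqrte_ge0.
  have s_ge0 : 0 <= 1 + s by lra.
  have si_ge0 : 0 <= 1 + s^-1 by rewrite addr_ge0// invr_ge0 ltW.
  have Yn : (sqL2norm Omega f <= (1 + s)%:E * sqL2norm Omega h +
      (1 + s^-1)%:E * sqL2norm Omega (fun z => f z - h z)%R)%E.
    apply: le_integral_comb => //.
    - by apply: measurable_funX; exact: measurableT_comp.
    - by apply: measurable_funX; exact: measurableT_comp.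
    - by apply: measurable_funX; apply: measurableT_comp => //; exact: measurable_funB.
    - move=> z _; rewrite !real_normK ?num_real//.
      by rewrite -(sqrrN (f z - h z)) opprB; exact: young_sqr.
  have Ye : (E (grad h) <= (1 + s)%:E * E g + (1 + s^-1)%:E * E (fun z => g z - grad h z)%R)%E.
    apply: le_integral_comb => //; try exact: mcof.
    - by move=> z _; split; exact: cof_form_ge0.
    - by move=> z _; exact: cof_form_young.
  have Nh : sqL2norm Omega h = (\int[area R]_z (h z ^+ 2))%:E by exact: sqL2norm_test.
  set m := \int[area R]_z (h z ^+ 2) in Nh.
  have Yn' : n <= (1 + s) * m + (1 + s^-1) * s ^+ 2.
    rewrite -lee_fin -nE EFinD !EFinM -Nh; apply: le_trans Yn _.
    by apply: leeD2l; apply: lee_wpmul2l; rewrite ?lee_fin.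
  have Ye' : lam * m <= (1 + s) * q + (1 + s^-1) * s ^+ 2.
    rewrite -lee_fin EFinM -Nh; apply: le_trans (ray h th) _.
    rewrite EFinD !EFinM -qE; apply: le_trans Ye _.
    by apply: leeD2l; apply: lee_wpmul2l; rewrite ?lee_fin.
  have ss : (1 + s^-1) * s ^+ 2 = s ^+ 2 + s by field; rewrite gt_eqF.
  rewrite ss in Yn' Ye'.
  have A1 : lam * n <= lam * ((1 + s) * m + (s ^+ 2 + s)) by rewrite ler_wpM2l.
  have A2 : (1 + s) * (lam * m) <= (1 + s) * ((1 + s) * q + (s ^+ 2 + s)).
    by rewrite ler_wpM2l.
  have s2 : s ^+ 2 <= s by rewrite expr2 ler_piMl// ltW.
  have A3 : lam * s ^+ 2 <= lam * s by rewrite ler_wpM2l.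
  have A4 : q * s ^+ 2 <= q * s by rewrite ler_wpM2l.
  have A5 : s * s ^+ 2 <= s * s by rewrite ler_wpM2l// ltW.
  apply: le_trans A1 _.
  have -> : lam * ((1 + s) * m + (s ^+ 2 + s)) = (1 + s) * (lam * m) + lam * s ^+ 2 + lam * s.
    by ring.
  have A6 : (1 + s) * ((1 + s) * q + (s ^+ 2 + s)) =
    q + 2 * (q * s) + q * s ^+ 2 + s + 2 * s ^+ 2 + s * s ^+ 2 by ring.
  have A7 : q + s * (3 * q + 4 + 2 * lam) = q + 3 * (q * s) + 4 * s + 2 * (lam * s) by ring.
  have A8 : s * s = s ^+ 2 by rewrite expr2.
  rewrite A8 in A5; rewrite A6 in A2; rewrite A7.
  move: A2 A3 A4 A5 s2 s0.
  by move: (lam * m) (lam * s ^+ 2) (lam * s) (q * s) (q * s ^+ 2) (s * s ^+ 2) (s ^+ 2) => *; lra.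
apply/ler_addgt0Pr => e e0.
set c := 3 * q + 4 + 2 * lam in key.
have c0 : 0 < c by rewrite /c; lra.
pose s := Num.min 1 (e / c).
have s01 : 0 < s <= 1 by rewrite /s lt_min ltr01 divr_gt0//= ge_min lexx.
apply: le_trans (key s s01) _; rewrite lerD2l -ler_pdivlMr//.
by rewrite ge_min lexx orbT.
Qed.

End extension.

(** * The first eigenvalue of the disc *)

Section test_quotient.
Variable R : realType.
Implicit Types (U : set (R * R)) (h k : R * R -> R) (j : 'I_2).

Lemma Lploc1_bbs U f : bbs (area R) f -> Lploc 1 U f.
Proof.
move=> bf; split; first by apply: measurable_funTS; case: bf.
move=> K cK _; have mK := compact_measurable_plane cK.
have /integrableP[_] : (area R).-integrable K (EFin \o f).
  by apply: (@integrableS _ _ _ (area R) setT) => //; exact: bbs_integrable.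
by under eq_integral do rewrite /= -[`|_|%R]expr1.
Qed.

Lemma test_integration_by_parts U j h k : test_function U h -> test_function U k ->
  \int[area R]_z (h z * partial j k z) = - \int[area R]_z (partial j h z * k z).
Proof.
move=> th tk; have [sh cK _] := th; have [sk _ _] := tk.
have [bh bdh] := test_function_bbs th; have [bk bdk] := test_function_bbs tk.
have [N KN] := compact_in_box cK.
have shk := smooth_mul sh sk.
have := @int_partial R j (fun z => h z * k z) (fun z => h z * partial j k z + k z * partial j h z) N.
have -> : \int[area R]_z (h z * partial j k z + k z * partial j h z) =
  \int[area R]_z (h z * partial j k z) + \int[area R]_z (partial j h z * k z).
  rewrite intD; [|exact: (bbsM bh (bbs_bmeas (bdk j)))|exact: (bbsM bk (bbs_bmeas (bdh j)))].
  by congr (_ + _); apply: eq_Rintegral => z _; rewrite mulrC.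
move=> H; apply/eqP; rewrite -addr_eq0; apply/eqP; apply: H.
- by move=> z; apply: is_deriveMm; exact: smooth_is_derive.
- move=> z; apply: cvgD; apply: cvgM.
  + exact: smooth_continuous.
  + exact: smooth_partial_continuous.
  + exact: smooth_continuous.
  + exact: smooth_partial_continuous.
- move=> z zN; have Kz : ~ closure [set z | h z != 0] z.
    by move=> /KN; rewrite leNgt zN.
  by have [-> _] := test_function_zero th Kz; rewrite mul0r.
Qed.

Lemma energy1 U h : measurable U -> test_function U h ->
  energy (fun=> 1%:M) U (grad h) =
  (\int[area R]_z (partial 0 h z ^+ 2 + partial 1 h z ^+ 2))%:E.
Proof.
move=> mU th; have [bh bdh] := test_function_bbs th.
rewrite -(int_in_zero mU); last 2 first.
- by apply: bbsD; apply: bbs_sqr; exact: bdh.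
- by move=> z /(test_function_out th)[_ dh]; rewrite !dh expr0n addr0.
by apply: eq_integral => z _; rewrite mul1mx innerE !mxE !expr2.
Qed.

Lemma test_function_W120 U h : open U -> test_function U h ->
  W120 (fun=> 1%:M) U h (grad h).
Proof.
move=> oU th; have mU := open_measurable_plane oU.
have [bh bdh] := test_function_bbs th.
have gradE j : (fun z => grad h z j 0) = partial j h.
  by apply/funext => z; rewrite mxE.
split.
- move=> j; split; first exact: Lploc1_bbs.
    by rewrite gradE; exact: Lploc1_bbs.
  move=> k tk.
  have -> : \int[area R]_(z in U) (h z * partial j k z) =
            \int[area R]_z (h z * partial j k z).
    by apply: Rint_in_zero => z /(test_function_out th)[-> _]; rewrite mul0r.
  have -> : \int[area R]_(z in U) (grad h z j 0 * k z) =
            \int[area R]_z (grad h z j 0 * k z).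
    by apply: Rint_in_zero => z /(test_function_out tk)[-> _]; rewrite mulr0.
  rewrite (test_integration_by_parts j th tk); congr (- _).
  by apply: eq_Rintegral => z _; rewrite mxE.
- by rewrite /W12norm (energy1 mU th) (sqL2norm_test mU th) /= -EFinD ltry.
- move=> e e0; exists h => //; rewrite /W12norm.
  have -> : sqL2norm U (fun z => h z - h z) = 0%E.
    by rewrite /sqL2norm integral0_eq// => z _; rewrite subrr normr0 expr0n.
  have -> : energy (fun=> 1%:M) U (fun z => grad h z - grad h z) = 0%E.
    by rewrite /energy integral0_eq// => z _; rewrite subrr mulmx0 innerE !mxE !mul0r addr0.
  by rewrite sqrte0 adde0 lte_fin.
Qed.

Lemma lambda1_le_quotient U h (E n : R) : open U -> test_function U h ->
  E = \int[area R]_z (partial 0 h z ^+ 2 + partial 1 h z ^+ 2) ->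
  n = \int[area R]_z (h z ^+ 2) -> 0 < n ->
  (lambda1 (fun=> 1%:M) U <= (E / n)%:E)%E.
Proof.
move=> oU th -> -> n0; have mU := open_measurable_plane oU.
have [bh bdh] := test_function_bbs th.
apply: ereal_inf_lbound; exists h, (grad h); split.
- exact: test_function_W120.
- move=> h0; have : \int[area R]_z (h z ^+ 2) = \int[area R]_z (0 : R).
    apply: ae_eq_int; [exact: bbs_sqr|exact: bbs0|].
    apply: filterS h0 => z hz; have [Uz|Uz] := pselect (U z).
      by rewrite hz// expr0n.
    by have [-> _] := test_function_out th Uz; rewrite expr0n.
  by move=> hh; move: n0; rewrite hh /Rintegral integral0 ltxx.
- rewrite (energy1 mU th) (sqL2norm_test mU th).
  by rewrite inver gt_eqF// EFinM.
Qed.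

End test_quotient.

Section disc_upper_bound.
Variable R : realType.
Implicit Types (z : R * R) (j : 'I_2).

Definition sqrad z : R := z.1 ^+ 2 + z.2 ^+ 2.

Lemma sqrad_ge0 z : 0 <= sqrad z.
Proof. by rewrite addr_ge0 ?sqr_ge0. Qed.

Lemma is_derive_sqrad j z :
  is_derive z (basis_vec R j) sqrad (2 * plane_coord j z).
Proof.
have -> : sqrad = (fun z => fst z * fst z + snd z * snd z).
  by apply/funext => w; rewrite /sqrad !expr2.
have -> : 2 * plane_coord j z =
  (z.1 * (j == 0)%:R + z.1 * (j == 0)%:R) + (z.2 * (j == 1)%:R + z.2 * (j == 1)%:R).
  have [->|->] := ord2P j; rewrite /plane_coord /=; ring.
apply: is_deriveDd; apply: is_deriveMm; by [exact: is_derive_coord1|exact: is_derive_coord2].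
Qed.

Lemma smooth_sqrad : smooth sqrad.
Proof.
have -> : sqrad = (fun z => fst z * fst z + snd z * snd z).
  by apply/funext => w; rewrite /sqrad !expr2.
by apply: smooth_add; apply: smooth_mul; by [exact: smooth_fst|exact: smooth_snd].
Qed.

Lemma open_unit_disc : open (unit_disc R).
Proof.
have -> : unit_disc R = sqrad @^-1` [set x | x < 1] by [].
apply: open_comp; last exact: open_lt.
by move=> z _; exact: (smooth_continuous smooth_sqrad).
Qed.

Lemma sqr_le1_norm (x : R) : x ^+ 2 <= 1 -> `|x| <= 1.
Proof. by move=> x1; rewrite -(ler_pXn2r (ltn0Sn 1)) ?nnegrE// expr1n real_normK// num_real. Qed.

Lemma sqrad_norm z : sqrad z <= 1 -> `|z| <= 1.
Proof.
rewrite prod_normE ge_max /sqrad => z1.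
rewrite !sqr_le1_norm//; apply: le_trans z1; first by rewrite lerDr sqr_ge0.
by rewrite lerDl sqr_ge0.
Qed.

Lemma compact_disc (a : R) : a <= 1 -> compact [set z | sqrad z <= a].
Proof.
move=> a1; have cl : closed [set z | sqrad z <= a].
  have -> : [set z | sqrad z <= a] = sqrad @^-1` [set x | x <= a] by [].
  apply: closed_comp; last exact: closed_le.
  by move=> z _; exact: (smooth_continuous smooth_sqrad).
apply: (subclosed_compact cl (@compact_box R 1)) => z /= za.
by apply/boxP; apply: sqrad_norm; exact: le_trans za a1.
Qed.

(** [int |grad (w eta)| ^ 2 = lam int (w eta) ^ 2 + int w ^ 2 |grad eta| ^ 2] when
    [w] is an eigenfunction: integrate [div (w eta ^ 2 grad w)]. *)
Lemma eigenfunction_cutoff (U : set (R * R)) (w eta : R * R -> R) (lam : R) :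
  smooth w -> test_function U eta ->
  (forall z, partial 0 (partial 0 w) z + partial 1 (partial 1 w) z = - lam * w z) ->
  let h z := w z * eta z in
  \int[area R]_z (partial 0 h z ^+ 2 + partial 1 h z ^+ 2) =
  lam * \int[area R]_z (h z ^+ 2) +
  \int[area R]_z (w z ^+ 2 * (partial 0 eta z ^+ 2 + partial 1 eta z ^+ 2)).
Proof.
move=> sw te lapw h; have [se cK KU] := te.
have [be bde] := test_function_bbs te.
have sh : smooth h by exact: smooth_mul.
have th : test_function U h.
  by apply: (test_function_compact sh cK KU) => z /(test_function_zero te)[e0 _]; rewrite /h e0 mulr0.
have [bh bdh] := test_function_bbs th.
have [N KN] := compact_in_box cK.
pose G j z := h z * eta z * partial j w z.
have sG j : smooth (G j).
  by apply: smooth_mul; [exact: smooth_mul|exact: smooth_partial].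
have tG j : test_function U (G j).
  apply: (test_function_compact (sG j) cK KU) => z /(test_function_zero te)[e0 _].
  by rewrite /G e0 mulr0 mul0r.
have dh j z : partial j h z = w z * partial j eta z + eta z * partial j w z.
  by apply: partial_val; apply: is_deriveMm; exact: smooth_is_derive.
have dG j z : partial j (G j) z =
   (h z * eta z) * partial j (partial j w) z +
   partial j w z * (h z * partial j eta z + eta z * (w z * partial j eta z + eta z * partial j w z)).
  apply: partial_val; apply: is_deriveMm; last first.
    by apply: smooth_is_derive; exact: smooth_partial.
  apply: is_deriveMm; last exact: smooth_is_derive.
  by rewrite -dh; exact: smooth_is_derive.
have intG j : \int[area R]_z partial j (G j) z = 0.
  apply: (@int_partial R j (G j) _ N).
  - by move=> z; exact: (smooth_is_derive j z (sG j)).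
  - exact: (smooth_partial_continuous (sG j)).
  - move=> z zN; have Kz : ~ closure [set z | eta z != 0] z.
      by move=> /KN; rewrite leNgt zN.
    by have [e0 _] := test_function_zero te Kz; rewrite /G e0 mulr0 mul0r.
have bdG j : bbs (area R) (partial j (G j)) by have [_] := test_function_bbs (tG j).
have brem : bbs (area R) (fun z => w z ^+ 2 * (partial 0 eta z ^+ 2 + partial 1 eta z ^+ 2)).
  have sq : smooth (fun z => w z ^+ 2 * (partial 0 eta z ^+ 2 + partial 1 eta z ^+ 2)).
    apply: smooth_mul; first exact: smooth_sqr.
    by apply: smooth_add; apply: smooth_sqr; exact: smooth_partial.
  apply: (@continuous_bbs _ _ N); first exact: smooth_continuous.
  move=> z zN; have Kz : ~ closure [set z | eta z != 0] z.
    by move=> /KN; rewrite leNgt zN.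
  by have [_ e0] := test_function_zero te Kz; rewrite !e0 expr0n addr0 mulr0.
have bh2 := bbs_sqr bh.
transitivity (\int[area R]_z ((partial 0 (G 0) z + partial 1 (G 1) z) +
    (lam * h z ^+ 2 + w z ^+ 2 * (partial 0 eta z ^+ 2 + partial 1 eta z ^+ 2)))).
  apply: eq_Rintegral => z _; rewrite (dG 0) (dG 1) (dh 0) (dh 1) /h.
  move: (lapw z); move: (partial 0 (partial 0 w) z) (partial 1 (partial 1 w) z).
  move: (partial 0 w z) (partial 1 w z) (partial 0 eta z) (partial 1 eta z).
  move: (w z) (eta z) => W H w0 w1 e0 e1 w00 w11 L.
  have -> : lam * (W * H) ^+ 2 = - (W * H * H) * (- lam * W) by ring.
  by rewrite -L; ring.
have blh := bbsZ lam bh2.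
apply: (etrans (intD (bbsD (bdG 0) (bdG 1)) (bbsD blh brem))).
have e1 := etrans (intD (bdG 0) (bdG 1)) (congr2 +%R (intG 0) (intG 1)).
have e2 := etrans (intD blh brem) (congr2 +%R (intZ lam bh2) (erefl _)).
by apply: (etrans (congr2 +%R e1 e2)); rewrite addr0 add0r.
Qed.

End disc_upper_bound.

Section disc_eigenvalue.
Variables (R : realType) (t0 : R).
Hypothesis t0_gt0 : 0 < t0.
Hypothesis bessel_t0 : bessel 0 t0 = 0.
Implicit Types (z : R * R) (n : nat).

(* [w] is the first eigenfunction of the disc. The cutoff [eta n] is
   [exp (- eps / (1 - eps - |z| ^ 2))] where [|z| ^ 2 < 1 - eps], and zero
   elsewhere. *)
Let w z : R := bessel 0 (t0 * sqrad z + 0).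
Let eps n : R := n.+2%:R^-1.
Let eta n z : R := flat 0 (- (eps n)^-1 * sqrad z + (eps n)^-1 * (1 - eps n)).

Let eps_gt0 n : 0 < eps n. Proof. by rewrite invr_gt0. Qed.

Let eps_le n : eps n <= 2^-1.
Proof. by rewrite lef_pV2 ?posrE// ler_nat. Qed.

Let smooth_w : smooth w.
Proof.
change (smooth ((fun s => bessel 0 (t0 * s + 0)) \o @sqrad R)).
apply: smooth_comp; first exact: smooth_sqrad.
by apply: smooth1_affine; exact: smooth1_bessel.
Qed.

Let smooth_eta n : smooth (eta n).
Proof.
change (smooth ((fun s => flat 0 (- (eps n)^-1 * s + (eps n)^-1 * (1 - eps n))) \o @sqrad R)).
apply: smooth_comp; first exact: smooth_sqrad.
by apply: smooth1_affine; exact: smooth1_flat.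
Qed.

Let arg n z : R := (1 - eps n - sqrad z) / eps n.

Let argE n z : - (eps n)^-1 * sqrad z + (eps n)^-1 * (1 - eps n) = arg n z.
Proof. by rewrite /arg; ring. Qed.

Let etaE n z : eta n z = flat 0 (arg n z).
Proof. by rewrite /eta argE. Qed.

Let arg_le0 n z : 1 - eps n <= sqrad z -> arg n z <= 0.
Proof. by move=> h; rewrite /arg pmulr_lle0 ?invr_gt0// subr_le0. Qed.

Let test_eta n : test_function (unit_disc R) (eta n).
Proof.
have e0 := eps_gt0 n.
apply: (@test_function_compact R (unit_disc R) [set z | sqrad z <= 1 - eps n]).
- exact: smooth_eta.
- by apply: compact_disc; lra.
- move=> z /= h; rewrite /unit_disc /= -/(sqrad z); lra.
- by move=> z /= /negP; rewrite -ltNge etaE => /ltW h; rewrite flat_le0// arg_le0.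
Qed.

Let partial_w j z :
  partial j w z = t0 * bessel 1 (t0 * sqrad z + 0) * (2 * plane_coord j z).
Proof.
apply: partial_val; apply: (@is_derive_chain _ (@sqrad R) (fun s => bessel 0 (t0 * s + 0))).
  exact: is_derive_sqrad.
rewrite mulrC; apply: (@is_derive1_comp _ (bessel 0) (fun s => t0 * s + 0)).
  exact: is_derive_bessel.
exact: is_derive_affine.
Qed.

Lemma is_derive_plane_coord j z : is_derive z (basis_vec R j) (@plane_coord R j) 1.
Proof.
have [->|->] := ord2P j; first exact: (is_derive_coord1 0 z).
exact: (is_derive_coord2 1 z).
Qed.

Let laplacian_w z :
  partial 0 (partial 0 w) z + partial 1 (partial 1 w) z = - (4 * t0) * w z.
Proof.
have second j : partial j (partial j w) z =
   2 * t0 * bessel 1 (t0 * sqrad z + 0) +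
   4 * t0 ^+ 2 * bessel 2 (t0 * sqrad z + 0) * plane_coord j z ^+ 2.
  have -> : partial j w = (fun z => t0 * bessel 1 (t0 * sqrad z + 0) * (2 * plane_coord j z)).
    by apply/funext => y; exact: partial_w.
  apply: partial_val.
  have d1 : is_derive z (basis_vec R j) (fun z => t0 * bessel 1 (t0 * sqrad z + 0))
     (t0 * (t0 * bessel 2 (t0 * sqrad z + 0)) * (2 * plane_coord j z)).
    apply: (@is_derive_chain _ (@sqrad R) (fun s => t0 * bessel 1 (t0 * s + 0))).
      exact: is_derive_sqrad.
    apply: is_deriveZ; rewrite mulrC.
    apply: (@is_derive1_comp _ (bessel 1) (fun s => t0 * s + 0)).
      exact: is_derive_bessel.
    exact: is_derive_affine.
  have d2 : is_derive z (basis_vec R j) (fun z => 2 * plane_coord j z) 2.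
    have := is_deriveZ 2 (is_derive_plane_coord j z).
    by rewrite [2 *: 1]mulr1.
  have := is_deriveMm d1 d2.
  congr is_derive; ring.
rewrite !second /w; have := bessel_ode (t0 * sqrad z + 0).
rewrite {1}addr0; have -> : sqrad z = plane_coord 0 z ^+ 2 + plane_coord 1 z ^+ 2 by [].
move: (bessel 0 _) (bessel 1 _) (bessel 2 _) => b0 b1 b2.
move: (plane_coord 0 z) (plane_coord 1 z) => x y ode.
have -> : b0 = - (t0 * (x ^+ 2 + y ^+ 2) * b2 + b1) by lra.
by ring.
Qed.

Let partial_eta n j z :
  partial j (eta n) z = - (eps n)^-1 * flat 2 (arg n z) * (2 * plane_coord j z).
Proof.
apply: partial_val.
apply: (@is_derive_chain _ (@sqrad R) (fun s => flat 0 (- (eps n)^-1 * s + (eps n)^-1 * (1 - eps n)))).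
  exact: is_derive_sqrad.
rewrite [- _ * flat _ _]mulrC; apply: (@is_derive1_comp _ (flat 0) (fun s => - (eps n)^-1 * s + (eps n)^-1 * (1 - eps n))).
  rewrite argE; have := is_derive_flat 0 (arg n z).
  by rewrite oppr0 mul0r add0r.
exact: is_derive_affine.
Qed.

(* The excess of the Dirichlet integral of [w eta] over [4 t0 int (w eta) ^ 2]. *)
Let rem n z : R := w z ^+ 2 * (partial 0 (eta n) z ^+ 2 + partial 1 (eta n) z ^+ 2).

Let remE n z : rem n z = 4 * sqrad z * (w z * ((eps n)^-1 * flat 2 (arg n z))) ^+ 2.
Proof. by rewrite /rem !partial_eta /sqrad /plane_coord /=; ring. Qed.

Let rem_ge0 n z : 0 <= rem n z.
Proof.
rewrite remE; apply: mulr_ge0; last exact: sqr_ge0.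
by apply: mulr_ge0 => //; exact: sqrad_ge0.
Qed.

Let rem_out n z : 1 - eps n <= sqrad z -> rem n z = 0.
Proof. by move=> /arg_le0 h; rewrite remE flat_le0// !mulr0 expr0n mulr0. Qed.

(* The eigenfunction vanishes linearly at the boundary, by the mean value
   theorem for [bessel 0] between [t0 |z| ^ 2] and [t0]. *)
Let w_lip : exists2 L : R, 0 <= L & forall z, sqrad z <= 1 -> `|w z| <= L * (1 - sqrad z).
Proof.
have /compact_bounded[M [_ MP]] : compact (bessel 1 @` `[0, t0]).
  apply: continuous_compact; last exact: segment_compact.
  by apply: continuous_subspaceT; exact: bessel_continuous.
have hM t : 0 <= t <= t0 -> `|bessel 1 t| <= `|M| + 1.
  move=> tI; apply: (MP (`|M| + 1)); last by exists t => //=; rewrite in_itv.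
  by apply: le_lt_trans (ler_norm M) _; rewrite ltrDl.
exists ((`|M| + 1) * t0); first by rewrite mulr_ge0 ?ltW// addr_ge0.
move=> z z1; have r0 := sqrad_ge0 z.
have le : t0 * sqrad z <= t0 by rewrite ler_piMr// ltW.
have [c /itvP cI E] := @MVT_segment R (bessel 0) (bessel 1) (t0 * sqrad z) t0 le
  (fun t _ => is_derive_bessel 0 t) (continuous_subspaceT (@bessel_continuous R 0)).
have -> : w z = - (bessel 1 c * (t0 - t0 * sqrad z)).
  by rewrite -E bessel_t0 sub0r opprK /w addr0.
rewrite normrN normrM -mulrA; apply: ler_pM => //.
  apply: hM; rewrite cI andbT; apply: le_trans (_ : 0 <= t0 * sqrad z) _.
    by rewrite mulr_ge0// ltW.
  by rewrite cI.
by rewrite ger0_norm ?subr_ge0// mulrBr mulr1.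
Qed.

(* With [x = arg n z], the boundary bound reads [|w| <= L eps (1 + x)], while
   the gradient of the cutoff is of size [flat 2 x / eps]; the widths cancel and
   [(1 + x) flat 2 x = flat 1 x + flat 2 x] is at most [1 + 2]. *)
Let rem_bound : exists2 C : R, 0 <= C & forall n z, `|rem n z| <= C.
Proof.
have [L L0 hL] := w_lip.
exists (4 * (L * 3) ^+ 2); first by rewrite mulr_ge0// sqr_ge0.
move=> n z; rewrite ger0_norm//.
have [z1|z1] := leP (1 - eps n) (sqrad z).
  by rewrite rem_out// mulr_ge0// sqr_ge0.
have e0 := eps_gt0 n; have r1 : sqrad z <= 1 by lra.
have x0 : 0 < arg n z by rewrite /arg divr_gt0// subr_gt0.
rewrite remE; apply: ler_pM.
- by apply: mulr_ge0 => //; exact: sqrad_ge0.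
- exact: sqr_ge0.
- by rewrite ler_piMr.
rewrite -(real_normK (num_real _)) ler_pXn2r ?nnegrE ?mulr_ge0//.
rewrite normrM; have f2 := flat_ge0 2 (arg n z).
rewrite [X in _ * X]ger0_norm ?mulr_ge0 ?invr_ge0 ?(ltW e0)//.
apply: le_trans (_ : L * (1 - sqrad z) * ((eps n)^-1 * flat 2 (arg n z)) <= _).
  by rewrite ler_wpM2r ?hL// mulr_ge0 ?invr_ge0 ?(ltW e0).
have -> : L * (1 - sqrad z) * ((eps n)^-1 * flat 2 (arg n z)) =
          L * ((arg n z + 1) * flat 2 (arg n z)).
  by rewrite /arg; move: (flat _ _) => F; field; rewrite gt_eqF.
rewrite ler_wpM2l// mulrDl mul1r.
have -> : arg n z * flat 2 (arg n z) = flat 1 (arg n z).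
  rewrite /flat x0 expr2 expr1 !mulrA mulfV ?mul1r// gt_eqF//.
have := flat_le 1 (arg n z); have := flat_le 2 (arg n z).
by rewrite !factS fact0 /=; lra.
Qed.

Let eps_cvg : eps n @[n --> \oo] --> 0.
Proof. by have := @cvg_harmonic R; rewrite -(cvg_shiftS (@harmonic R)). Qed.

Let rem_cvg z : rem n z @[n --> \oo] --> 0.
Proof.
have [z1|z1] := ltP (sqrad z) 1; last first.
  apply: (@cvg_trans _ ((fun=> 0 : R) @ \oo)); last exact: cvg_cst.
  apply: near_eq_cvg; apply: nearW => n.
  by rewrite rem_out//; have := eps_gt0 n; lra.
pose c := (1 - sqrad z) / 2; have c0 : 0 < c by rewrite divr_gt0// subr_gt0.
apply: (@squeeze_cvgr _ _ _ _ (fun=> 0 : R)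
   (fun n => 4 * sqrad z * (w z * (c ^- 2 * eps n)) ^+ 2) (fun n => rem n z)).
- near=> n; rewrite rem_ge0 /= remE ler_wpM2l ?mulr_ge0 ?sqrad_ge0//.
  have e0 := eps_gt0 n; have ec : eps n <= c by near: n; exact: cvgr_le eps_cvg _ c0.
  rewrite !exprMn ler_wpM2l ?sqr_ge0//.
  rewrite -!exprMn ler_pXn2r ?nnegrE ?mulr_ge0 ?flat_ge0 ?invr_ge0 ?exprn_ge0 ?(ltW e0) ?(ltW c0)//.
  have ac : c / eps n <= arg n z.
    by rewrite /arg ler_wpM2r ?invr_ge0 ?(ltW e0)//; rewrite /c in ec *; lra.
  have ce0 : 0 < c / eps n by rewrite divr_gt0.
  have a0 : 0 < arg n z by apply: lt_le_trans ac.
  have f2 : flat 2 (arg n z) <= (c / eps n) ^- 2.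
    rewrite /flat a0; apply: le_trans (_ : (arg n z)^-1 ^+ 2 <= _).
      by rewrite ler_piMr ?exprn_ge0 ?invr_ge0 ?(ltW a0)// -expR0 ler_expR oppr_le0 invr_ge0 ltW.
    rewrite -exprVn ler_pXn2r ?nnegrE ?invr_ge0 ?(ltW a0) ?(ltW ce0)//.
    by rewrite lef_pV2 ?posrE.
  apply: le_trans (_ : (eps n)^-1 * (c / eps n) ^- 2 <= _).
    by rewrite ler_wpM2l// invr_ge0 ltW.
  rewrite le_eqVlt; apply/orP; left; apply/eqP.
  have idem (x y : R) : 0 < x -> 0 < y -> x^-1 * (y / x) ^- 2 = y ^- 2 * x.
    by move=> x_gt0 y_gt0; field; rewrite !gt_eqF.
  exact: idem.
- exact: cvg_cst.
- have -> : 0 = 4 * sqrad z * ((w z * (c ^- 2 * 0)) * (w z * (c ^- 2 * 0))) :> R.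
    by rewrite !mulr0.
  apply: cvgM; first exact: cvg_cst.
  have H : w z * (c ^- 2 * eps n) @[n --> \oo] --> w z * (c ^- 2 * 0).
    by apply: cvgM; [exact: cvg_cst|apply: cvgM; [exact: cvg_cst|exact: eps_cvg]].
  by under eq_fun do rewrite expr2; apply: cvgM.
Unshelve. all: by end_near. Qed.

Let int_rem_cvg : \int[area R]_z rem n z @[n --> \oo] --> 0.
Proof.
have [C C0 hC] := rem_bound.
have mrem n : measurable_fun setT (rem n).
  apply: continuous_measurable_plane; apply: smooth_continuous.
  apply: smooth_mul; first exact: smooth_sqr.
  by apply: smooth_add; apply: smooth_sqr; apply: smooth_partial.
have H : (\int[area R]_z (rem n z)%:E @[n --> \oo] --> \int[area R]_z (0 : R)%:E)%E.
  apply: (@bbs_dct _ _ _ (area R) rem (fun=> 0) C (box 1)) => //.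
  - exact: measurable_box.
  - exact: area_box.
  - move=> n z zb; apply: rem_out; rewrite leNgt; apply/negP => z1; apply: zb.
    by apply/boxP; apply: sqrad_norm; have := eps_gt0 n; lra.
  - by apply: aeW => z; exact: rem_cvg.
by apply: fine_cvg; move: H; rewrite integral0.
Qed.

Let h n z := w z * eta n z.

Let test_h n : test_function (unit_disc R) (h n).
Proof.
have [se cK KU] := test_eta n.
apply: (test_function_compact (smooth_mul smooth_w se) cK KU).
move=> z /(test_function_zero (test_eta n))[e0 _]; by rewrite -[LHS]/(w z * eta n z) e0 mulr0.
Qed.

(* Near the origin [w > 1 / 2], and [arg n z >= 1 / 2] gives
   [eta n z >= exp (- 2)]. *)
Let mass_bound : exists2 m : R, 0 < m & forall n, m <= \int[area R]_z (h n z ^+ 2).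
Proof.
have w1 : \forall z \near (0 : R * R), 2^-1 < w z.
  have cw : w z @[z --> (0 : R * R)] --> w 0 by exact: smooth_continuous smooth_w 0.
  apply: (cvgr_gt _ cw).
  have s0 : @sqrad R 0 = 0 by rewrite -[LHS]/((0 : R) ^+ 2 + 0 ^+ 2) expr0n /= addr0.
  by rewrite /w s0 mulr0 addr0 bessel0; lra.
have [rho /= rho0 hrho] : exists2 rho : R, 0 < rho & forall z, `|z| < rho -> 2^-1 < w z.
  have /nbhs_ballP[e /= e0 eP] := w1; exists e => // z ze; apply: eP.
  by rewrite -ball_normE /= sub0r normrN.
pose r : R := Num.min (rho / 2) 4^-1.
have r0 : 0 < r by rewrite lt_min divr_gt0//= invr_gt0.
have rrho : r < rho by rewrite gt_min; apply/orP; left; lra.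
have r4 : r <= 4^-1 by rewrite ge_min lexx orbT.
pose c : R := (2^-1 * expR (- 2)) ^+ 2.
have c0 : 0 < c by rewrite exprn_gt0// mulr_gt0// expR_gt0.
have mb := measurable_box r.
have areab : (area R (box r) = ((2 * r) * (2 * r))%:E)%E.
  have L : (@lebesgue_measure R `[(- r)%R, r%R] = (2 * r)%:E)%E.
    rewrite lebesgue_measure_itv/= lte_fin gtrN// -EFinB; congr EFin; ring.
  rewrite product_measure1E; [|exact: measurable_itv|exact: measurable_itv].
  by rewrite /= in L *; rewrite L EFinM.
have bI : bbs (area R) (\1_(box r) : R * R -> R).
  split; first exact: measurable_indic.
  exists 1, (box r); split => //.
  - exact: area_box.
  - by move=> z; rewrite indicE; case: (_ \in _); rewrite ?normr1 ?normr0.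
  - by move=> z zb; rewrite indicE memNset.
exists (c * ((2 * r) * (2 * r))); first by rewrite !mulr_gt0.
move=> n.
have -> : c * ((2 * r) * (2 * r)) = \int[area R]_z (c * (\1_(box r) : R * R -> R) z).
  apply: esym; apply: (etrans (intZ c bI)); congr (c * _).
  by rewrite /Rintegral integral_indic// setIT; exact: (congr1 fine areab).
have [bh _] := test_function_bbs (test_h n).
apply: le_int => [||z]; [exact: bbsZ|exact: bbs_sqr|].
rewrite indicE; have [zb|zb] := pselect (box r z); last first.
  by rewrite memNset// mulr0 sqr_ge0.
rewrite mem_set// mulr1 /c /h ler_pXn2r//; last 2 first.
- by rewrite nnegrE mulr_ge0// expR_ge0.
- rewrite nnegrE mulr_ge0//; last by rewrite etaE flat_ge0.
  apply: ltW; apply: le_lt_trans (hrho z _); first by rewrite invr_ge0.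
  by apply: le_lt_trans rrho; apply/boxP.
have zr : `|z| <= r by apply/boxP.
apply: ler_pM; rewrite ?invr_ge0 ?expR_ge0//.
  by apply: ltW; apply: hrho; exact: le_lt_trans rrho.
have sz : sqrad z <= 4^-1.
  have sq (x : R) : `|x| <= 4^-1 -> x ^+ 2 <= 8^-1.
    move=> hx; rewrite -(real_normK (num_real x)).
    apply: le_trans (_ : 4^-1 ^+ 2 <= _); first by rewrite ler_pXn2r ?nnegrE.
    by rewrite exprVn lef_pV2 ?posrE// -natrX ler_nat.
  have := le_trans zr r4; rewrite prod_normE ge_max => /andP[/sq z1 /sq z2].
  by rewrite /sqrad; lra.
have e0 := eps_gt0 n; have e1 := eps_le n.
have ax : 2^-1 <= arg n z.
  by rewrite /arg ler_pdivlMr//; lra.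
have x0 : 0 < arg n z by apply: lt_le_trans ax; rewrite invr_gt0.
rewrite etaE /flat x0 expr0 mul1r ler_expR lerN2.
by rewrite -[leRHS]invrK lef_pV2 ?posrE// invr_gt0.
Qed.

(** The quotient of [w eta] is [4 t0] plus the remainder over the mass; the
    remainder tends to zero and the mass is bounded below. *)
Lemma lambda1_disc_le : (lambda1 (fun=> 1%:M) (unit_disc R) <= (4 * t0)%:E)%E.
Proof.
have [m m0 hm] := mass_bound.
apply/lee_addgt0Pr => e e0.
have em0 : 0 < e * m by rewrite mulr_gt0.
have [n hn] : exists n, \int[area R]_z rem n z <= e * m.
  have [n _ hn] : \forall n \near \oo, \int[area R]_z rem n z <= e * m.
    by apply: (cvgr_le 0) em0; exact: int_rem_cvg.
  by exists n; exact: (hn n (leqnn n)).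
have N0 : 0 < \int[area R]_z (h n z ^+ 2) by exact: lt_le_trans (hm n).
have E := eigenfunction_cutoff smooth_w (test_eta n) laplacian_w.
set N := (\int[area R]_z (h n z ^+ 2)) in N0.
have L : (lambda1 (fun=> 1%:M) (unit_disc R) <=
    ((4 * t0 * N + \int[area R]_z rem n z) / N)%:E)%E.
  apply: (@lambda1_le_quotient R _ (h n)) .
  - exact: open_unit_disc.
  - exact: test_h.
  - exact: (esym E).
  - by [].
  - exact: N0.
apply: le_trans L _.
rewrite -EFinD lee_fin ler_pdivrMr// (mulrDl (4 * t0) e N) lerD2l.
apply: le_trans hn _; rewrite ler_wpM2l ?(ltW e0)//; exact: hm.
Qed.

End disc_eigenvalue.

(** * The comparison of eigenvalues *)

Section conclusion.
Variable R : realType.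

Lemma volume_preserving_form (Omega : set (R * R)) (A : R * R -> 'M[R]_2) :
  M22 Omega A -> volume_preserving_infty_regular A Omega ->
  exists phi (Dphi : R * R -> 'M[R]_2) (K : R),
    [/\ 0 <= K, (forall z, Omega z -> (phi z).1 ^+ 2 + (phi z).2 ^+ 2 < 1),
        weak_differential Omega phi Dphi,
        {ae area R, forall z, Omega z ->
          \det (Dphi z) = 1 /\ forall i j, `|Dphi z i j| <= K} &
        {ae area R, forall z, Omega z -> forall u,
          inner (A z *m u) u = cof_form (Dphi z) u}].
Proof.
move=> [symA _ detA [K K1 ellA]] [phi [psi [Dphi [Dpsi [[[qc bel] _ _] vol]]]]].
have [[_ phiO _ _ _] [wd _ _] _] := qc.
have good : {ae area R, forall z, Omega z ->
    [/\ \det (Dphi z) = 1, forall u, inner (A z *m u) u = cof_form (Dphi z) u &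
        forall i j, `|Dphi z i j| <= K]}.
  apply: filterS3 (filterI detA ellA) bel vol => z [dA eA] bz vz Oz.
  by apply: beltrami_unimodular; [exact: symA|exact: dA|exact: K1|exact: eA|exact: bz|exact: vz].
exists phi, Dphi, K; split => //.
- exact: le_trans ler01 K1.
- by move=> z Oz; apply: (phiO (phi z)); exists z.
- by apply: filterS good => z gz Oz; have [] := gz Oz.
- by apply: filterS good => z gz Oz; have [] := gz Oz.
Qed.

End conclusion.

Theorem corollary4p2 (R : realType) (Omega : set (R * R))
    (A : R * R -> 'M[R]_2)
    (Omega_sc : simply_connected_domain Omega)
    (A_M22 : M22 Omega A)
    (Omega_vp : volume_preserving_infty_regular A Omega) :
  (lambda1 (fun=> 1%:M) (unit_disc R) <= lambda1 A Omega)%E.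
Proof.
have [oO _ _ _] := Omega_sc.
have mO := open_measurable_plane oO.
have [phi [Dphi [K [K0 phiD wd Dgood AD]]]] := volume_preserving_form A_M22 Omega_vp.
have mD i j : measurable_fun Omega (fun z => Dphi z i j) by have [_ [m _] _] := wd i j.
apply/ereal_infP => _ [f [g [wfg f0 ->]]].
have ray t : 0 <= t -> (forall s, 0 <= s -> s <= t -> 0 < @bessel R 0 s) ->
    ((4 * t)%:E * sqL2norm Omega f <= energy A Omega g)%E.
  move=> t0 pos; apply: (rayleigh_closure _ oO mD AD _ wfg); first by rewrite mulr_ge0.
  by move=> h; exact: (picone_map t0 pos K0 oO phiD wd Dgood).
have [n n0 nE] : exists2 n : R, 0 < n & sqL2norm Omega f = n%:E.
  have [[/(_ 0)[[mf _] _ _] foo _] N0] := (wfg, sqL2norm_ge0 Omega f).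
  have Noo : (sqL2norm Omega f < +oo)%E.
    rewrite -ge0_fin_numE// -(sqrte_fin_num N0) ge0_fin_numE ?sqrte_ge0//.
    by apply: le_lt_trans foo; rewrite leeDl// sqrte_ge0.
  have Nfin : sqL2norm Omega f \is a fin_num by rewrite ge0_fin_numE.
  exists (fine (sqL2norm Omega f)); last by rewrite fineK.
  rewrite -lte_fin fineK// lt_neqAle N0 andbT; apply/eqP => /esym Nz; apply: f0.
  have mf2 : measurable_fun Omega (fun z => (`|f z| ^+ 2)%:E).
    by apply/measurable_EFinP; apply: measurable_funX; exact: measurableT_comp.
  have /(ae_eq_integral_abs (area R) mO mf2) f20 :
      (\int[area R]_(z in Omega) `|(`|f z| ^+ 2)%:E|)%E = 0%E.
    by rewrite -[RHS]Nz; apply: eq_integral => z _; rewrite gee0_abs.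
  apply: filterS f20 => z + Oz => /(_ Oz) /= -[].
  by move=> /eqP; rewrite expf_eq0/= normr_eq0 => /eqP.
rewrite nE; have ray' t : 0 <= t -> (forall s, 0 <= s -> s <= t -> 0 < @bessel R 0 s) ->
    ((4 * t)%:E <= energy A Omega g / n%:E)%E.
  by move=> t0 pos; rewrite inver gt_eqF// lee_pdivlMr// -nE ray.
have [pos|[t0 [t0_gt0 bt0 pos]]] := @bessel_first_zero R.
  have -> : (energy A Omega g / n%:E)%E = +oo%E.
    apply/eqyP => a a0; have -> : a = 4 * (a / 4) by field.
    by apply: ray' => [|s s0 _]; [rewrite divr_ge0// ltW|exact: pos].
  exact: leey.
apply: le_trans (lambda1_disc_le t0_gt0 bt0) _.
apply/lee_addgt0Pr => e e0; pose t := Num.max 0 (t0 - e / 4).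
have tt0 : t < t0 by rewrite gt_max t0_gt0 /=; lra.
have te : t0 - e / 4 <= t by rewrite le_max lexx orbT.
apply: le_trans (_ : ((4 * t)%:E + e%:E <= _)%E).
  by rewrite -EFinD lee_fin; lra.
apply: leeD2r; apply: ray' => [|s s0 st]; first by rewrite le_max lexx.
by apply: pos => //; exact: le_lt_trans tt0.
Qed.
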